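(* Let $0\le r<q$, and assume the isotropic experiment, i.e. the reduced covariance $\mathcal S_{P_s}$ is proportional to the identity on $\mathbb S^{k_s}$ on every rank stratum. Let $c_{\alpha,r}^{\mathrm{top}}$ be a positive upper-$\alpha$ critical value of the isotropic top-stratum law, i.e. of the law of $\sum_{j=1}^{q-r}\{\lambda_j(G)_+\}^2$ with $G$ standard Gaussian in $\mathbb S^{q-r}$. Let $\theta_0=(\psi_0,\Sigma_0)$ with $\Sigma_0\succeq0$ of rank $s\le r$, let the LAN assumption and the local set convergence and localisation assumption (both stated in the context) hold at $\theta_0$, and let $t\mapsto\theta(t)\in\Theta_0$ be a null path with $\theta(t)=\theta_0+t(a,H)+o(t)$ as $t\downarrow0$, $\theta_n=\theta(n^{-1/2})$. Then $$\limsup_{n\to\infty}\Pr_{\theta_n}\{\Lambda_n>c_{\alpha,r}^{\mathrm{top}}\}\le\alpha.$$ The same conclusion holds uniformly over compact drift families (families of such null paths whose drifts $(a,H)$ range over a compact set, with the supremum over the family taken inside the $\limsup$) whenever the LAN and localisation assumptions hold uniformly over those families.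
   Context: Spaces. $\mathbb S^d$ is the space of real symmetric $d\times d$ matrices with Frobenius inner product $\langle A,B\rangle_F=\operatorname{tr}(AB)$; $\mathbb S_+^d$ is its positive-semidefinite cone. $\mathcal E=\mathbb R^{d_\psi}\oplus\mathbb S^q$ with inner product $\langle(a,A),(b,B)\rangle=a^\top b+\langle A,B\rangle_F$. Eigenvalues are ordered decreasingly and $x_+=\max(x,0)$. A standard Gaussian element of $\mathbb S^d$ has independent $N(0,1)$ coordinates in the Frobenius-orthonormal basis $E_{ii}$, $F_{ij}=(E_{ij}+E_{ji})/\sqrt2$, $i<j$. The upper-$\alpha$ critical value of a distribution function $F$ is $\inf\{c:F(c)\ge1-\alpha\}$, $\alpha\in(0,1)$. Experiment. The parameter is $\theta=(\psi,\Sigma)\in\mathcal E$, with $\psi$ a nuisance parameter; $\Pr_\theta$ is the law of the data and $\ell_n(\theta)$ the sample log-likelihood at sample size $n$. The model admits a regular local extension to an open neighbourhood of $\theta_0$. The null and alternative parameter sets $\Theta_0\subseteq\Theta_1$ have the following restrictions on the matrix component: $\Sigma\succeq0$ and $\operatorname{rank}(\Sigma)\le r$ for $\Theta_0$; $\Sigma\succeq0$ for $\Theta_1$. The parameter $\theta_0$ lies in $\Theta_0$. The likelihood-ratio statistic is $\Lambda_n=2\{\sup_{\theta\in\Theta_1}\ell_n(\theta)-\sup_{\theta\in\Theta_0}\ell_n(\theta)\}$. Active block. $K_s=\ker(\Sigma_0)$, $k_s=q-s$, $m_s=r-s$, $P_s$ is the orthogonal projector onto $K_s$, $U_s\in\mathbb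 R^{q\times k_s}$ has orthonormal columns spanning $K_s$; $\mathcal A_{P_s}(H)=U_s^\top HU_s$ and $\mathcal A_{P_s}^*(B)=U_sBU_s^\top$. For $0\le m\le k$, $\mathcal K_m^k=\{B\in\mathbb S_+^k:\operatorname{rank}(B)\le m\}$. Put $T_1(P_s)=\{H\in\mathbb S^q:\mathcal A_{P_s}(H)\succeq0\}$ and $T_{0,s}^{(r)}(P_s)=\{H\in\mathbb S^q:\mathcal A_{P_s}(H)\in\mathcal K_{m_s}^{k_s}\}$. LAN assumption. There exist random elements $Z_n\in\mathcal E$ and a self-adjoint positive-definite operator $\mathcal I$ on $\mathcal E$ such that, under $\Pr_{\theta_0}$, for every compact $C\subset\mathcal E$, $\sup_{h\in C}|\ell_n(\theta_0+n^{-1/2}h)-\ell_n(\theta_0)-\langle h,Z_n\rangle+\frac12\langle h,\mathcal Ih\rangle|\to0$ in probability, and $Z_n\Rightarrow Z\sim\mathcal N_{\mathcal E}(0,\mathcal I)$. Local set convergence and localisation assumption. The rescaled sets $\{h:\theta_0+n^{-1/2}h\in\Theta_0\}$ and $\{h:\theta_0+n^{-1/2}h\in\Theta_1\}$ converge on bounded sets (i.e. in Hausdorff distance after intersection with every closed bounded ball) to $\mathbb R^{d_\psi}\oplus T_{0,s}^{(r)}(P_s)$ and $\mathbb R^{d_\psi}\oplus T_1(P_s)$, respectively, and the corresponding local constrained maximisers of $h\mapsto\ell_n(\theta_0+n^{-1/2}h)$ over these rescaled sets are stochastically bounded. Reduced covariance. Partition $\mathcal I$ according to $\mathcal E=\mathbb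 R^{d_\psi}\oplus\mathbb S^q$ and set $\mathcal I_{\mathrm{eff}}=\mathcal I_{\Sigma\Sigma}-\mathcal I_{\Sigma\psi}\mathcal I_{\psi\psi}^{-1}\mathcal I_{\psi\Sigma}$ and $\mathcal S_{P_s}=\mathcal A_{P_s}\mathcal I_{\mathrm{eff}}^{-1}\mathcal A_{P_s}^*$, a self-adjoint positive-definite operator on $\mathbb S^{k_s}$. *)

(* Defs.v *)
From HB Require Import structures.
From mathcomp Require Import all_boot all_order all_algebra.
From mathcomp Require Import all_classical all_reals all_analysis.
From mathcomp Require Import measurable_realfun.

Set Implicit Arguments.
Unset Strict Implicit.
Unset Printing Implicit Defensive.

Import Order.TTheory GRing.Theory Num.Theory.
Import numFieldNormedType.Exports.

Local Open Scope classical_set_scope.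
Local Open Scope ring_scope.

Definition skew_part (R : realType) (n : nat) (A : 'M[R]_n) := A - A^T.

Lemma skew_part_is_linear (R : realType) (n : nat) :
  linear (@skew_part R n).
Proof.
move=> a A B; apply/matrixP => i j.
by rewrite !mxE mulrBr opprD addrACA.
Qed.

HB.instance Definition _ (R : realType) (n : nat) :=
  GRing.isLinear.Build R 'M[R]_n 'M[R]_n _ (@skew_part R n)
    (@skew_part_is_linear R n).

Definition symv (R : realType) (n : nat) : {vspace 'M[R]_n} :=
  lker (linfun (@skew_part R n)).

Lemma symvP (R : realType) (n : nat) (A : 'M[R]_n) :
  reflect (A^T = A) (A \in symv R n).
Proof.
rewrite memv_ker lfunE /= subr_eq0.
by apply: (iffP eqP) => /esym.
Qed.

Definition sym (R : realType) (n : nat) := subvs_of (symv R n).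

HB.instance Definition _ (R : realType) (n : nat) :=
  Vector.copy (sym R n) (subvs_of (symv R n)).

(* The topology of S^n is the one induced by the ambient matrix space. *)
HB.instance Definition _ (R : realType) (n : nat) :=
  PseudoMetric.copy (sym R n)
    (initial_topology (vsval : subvs_of (symv R n) -> 'M[R]_n)).

Definition param (R : realType) (d q : nat) : Type := ('cV[R]_d * sym R q)%type.

Section Spaces.
Variables (R : realType) (d q : nat).
Implicit Types (x y : param R d q) (A B : set (param R d q)).

Definition inner x y : R :=
  (x.1^T *m y.1) 0 0 + \tr (vsval x.2 *m vsval y.2).

Definition enorm x : R := Num.sqrt (inner x x).

Definition hausdorff A B : \bar R :=
  maxe
    (ereal_sup [set ereal_inf [set (enorm (x - y))%:E | y in B] | x in A])
    (ereal_sup [set ereal_inf [set (enorm (x - y))%:E | x in A] | y in B]).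

Definition converges_on_bounded (A_ : nat -> set (param R d q)) A :=
  forall rho : R, 0 < rho ->
    hausdorff (A_ n `&` [set x | enorm x <= rho])
              (A `&` [set x | enorm x <= rho]) @[n --> \oo] --> 0%E.

End Spaces.

Definition psd (R : realType) (n : nat) (A : sym R n) : Prop :=
  forall x : 'cV[R]_n, 0 <= (x^T *m vsval A *m x) 0 0.

Definition psd_rank_le (R : realType) (n m : nat) : set (sym R n) :=
  [set B | psd B /\ (\rank (vsval B) <= m)%N].

(* The eigenvalues with multiplicity in decreasing order. *)
Definition eigenvalues (R : realType) (n : nat) (A : 'M[R]_n) : seq R :=
  xget [::] [set e | sorted >=%R e /\ char_poly A = \prod_(x <- e) ('X - x%:P)].

(* The index j counts from 0. *)
Definition lambda (R : realType) (n : nat) (A : sym R n) (j : nat) : R :=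
  nth 0 (eigenvalues (vsval A)) j.

Section ActiveBlock.
Variables (R : realType) (q : nat).

(* The columns of U form an orthonormal basis of ker Sigma. *)
Definition kernel_frame (Sigma : sym R q) (k : nat) (U : 'M[R]_(q, k)) : Prop :=
  U^T *m U = 1%:M /\ (U^T == kermx ((vsval Sigma)^T))%MS.

(* On symmetric arguments the projection vsproj acts as the identity. *)
Definition compress (k : nat) (U : 'M[R]_(q, k)) : 'Hom(sym R q, sym R k) :=
  linfun (fun H : sym R q => vsproj (symv R k) (U^T *m vsval H *m U)).

Definition compress_adj (k : nat) (U : 'M[R]_(q, k)) : 'Hom(sym R k, sym R q) :=
  linfun (fun B : sym R k => vsproj (symv R q) (U *m vsval B *m U^T)).

Variable d : nat.

Definition cone1 (k : nat) (U : 'M[R]_(q, k)) : set (param R d q) :=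
  [set h | psd (compress U h.2)].

Definition cone0 (k m : nat) (U : 'M[R]_(q, k)) : set (param R d q) :=
  [set h | psd_rank_le m (compress U h.2)].

End ActiveBlock.

Section Information.
Variables (R : realType) (d q : nat).

Definition self_adjoint (I : 'End(param R d q)) : Prop :=
  forall x y, inner (I x) y = inner x (I y).

Definition positive_definite (I : 'End(param R d q)) : Prop :=
  forall x, x != 0 -> 0 < inner x (I x).

Definition in_psi : 'Hom('cV[R]_d, param R d q) := linfun (fun a => (a, 0)).
Definition in_sigma : 'Hom(sym R q, param R d q) := linfun (fun H => (0, H)).
Definition pr_psi : 'Hom(param R d q, 'cV[R]_d) := linfun fst.
Definition pr_sigma : 'Hom(param R d q, sym R q) := linfun snd.

Definition efficient_information (I : 'End(param R d q)) : 'End(sym R q) :=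
  ((pr_sigma \o I \o in_sigma)
   - ((pr_sigma \o I \o in_psi) \o (pr_psi \o I \o in_psi)^-1
      \o (pr_psi \o I \o in_sigma)))%VF.

Definition reduced_covariance (k : nat) (I : 'End(param R d q))
    (U : 'M[R]_(q, k)) : 'End(sym R k) :=
  (compress U \o (efficient_information I)^-1 \o compress_adj U)%VF.

End Information.

Section Gaussian.
Variables (R : realType) (dT : measure_display) (T : measurableType dT)
  (P : probability T R).

Definition random_element (V : topologicalType) (X : T -> V) : Prop :=
  forall O : set V, open O -> measurable (X @^-1` O).

Definition centred_gaussian (d q : nat) (I : 'End(param R d q))
    (Z : T -> param R d q) : Prop :=
  random_element Z /\
  forall (h : param R d q) (B : set R), h != 0 -> measurable B ->
    P ((fun w => inner h (Z w)) @^-1` B)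
    = normal_prob 0 (Num.sqrt (inner h (I h))) B.

Definition mutually_independent (J : finType) (X : J -> T -> R) : Prop :=
  forall (S : {set J}) (B : J -> set R), (forall j, measurable (B j)) ->
    P (\bigcap_(j in [set` S]) (X j @^-1` B j))
    = (\prod_(j in S) P (X j @^-1` B j))%E.

Definition sym_basis (n : nat) (ij : 'I_n * 'I_n) : 'M[R]_n :=
  if ij.1 == ij.2 then delta_mx ij.1 ij.1
  else (Num.sqrt 2)^-1 *: (delta_mx ij.1 ij.2 + delta_mx ij.2 ij.1).

Definition sym_coord (n : nat) (G : T -> sym R n)
    (ij : {ij : 'I_n * 'I_n | (ij.1 <= ij.2)%N}) (w : T) : R :=
  \tr (vsval (G w) *m sym_basis (val ij)).

Definition standard_gaussian (n : nat) (G : T -> sym R n) : Prop :=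
  [/\ random_element G,
      forall ij (B : set R), measurable B ->
        P (sym_coord G ij @^-1` B) = normal_prob 0 1 B
    & mutually_independent (sym_coord G)].

(* The distribution function of sum_j {lambda_j(G)_+}^2. *)
Definition top_stratum_cdf (n : nat) (G : T -> sym R n) (c : R) : R :=
  fine (P [set w | \sum_(j < n) Num.max (lambda (G w) j) 0 ^+ 2 <= c]).

End Gaussian.

Definition upper_critical (R : realType) (F : R -> R) (alpha : R) : R :=
  inf [set c | 1 - alpha <= F c].

(* The observation at sample size n lives in obs n.  The set ext is the
   parameter set of the (locally extended) model: law and loglik carry no
   information outside of it.  The log-likelihood is -oo where the density
   vanishes. *)
Record experiment (R : realType) (d q : nat) := Experiment {
  disp : nat -> measure_display;
  obs : forall n, measurableType (disp n);
  dominating : forall n, {measure set (obs n) -> \bar R};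
  ext : set (param R d q);
  law : forall n, param R d q -> probability (obs n) R;
  loglik : forall n, param R d q -> obs n -> \bar R;
  measurable_loglik : forall n theta, ext theta ->
    measurable_fun setT (@loglik n theta);
  law_density : forall n theta A, ext theta -> measurable A ->
    law n theta A = (\int[dominating n]_(w in A) expeR (loglik theta w))%E
}.

Definition rate (R : realType) (n : nat) : R := (Num.sqrt n%:R)^-1.

Section Likelihood.
Variables (R : realType) (d q : nat) (X : experiment R d q).

Local Notation E := (param R d q).
Local Notation score := (forall n, obs X n -> E).

(* Outer probability: events that involve suprema over the parameter need not
   be measurable.  It agrees with law X n theta on measurable events. *)
Definition outer_pr (n : nat) (theta : E) (A : set (obs X n)) : \bar R :=
  mu_ext (law X n theta) A.

Definition sup_loglik (Theta : set E) (n : nat) (w : obs X n) : \bar R :=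
  ereal_sup [set loglik theta w | theta in Theta].

Definition lr_stat (Theta0 Theta1 : set E) (n : nat) (w : obs X n) : \bar R :=
  (2%:E * (sup_loglik Theta1 w - sup_loglik Theta0 w))%E.

Definition local_point (theta0 : E) (n : nat) (h : E) : E :=
  theta0 + rate R n *: h.

Definition rescaled (Theta : set E) (theta0 : E) (n : nat) : set E :=
  [set h | Theta (local_point theta0 n h)].

Definition lan_error (theta0 : E) (I : 'End(E)) (Z : score) (n : nat)
    (theta h : E) (w : obs X n) : \bar R :=
  (`|loglik theta w - loglik theta0 w
     - (inner h (Z n w))%:E + (2^-1 * inner h (I h))%:E|)%E.

Definition converges_in_law (theta0 : E) (Z : score) (dT : measure_display)
    (T : measurableType dT) (P : probability T R) (Zlim : T -> E) : Prop :=
  forall f : E -> R, continuous f -> (exists M, forall x, `|f x| <= M) ->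
    (\int[law X n theta0]_w (f (Z n w))%:E @[n --> \oo]
      --> \int[P]_w (f (Zlim w))%:E)%E.

Definition lan (theta0 : E) (I : 'End(E)) (Z : score) : Prop :=
  [/\ self_adjoint I /\ positive_definite I,
      forall n, random_element (Z n),
      forall (C : set E) (eps : R), compact C -> 0 < eps ->
        (outer_pr theta0 [set w : obs X n | (eps%:E <
            ereal_sup [set lan_error theta0 I Z (local_point theta0 n h) h w
                      | h in C])%E])
          @[n --> \oo] --> 0%E
    & exists (dT : measure_display) (T : measurableType dT)
        (P : probability T R) (Zlim : T -> E),
        centred_gaussian P I Zlim /\ converges_in_law theta0 Z P Zlim].

(* Uniform LAN expansion along paths theta k n with drifts h k. *)
Definition lan_along (theta0 : E) (I : 'End(E)) (Z : score) (K : Type)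
    (theta : K -> nat -> E) (h : K -> E) : Prop :=
  forall eps : R, 0 < eps ->
    (ereal_sup [set outer_pr theta0 [set w : obs X n |
        (eps%:E < lan_error theta0 I Z (theta k n) (h k) w)%E] | k in setT])%E
      @[n --> \oo] --> 0%E.

Definition local_maximiser (Theta : set E) (theta0 : E) (n : nat)
    (w : obs X n) (h : E) : Prop :=
  rescaled Theta theta0 n h /\
  forall h', rescaled Theta theta0 n h' ->
    (loglik (local_point theta0 n h') w <= loglik (local_point theta0 n h) w)%E.

(* Stochastically bounded constrained maximisers, uniformly in k, when the
   data at sample size n are drawn from law n (theta k n). *)
Definition localised_along (Theta : set E) (theta0 : E) (K : Type)
    (theta : K -> nat -> E) : Prop :=
  exists hhat : score, forall eps : R, 0 < eps ->
    exists M : R, \forall n \near \oo, forall k : K,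
      (outer_pr (theta k n)
         [set w : obs X n | ~ (local_maximiser Theta theta0 w (hhat n w) /\
                     (enorm (hhat n w) <= M)%R)]
       <= eps%:E)%E.

Definition localised (Theta : set E) (theta0 : E) : Prop :=
  localised_along Theta theta0 (fun (_ : unit) (_ : nat) => theta0).

Definition isotropic_experiment (Theta0 : set E) (r : nat) : Prop :=
  forall (s : nat) (theta0 : E) (U : 'M[R]_(q, q - s)) (I : 'End(E))
    (Z : score),
    (s <= r)%N -> Theta0 theta0 -> \rank (vsval theta0.2) = s ->
    nbhs theta0 (ext X) -> kernel_frame theta0.2 U -> lan theta0 I Z ->
    exists c : R, reduced_covariance I U = c *: \1%VF.

End Likelihood.

Definition null_path (R : realType) (d q : nat) (Theta0 : set (param R d q))
    (theta0 h : param R d q) (theta : R -> param R d q) : Prop :=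
  (forall t, 0 < t -> Theta0 (theta t)) /\
  enorm (theta t - theta0 - t *: h) / t @[t --> 0^'+] --> 0.

Definition local_set_convergence (R : realType) (d q s r : nat)
    (Theta0 Theta1 : set (param R d q)) (theta0 : param R d q)
    (U : 'M[R]_(q, q - s)) : Prop :=
  converges_on_bounded (rescaled Theta0 theta0) (cone0 (r - s) U) /\
  converges_on_bounded (rescaled Theta1 theta0) (cone1 U).

(* Main.v *)
Require Import Defs.
From HB Require Import structures.
From mathcomp Require Import all_boot all_order all_algebra complex.
From mathcomp Require Import all_classical all_reals all_analysis.
From mathcomp Require Import measurable_realfun.

From mathcomp Require Import ring lra zify.

Set Implicit Arguments.
Unset Strict Implicit.
Unset Printing Implicit Defensive.

Import Order.TTheory GRing.Theory Num.Theory.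
Import numFieldNormedType.Exports.

Local Open Scope classical_set_scope.
Local Open Scope ring_scope.

(** The critical value is calibrated on the top stratum, yet it controls the
    size at every lower stratum and along every null drift [h]. The reason is a
    domination of the likelihood ratio of the limiting experiment that depends
    on the drift.

    In that experiment the score [z] is Gaussian with covariance [I] under
    [theta0], and the log-likelihood ratio of [h] is [lan_form I h z]. By
    isotropy, maximising it over the two cones is projecting one symmetric
    matrix of size [k = q - s], the normalised active block [active_score z],
    onto the positive semidefinite cone and onto its matrices of rank at most
    [m = r - s]. Let [V] have [p = q - r] orthonormal columns. Truncating the
    positive part along the range of [V] shows ([psd_rank_truncation],
    [lr_bound]) that the likelihood ratio is at most
    [pos_sqnorm (V^T *m active_score z *m V)], the sum of the squared positive
    eigenvalues of the compression [reduced_score z], a matrix of size [q - r].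

    A null drift [h] has an active block of rank at most [m]
    ([null_path_drift]), so [V] can be chosen orthogonal to it
    ([kernel_orthonormal]). Then [reduced_score z] is independent of [<h, z>],
    and since the law under the drift is the law under [theta0] tilted by
    [exp (lan_form I h z)], the reduced score remains standard Gaussian under
    the drift ([tilted_pos_sqnorm]). The likelihood ratio is therefore
    dominated by a variable with the top-stratum law, and that law has no atom
    at a positive critical value ([sym_gaussian_no_atom],
    [critical_value_left]).

    The passage to finite sample sizes avoids weak convergence under the
    drifting laws. On a bounded set of scores, where the expansion holds, the
    statistic is at most its limiting bound up to a small constant
    ([lr_stat_le]), while the drifting law is bounded below by the tilted law
    under [theta0]; applied to a continuous bump function of the score this
    bounds the rejection probability from above ([lan_transfer],
    [local_size]). All estimates hold for drifts near a given one, whence the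
    uniformity over compact sets of drifts ([uniform_size]). For a single path,
    the expansion and the localisation along the path follow from those at
    [theta0] ([null_path_weak_lan], [null_path_localised]). *)

(** * Spectral theorem for real symmetric matrices *)

Section Entries.
Context {R : pzRingType} {m n : nat}.
Implicit Types (A B : 'M[R]_(m, n)).

Lemma entryD A B i j : (A + B) i j = A i j + B i j. Proof. exact: mxE. Qed.

Lemma entryB A B i j : (A - B) i j = A i j - B i j. Proof. by rewrite !mxE. Qed.

Lemma entryZ a A i j : (a *: A) i j = a * A i j. Proof. exact: mxE. Qed.

End Entries.

Lemma row_sqnorm_ge0 (R : realDomainType) n (v : 'rV[R]_n) : 0 <= (v *m v^T) 0 0.
Proof. by rewrite mxE sumr_ge0// => i _; rewrite mxE -expr2 sqr_ge0. Qed.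

Lemma row_sqnorm_eq0 (R : realDomainType) n (v : 'rV[R]_n) :
  ((v *m v^T) 0 0 == 0) = (v == 0).
Proof.
apply/eqP/eqP => [|->]; last by rewrite mul0mx mxE.
rewrite mxE => /eqP; rewrite psumr_eq0; last first.
  by move=> i _; rewrite mxE -expr2 sqr_ge0.
move/allP => h; apply/rowP => i; move: (h i); rewrite mem_index_enum => /(_ isT).
by rewrite mxE -expr2 sqrf_eq0 => /eqP ->; rewrite mxE.
Qed.

Lemma row_dot_sym (R : comPzRingType) n (v w : 'rV[R]_n) :
  (v *m w^T) 0 0 = (w *m v^T) 0 0.
Proof. by rewrite !mxE; apply: eq_bigr => i _; rewrite !mxE mulrC. Qed.

(** For a complex eigenvector [x + i y] with eigenvalue [a + i b], symmetry
    gives [b (|x|^2 + |y|^2) = 0]; hence [b = 0] and [x] or [y] is a real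
    eigenvector. *)
Lemma sym_eigenvector (R : rcfType) n (A : 'M[R]_n.+1) : A^T = A ->
  exists a : R, exists2 v : 'rV[R]_n.+1, v *m A = a *: v & v != 0.
Proof.
move=> symA.
pose toC := complex.real_complex R.
have [l /eigenvalueP[w wA w0]] :=
  @eigenvalue_closed (complex.complex R) n.+1 (map_mx toC A) isT.
pose x : 'rV[R]_n.+1 := map_mx (@complex.Re R) w.
pose y : 'rV[R]_n.+1 := map_mx (@complex.Im R) w.
case: l wA => a b wA.
have xA : x *m A = a *: x - b *: y.
  apply/rowP => j; move/rowP : wA => /(_ j) /(congr1 (@complex.Re R)).
  rewrite !mxE raddf_sum => /=.
  case: (w 0 j) => /= u v <-; apply: eq_bigr => i _; rewrite !mxE.
  by case: (w 0 i) => /= u' v'; rewrite mulr0 subr0.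
have yA : y *m A = a *: y + b *: x.
  apply/rowP => j; move/rowP : wA => /(_ j) /(congr1 (@complex.Im R)).
  rewrite !mxE raddf_sum => /=.
  case: (w 0 j) => /= u v <-; apply: eq_bigr => i _; rewrite !mxE.
  by case: (w 0 i) => /= u' v'; rewrite mulr0 add0r mulrC.
have b0 : b * ((x *m x^T) 0 0 + (y *m y^T) 0 0) = 0.
  have : (x *m A *m y^T) 0 0 = (y *m A *m x^T) 0 0.
    by rewrite [RHS]row_dot_sym trmx_mul symA mulmxA.
  rewrite xA yA mulmxBl mulmxDl -!scalemxAl.
  rewrite entryB entryD !entryZ (row_dot_sym y x); lra.
have xy0 : (x != 0) || (y != 0).
  apply: contraT; rewrite negb_or !negbK => /andP[/eqP x0 /eqP y0].
  case/negP: w0; apply/eqP/rowP => i.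
  move/rowP : x0 => /(_ i); move/rowP : y0 => /(_ i); rewrite !mxE.
  by case: (w 0 i) => /= u v -> ->.
have b0' : b = 0.
  move/eqP: b0; rewrite mulf_eq0 => /orP[/eqP//|].
  rewrite paddr_eq0 ?row_sqnorm_ge0// !row_sqnorm_eq0.
  by move: xy0; case: (x == 0); case: (y == 0).
exists a; case/orP: xy0 => n0.
  by exists x => //; rewrite xA b0' scale0r subr0.
by exists y => //; rewrite yA b0' scale0r addr0.
Qed.

(** A Householder reflection; in the induction below it turns a unit
    eigenvector into the first basis vector. *)
Lemma reflection_exchange (R : rcfType) n (e v : 'rV[R]_n) :
  (e *m e^T) 0 0 = 1 -> (v *m v^T) 0 0 = 1 ->
  exists Q : 'M[R]_n, [/\ Q^T = Q, Q *m Q = 1%:M & e *m Q = v].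
Proof.
move=> ee vv; have [<-|ev] := eqVneq e v.
  by exists 1%:M; split; rewrite ?trmx1 ?mulmx1.
pose u := e - v; pose s := (u *m u^T) 0 0.
have s0 : s != 0 by rewrite row_sqnorm_eq0 subr_eq0.
have uuT : u *m u^T = s%:M by rewrite [LHS]mx11_scalar.
have sE : s = 2 * (1 - (e *m v^T) 0 0).
  rewrite /s /u linearB /= mulmxBl !mulmxBr.
  rewrite !entryB.
  rewrite ee vv (row_dot_sym v e); lra.
have eu : e *m u^T = (s / 2)%:M.
  rewrite [LHS]mx11_scalar /u linearB /= mulmxBr.
  rewrite entryB ee sE.
  congr (_%:M); lra.
exists (1%:M - (2 / s) *: (u^T *m u)); split.
- by rewrite linearB /= linearZ /= trmx_mul trmxK trmx1.
- set X := (2 / s) *: _; have XX : X *m X = X + X.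
    rewrite -scalemxAl -scalemxAr mulmxA -(mulmxA u^T u) uuT mul_mx_scalar.
    rewrite -scalemxAl !scalerA -scalerDl; congr (_ *: _); field; exact: s0.
  by rewrite mulmxBr mulmx1 mulmxBl mul1mx XX opprB addrK subrK.
- rewrite mulmxBr mulmx1 -scalemxAr mulmxA eu mul_scalar_mx scalerA.
  rewrite (_ : 2 / s * (s / 2) = 1) ?scale1r /u; last by field; exact: s0.
  by rewrite opprB addrCA subrr addr0.
Qed.

(** Once a unit eigenvector has been moved to the first basis vector, the
    matrix is block diagonal and the induction applies to the lower block. *)
Lemma sym_spectral (R : rcfType) n (A : 'M[R]_n) : A^T = A ->
  exists O : 'M[R]_n, exists2 d : 'rV[R]_n,
    O *m O^T = 1%:M & A = O^T *m diag_mx d *m O.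
Proof.
elim: n A => [|n IH] A symA.
  by exists 1%:M, 0; rewrite ?trmx1 ?mulmx1//; apply/matrixP => -[].
have [a [v0 v0A v0n]] := sym_eigenvector symA.
pose t := Num.sqrt ((v0 *m v0^T) 0 0).
have t0 : t != 0 by rewrite sqrtr_eq0 -ltNge lt_def row_sqnorm_ge0 row_sqnorm_eq0 v0n.
pose v := t^-1 *: v0.
have vA : v *m A = a *: v by rewrite -scalemxAl v0A scalerA mulrC -scalerA.
have vv : (v *m v^T) 0 0 = 1.
  rewrite linearZ /= -scalemxAl -scalemxAr scalerA mxE.
  have -> : (v0 *m v0^T) 0 0 = t ^+ 2 by rewrite sqr_sqrtr ?row_sqnorm_ge0.
  by rewrite expr2; field; exact: t0.
pose e : 'rV[R]_(1 + n) := row_mx 1%:M 0.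
have ee : (e *m e^T) 0 0 = 1.
  by rewrite tr_row_mx mul_row_col trmx1 trmx0 mulmx0 addr0 mulmx1 mxE.
have [Q [QT QQ eQ]] := @reflection_exchange R n.+1 e v ee vv.
pose B : 'M[R]_(1 + n) := Q *m A *m Q.
have BT : B^T = B by rewrite /B !trmx_mul QT symA mulmxA.
have eB : e *m B = a *: e.
  rewrite /B !mulmxA eQ vA -scalemxAl.
  by congr (_ *: _); rewrite -eQ -mulmxA QQ mulmx1.
have : row_mx (ulsubmx B) (ursubmx B) = row_mx a%:M 0.
  move: eB; rewrite -{1}(submxK B) /e mul_row_block !mul1mx !mul0mx !addr0.
  by rewrite scale_row_mx scaler0 scalemx1.
move/eq_row_mx => [Bul Bur].
have Bdl : dlsubmx B = 0.
  by rewrite -BT -trmx_ursub Bur trmx0.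
have [|O' [d' OO' dE]] := IH (drsubmx B).
  by rewrite trmx_drsub BT.
pose O1 : 'M[R]_(1 + n) := block_mx 1%:M 0 0 O'.
have O1O1 : O1 *m O1^T = 1%:M.
  rewrite /O1 tr_block_mx mulmx_block OO' !trmx0 !mulmx0 !mul0mx !addr0 add0r.
  by rewrite trmx1 mulmx1 -scalar_mx_block.
have BE : O1^T *m diag_mx (row_mx a%:M d') *m O1 = B.
  rewrite diag_mx_row /O1 tr_block_mx !mulmx_block !trmx0.
  rewrite !mulmx0 !mul0mx !addr0 !add0r -dE !mul0mx trmx1 mulmx1 mul1mx.
  rewrite -[B]submxK Bul Bur Bdl; congr block_mx => /=.
    by apply/matrixP => i j; rewrite !ord1 !mxE eqxx mulr1n.
  by rewrite block_mxKdr.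
exists (O1 *m Q); exists (row_mx a%:M d').
  by rewrite trmx_mul QT mulmxA -(mulmxA O1) QQ mulmx1.
have -> : (O1 *m Q)^T *m diag_mx (row_mx a%:M d') *m (O1 *m Q) = Q *m B *m Q.
  by rewrite -BE trmx_mul QT !mulmxA.
by rewrite /B !mulmxA QQ mul1mx -mulmxA QQ mulmx1.
Qed.

(** * Squared norm of the positive part *)

(** [psd A] is convertible to [psdmx (vsval A)]; products and compressions are
    handled as plain matrices. *)
Definition psdmx (R : realType) n (A : 'M[R]_n) : Prop :=
  forall x : 'cV[R]_n, 0 <= (x^T *m A *m x) 0 0.

Lemma mxtrace_gram_ge0 (R : realType) m n (A : 'M[R]_(m, n)) :
  0 <= \tr (A *m A^T).
Proof.
rewrite sumr_ge0// => i _; rewrite mxE sumr_ge0// => j _.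
by rewrite mxE -expr2 sqr_ge0.
Qed.

Lemma mxtrace_gram_eq0 (R : realType) m n (A : 'M[R]_(m, n)) :
  (\tr (A *m A^T) == 0) = (A == 0).
Proof.
apply/eqP/eqP => [/eqP|->]; last by rewrite mul0mx mxtrace0.
rewrite psumr_eq0 => [/allP h|]; last first.
  by move=> i _; rewrite mxE sumr_ge0// => j _; rewrite mxE -expr2 sqr_ge0.
apply/matrixP => i j; move: (h i); rewrite mem_index_enum => /(_ isT).
rewrite mxE psumr_eq0 => [/allP|k _]; last by rewrite mxE -expr2 sqr_ge0.
move=> /(_ j); rewrite mem_index_enum => /(_ isT).
by rewrite mxE -expr2 sqrf_eq0 => /eqP ->; rewrite mxE.
Qed.

Lemma psdmx_gram (R : realType) m n (A : 'M[R]_(m, n)) : psdmx (A^T *m A).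
Proof.
move=> x; rewrite !mulmxA -mulmxA -trmx_mul.
have := row_sqnorm_ge0 (A *m x)^T; by rewrite trmxK.
Qed.

Lemma char_poly_orthogonal (R : realType) n (O : 'M[R]_n) (d : 'rV[R]_n) :
  O *m O^T = 1%:M ->
  char_poly (O^T *m diag_mx d *m O) = \prod_(i < n) ('X - (d 0 i)%:P).
Proof.
move=> OO; have OO' := mulmx1C OO.
rewrite -[RHS](_ : char_poly (diag_mx d) = _); last first.
  rewrite char_poly_trig ?diag_mx_is_trig//.
  by apply: eq_bigr => i _; rewrite mxE eqxx mulr1n.
rewrite /char_poly; set D := diag_mx d.
have -> : char_poly_mx (O^T *m D *m O) =
          map_mx polyC O^T *m char_poly_mx D *m map_mx polyC O.
  rewrite /char_poly_mx mulmxBr mulmxBl !map_mxM /= scalar_mxC -!mulmxA.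
  by rewrite -[X in _ *m X - _]map_mxM OO' map_mx1 mulmx1.
rewrite !det_mulmx mulrAC -det_mulmx -map_mxM OO' map_mx1 det1 mul1r //.
Qed.

(** The statistic of the top-stratum law: for symmetric [A], the squared
    Frobenius norm of the positive part of [A]. *)
Definition pos_sqnorm (R : realType) n (A : 'M[R]_n) : R :=
  \sum_(j < n) Num.max (nth 0 (eigenvalues A) j) 0 ^+ 2.

(** [eigenvalues] is a chosen sequence, but two factorisations of the
    characteristic polynomial are permutations of each other, so that any
    diagonalisation computes the sum. *)
Lemma pos_sqnorm_spectral (R : realType) n (O : 'M[R]_n) (d : 'rV[R]_n) :
  O *m O^T = 1%:M ->
  pos_sqnorm (O^T *m diag_mx d *m O) = \sum_(i < n) Num.max (d 0 i) 0 ^+ 2.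
Proof.
move=> OO; set A := _ *m O; pose s := [seq d 0 i | i <- index_enum 'I_n].
have cA : char_poly A = \prod_(x <- s) ('X - x%:P).
  by rewrite char_poly_orthogonal// big_map.
have [_ eA] : (sorted >=%R (eigenvalues A)) /\
    char_poly A = \prod_(x <- eigenvalues A) ('X - x%:P).
  apply: (@xgetPex _ [::] [set e | sorted >=%R e /\ char_poly A = _]).
  exists (sort >=%R s); split; first by apply: sort_sorted => x y; exact: le_total.
  by rewrite cA; apply: perm_big; rewrite perm_sym perm_sort.
have pe : perm_eq (eigenvalues A) s by apply: prod_XsubC_eq; rewrite -eA.
have sz : size (eigenvalues A) = n.
  by rewrite (perm_size pe) size_map /index_enum -enumT size_enum_ord.
rewrite /pos_sqnorm -[RHS](big_map (fun i => d 0 i) xpredT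
  (fun x => Num.max x 0 ^+ 2)).
rewrite -(perm_big _ pe) /= (big_nth 0) sz big_mkord //.
Qed.

(** In an eigenbasis, [H *m H] is the positive part of [Y], [N] its negative
    part and [E] the projector onto the positive eigenspaces. *)
Lemma positive_part (R : realType) n (Y : 'M[R]_n) : Y^T = Y ->
  exists H E N : 'M[R]_n, [/\ [/\ H^T = H, E^T = E & N^T = N],
    [/\ E *m E = E, E *m H = H & N *m E = 0],
    Y = H *m H - N, psdmx N & pos_sqnorm Y = \tr (H *m H *m (H *m H))].
Proof.
move=> symY; have [Q [d OO YE]] := sym_spectral symY.
have OO' := mulmx1C OO.
pose F (g : R -> R) : 'M[R]_n := Q^T *m diag_mx (map_mx g d) *m Q.
have FT g : (F g)^T = F g by rewrite /F !trmx_mul trmxK tr_diag_mx mulmxA.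
have FM g h : F g *m F h = F (fun x => g x * h x).
  rewrite /F !mulmxA -(mulmxA _ Q) OO mulmx1 -[Q^T *m _ *m diag_mx _]mulmxA mulmx_diag.
  by congr (_ *m diag_mx _ *m _); apply/rowP => i; rewrite !mxE.
have F0 : F (fun=> 0) = 0.
  rewrite /F (_ : map_mx _ _ = 0) ?linear0 ?mulmx0 ?mul0mx//.
  by apply/rowP => i; rewrite !mxE.
pose p (x : R) := Num.max x 0; pose h (x : R) := Num.sqrt (p x).
pose e (x : R) : R := (0 < x)%R%:R; pose m (x : R) := Num.max (- x) 0.
have FE g g' : g =1 g' -> F g = F g'.
  by move=> gg; rewrite /F; congr (_ *m diag_mx _ *m _); apply/rowP => i;
     rewrite !mxE gg.
have hh x : h x * h x = p x by rewrite -expr2 sqr_sqrtr// le_max lexx orbT.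
exists (F h), (F e), (F m); split => //.
- split; rewrite FM.
  + by apply: FE => x; rewrite /e; case: ltP; rewrite ?mulr1 ?mulr0.
  + apply: FE => x; rewrite /e /h /p; case: ltP => x0; rewrite ?mul1r// mul0r.
    by rewrite sqrtr0.
  + rewrite -F0; apply: FE => x; rewrite /e /m; case: ltP => x0.
      by rewrite mulr1; apply/max_idPr; rewrite oppr_le0 ltW.
    by rewrite mulr0.
- rewrite FM YE /F -mulmxBl -mulmxBr -linearB /=.
  congr (_ *m diag_mx _ *m _); apply/rowP => i; rewrite !mxE hh /p /m.
  case: (leP 0 (d 0 i)) => x0.
    by rewrite (max_idPr _) ?oppr_le0// subr0.
  by rewrite (max_idPl _) ?oppr_ge0 ?ltW// sub0r opprK.
- have mm x : m x = Num.sqrt (m x) * Num.sqrt (m x).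
    by rewrite -expr2 sqr_sqrtr// le_max lexx orbT.
  rewrite (FE _ _ mm) -FM -{1}FT; exact: psdmx_gram.
- rewrite !FM YE pos_sqnorm_spectral// /F -mulmxA mxtrace_mulC -mulmxA OO mulmx1.
  rewrite mxtrace_diag; apply: eq_bigr => i _.
  by rewrite !mxE !hh expr2.
Qed.

Lemma psdmx_sqrt (R : realType) n (B : 'M[R]_n) : B^T = B -> psdmx B ->
  exists2 S : 'M[R]_n, S^T = S & B = S *m S.
Proof.
move=> symB psdB; have [Q [d QQ BE]] := sym_spectral symB.
have d0 i : 0 <= d 0 i.
  have := psdB (Q^T *m (delta_mx i 0 : 'cV_n)).
  rewrite BE !trmx_mul trmxK !mulmxA -(mulmxA _ Q Q^T) QQ mulmx1.
  rewrite -(mulmxA _ Q Q^T) QQ mulmx1 trmx_delta -rowE row_diag_mx.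
  by rewrite -scalemxAl mul_delta_mx !mxE !eqxx mulr1.
exists (Q^T *m diag_mx (map_mx Num.sqrt d) *m Q).
  by rewrite !trmx_mul trmxK tr_diag_mx mulmxA.
rewrite BE !mulmxA -(mulmxA _ Q Q^T) QQ mulmx1.
rewrite -[Q^T *m _ *m diag_mx _]mulmxA mulmx_diag; congr (_ *m diag_mx _ *m _).
by apply/rowP => i; rewrite !mxE -expr2 sqr_sqrtr.
Qed.

Lemma mxtraceB (R : pzRingType) n (A B : 'M[R]_n) :
  \tr (A - B) = \tr A - \tr B.
Proof. exact: raddfB. Qed.

Lemma mulmx_delta_entry (R : pzRingType) n (M : 'M[R]_n) i :
  ((delta_mx 0 i : 'rV_n) *m (M *m (delta_mx i 0 : 'cV_n))) 0 0 = M i i.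
Proof. by rewrite -colE -rowE !mxE. Qed.

(** Half of the self-duality of the positive semidefinite cone. *)
Lemma psdmx_mxtrace_ge0 (R : realType) n (A B : 'M[R]_n) :
  B^T = B -> psdmx B -> psdmx A -> 0 <= \tr (B *m A).
Proof.
move=> symB psdB psdA; have [S ST ->] := psdmx_sqrt symB psdB.
rewrite -mulmxA mxtrace_mulC sumr_ge0// => i _.
have := psdA (S *m delta_mx i 0); rewrite trmx_mul ST trmx_delta !mulmxA.
by rewrite -!(mulmxA (delta_mx 0 i)) mulmx_delta_entry.
Qed.

(** Projecting [Y] onto the positive semidefinite cone maximises
    [2 <B, Y> - <B, B>]; with the next lemma, [pos_sqnorm] is thus a supremum of
    affine functions, which is the form used for measurability, continuity and
    comparison. *)
Lemma pos_sqnorm_ge (R : realType) n (Y B : 'M[R]_n) : Y^T = Y ->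
  B^T = B -> psdmx B -> 2 * \tr (B *m Y) - \tr (B *m B) <= pos_sqnorm Y.
Proof.
move=> symY symB psdB.
have [H [E [N [[HT _ _] _ YE psdN ->]]]] := positive_part symY.
have := psdmx_mxtrace_ge0 symB psdB psdN.
have := mxtrace_gram_ge0 (B - H *m H).
rewrite YE mulmxBr mxtraceB [(_ - _)^T]linearB /= trmx_mul HT symB.
rewrite mulmxBl !mulmxBr !mxtraceB.
rewrite (mxtrace_mulC (H *m H) B); lra.
Qed.

Lemma pos_sqnorm_attained (R : realType) n (Y : 'M[R]_n) : Y^T = Y ->
  exists B : 'M[R]_n, [/\ B^T = B, psdmx B,
    pos_sqnorm Y = 2 * \tr (B *m Y) - \tr (B *m B) &
    pos_sqnorm Y = \tr (B *m B)].
Proof.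
move=> symY.
have [H [E [N [[HT ET NT] [EE EH NE] YE psdN pE]]]] := positive_part symY.
have HN : H *m N = 0.
  have := congr1 trmx NE; rewrite trmx_mul ET NT trmx0 => EN.
  by rewrite -[H]HT -EH trmx_mul ET HT -mulmxA EN mulmx0.
exists (H *m H); split => //.
- by rewrite trmx_mul HT.
- by rewrite -{1}HT; exact: psdmx_gram.
- rewrite {2}YE mulmxBr -[H *m H *m N]mulmxA HN mulmx0 subr0 pE; lra.
Qed.

Lemma pos_sqnorm_ge0 (R : realType) n (Y : 'M[R]_n) : 0 <= pos_sqnorm Y.
Proof. by rewrite sumr_ge0// => i _; rewrite sqr_ge0. Qed.

Lemma pos_sqnorm_le (R : realType) n (Y : 'M[R]_n) : Y^T = Y ->
  pos_sqnorm Y <= \tr (Y *m Y).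
Proof.
move=> symY; have [B [symB _ -> _]] := pos_sqnorm_attained symY.
have := mxtrace_gram_ge0 (B - Y); rewrite [(_ - _)^T]linearB /= symB symY.
rewrite mulmxBl !mulmxBr !mxtraceB (mxtrace_mulC Y B); lra.
Qed.

(** Eigenvectors for the eigenvalue zero. For [B] the active block of a drift
    in the null cone, [V] spans the directions along which the drift is not
    seen. *)
Lemma kernel_orthonormal (R : realType) k m p (B : 'M[R]_k) : B^T = B ->
  (\rank B <= m)%N -> (m + p <= k)%N ->
  exists V : 'M[R]_(k, p), V^T *m V = 1%:M /\ B *m V = 0.
Proof.
move=> symB rB mpk; have [Q [d QQ BE]] := sym_spectral symB.
pose Z := [pred i | d 0 i == 0].
have cZ : (p <= #|Z|)%N.
  have : (#|[predC Z]| <= m)%N.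
    apply: leq_trans rB; rewrite BE mxrankMfree; last first.
      by rewrite row_free_unit; case/mulmx1_unit: QQ.
    rewrite -mxrank_tr trmx_mul trmxK mxrankMfree; last first.
      by rewrite row_free_unit; case/mulmx1_unit: QQ.
    pose g (j : 'I_#|[predC Z]|) := enum_val j.
    have : \rank (rowsub g (diag_mx d)) = #|[predC Z]|.
      apply/eqP; rewrite -/(row_free _); apply/row_freeP.
      exists (\matrix_(i, j) (if i == g j then (d 0 i)^-1 else 0)).
      apply/matrixP => i j; rewrite !mxE (bigD1 (g i))//= big1 => [|l lg].
        rewrite addr0 !mxE eqxx mulr1n (inj_eq enum_val_inj) eq_sym.
        case: eqVneq => ij; rewrite ?mulr0// mulfV//.
        by have := enum_valP i; rewrite inE.
      by rewrite !mxE (eq_sym (g i)) (negPf lg) mulr0n mul0r.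
    move=> <-; rewrite rowsubE; apply: leq_trans (mxrankM_maxr _ _) _.
    by rewrite tr_diag_mx.
  move=> h; rewrite -(leq_add2l m) (leq_trans mpk)//.
  by rewrite -[leqLHS]card_ord -(cardC Z) addnC leq_add2r.
pose g (j : 'I_p) : 'I_k := enum_val (widen_ord cZ j).
have g_inj : injective g.
  by move=> i j /enum_val_inj /(congr1 val) /= ij; apply: val_inj.
exists (rowsub g Q)^T; split.
  rewrite trmxK; apply/matrixP => i j; rewrite !mxE.
  have := congr1 (fun X : 'M[R]_k => X (g i) (g j)) QQ; rewrite !mxE.
  rewrite (inj_eq g_inj) => <-; by apply: eq_bigr => l _; rewrite !mxE.
rewrite BE -[_ *m Q *m _]mulmxA.
have -> : Q *m (rowsub g Q)^T = (rowsub g 1%:M)^T.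
  by rewrite -{1}[Q]trmxK -trmx_mul mul_rowsub_mx QQ.
rewrite -mulmxA -{1}[diag_mx d]trmxK -trmx_mul tr_diag_mx mul_rowsub_mx mul1mx.
rewrite (_ : rowsub g _ = 0) ?trmx0 ?mulmx0//.
apply/matrixP => i j; rewrite !mxE; have := enum_valP (widen_ord cZ i).
by rewrite inE -/(g i) => /eqP ->; rewrite mul0rn.
Qed.

(** The formula [B^T (B B^T)^-1 B] for a row basis [B] of [T]. *)
Lemma row_projector (R : realType) m n (T : 'M[R]_(m, n)) :
  exists P : 'M[R]_n, [/\ P^T = P, P *m P = P & (P :=: T)%MS].
Proof.
suff /(_ (row_base T) (row_base_free T)) [P [PT PP PB]] : forall B : 'M[R]_(\rank T, n), row_free B ->
    exists P : 'M[R]_n, [/\ P^T = P, P *m P = P & (P :=: B)%MS].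
  by exists P; split => //; exact: eqmx_trans PB (eq_row_base T).
move=> B freeB.
have gU : B *m B^T \in unitmx.
  rewrite -row_free_unit -kermx_eq0; apply/eqP/row_matrixP => i; rewrite row0.
  have : (row i (kermx (B *m B^T)) <= kermx (B *m B^T))%MS by exact: row_sub.
  move/sub_kermxP; set x := row i _ => xB; apply/eqP.
  rewrite -(mulmx_free_eq0 _ freeB) -row_sqnorm_eq0.
  by rewrite trmx_mul mulmxA -(mulmxA x) xB mul0mx mxE.
exists (B^T *m invmx (B *m B^T) *m B); split.
- by rewrite !trmx_mul trmxK trmx_inv trmx_mul trmxK mulmxA.
- by rewrite !mulmxA -(mulmxA _ B B^T) -[_ *m invmx _ *m (B *m _)]mulmxA mulVmx// mulmx1.
- apply/eqmxP; rewrite submxMl /=.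
  have : (B *m (B^T *m invmx (B *m B^T) *m B) <= B^T *m invmx (B *m B^T) *m B)%MS.
    exact: submxMl.
  by rewrite !mulmxA mulmxV// mul1mx.
Qed.

(** Let [S] be the intersection of the range of [V] with the span [E] of the
    positive eigenvectors of [Y], and [P] the projector onto [S]. As [S] has
    codimension at most [m] in [E], the matrix [H (E - P) H] has rank at most
    [m]. It misses [H P H] from the positive part [H H], and the squared norm of
    [H P H] is that of the compression of [Y] to [S], hence at most that of the
    positive part of the compression to the range of [V]. *)
Lemma psd_rank_truncation (R : realType) k m p (Y : 'M[R]_k)
    (V : 'M[R]_(k, p)) : Y^T = Y -> V^T *m V = 1%:M -> (k <= m + p)%N ->
  exists B : 'M[R]_k, [/\ B^T = B, psdmx B, (\rank B <= m)%N &
    \tr ((B - Y) *m (B - Y)) - \tr (Y *m Y) + pos_sqnorm Y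
      <= pos_sqnorm (V^T *m Y *m V)].
Proof.
move=> symY VV kmp.
have [H [E [N [[HT ET NT] [EE EH NE] YE psdN pE]]]] := positive_part symY.
have HE : H *m E = H by rewrite -[H]HT -[E]ET -trmx_mul EH.
have EN : E *m N = 0 by rewrite -[E]ET -[N]NT -trmx_mul NE trmx0.
have [P [PT PP PS]] := row_projector (V^T :&: E)%MS.
have PE : P *m E = P.
  have : (P <= E)%MS by rewrite PS capmxSr.
  by case/submxP => D ->; rewrite -mulmxA EE.
have EP : E *m P = P by rewrite -[E]ET -[P]PT -trmx_mul PE.
have PV : P *m (V *m V^T) = P.
  have : (P <= V^T)%MS by rewrite PS capmxSl.
  by case/submxP => D ->; rewrite -mulmxA (mulmxA V^T) VV mul1mx.
have VP : V *m V^T *m P = P.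
  have VVT : (V *m V^T)^T = V *m V^T by rewrite trmx_mul trmxK.
  by rewrite -[P in LHS]PT -VVT -trmx_mul PV PT.
have [Q QE] : exists Q, Q = E - P by exists (E - P).
have [A AE] : exists A, A = H *m H by exists (H *m H).
have QT : Q^T = Q by rewrite QE linearB /= ET PT.
have QQ : Q *m Q = Q.
  by rewrite QE mulmxBl !mulmxBr EE EP PE PP subrr subr0.
have QP : Q *m P = 0 by rewrite QE mulmxBl EP PP subrr.
have rV : \rank V^T = p.
  by apply/eqP; rewrite -/(row_free _); apply/row_freeP; exists V.
have rQ : (\rank Q <= m)%N.
  have QP0 : (Q :&: P)%MS = 0.
    apply/eqP; rewrite -submx0; apply/rV_subP => v; rewrite sub_capmx.
    case/andP => /submxP[x ->] /submxP[y xy].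
    have -> : x *m Q = 0; last exact: sub0mx.
    by rewrite xy -PP mulmxA -xy -mulmxA QP mulmx0.
  have h1 : (\rank Q + \rank P <= \rank E)%N.
    rewrite -(mxrank_disjoint_sum QP0) mxrankS// addsmx_sub.
    rewrite (_ : (P <= E)%MS) ?andbT; last by rewrite PS capmxSr.
    by apply/submxP; exists Q; rewrite QE mulmxBl EE PE.
  have h2 := mxrank_sum_cap V^T E.
  have h3 : (\rank (V^T + E)%MS <= k)%N by exact: rank_leq_col.
  have h4 : \rank P = \rank (V^T :&: E)%MS by rewrite PS.
  lia.
have YP : Y *m P = A *m P.
  by rewrite YE -AE mulmxBl -[P in N *m P]EP (mulmxA N) NE mul0mx subr0.
have YQ : Y *m (H *m Q *m H) = A *m (H *m Q *m H).
  have NH : N *m H = 0 by rewrite -EH mulmxA NE mul0mx.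
  by rewrite YE -AE mulmxBl [N *m _]mulmxA [N *m _]mulmxA NH !mul0mx subr0.
have AT : A^T = A by rewrite AE trmx_mul HT.
exists (H *m Q *m H); split.
- by rewrite !trmx_mul HT QT mulmxA.
- have -> : H *m Q *m H = (Q *m H)^T *m (Q *m H).
    by rewrite trmx_mul HT QT !mulmxA -[H *m Q *m Q]mulmxA QQ.
  exact: psdmx_gram.
- apply: leq_trans rQ; apply: leq_trans (mxrankM_maxl _ _) _.
  exact: mxrankM_maxr.
- have -> : \tr ((H *m Q *m H - Y) *m (H *m Q *m H - Y)) - \tr (Y *m Y) +
            pos_sqnorm Y = \tr (P *m A *m P *m A).
    rewrite pE -AE mulmxBl !mulmxBr !mxtraceB YQ.
    rewrite (mxtrace_mulC (H *m Q *m H) Y) YQ.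
    have HPH : H *m P *m H = A - H *m Q *m H.
      by rewrite QE AE mulmxBr mulmxBl HE opprB addrCA subrr addr0.
    have -> : \tr (P *m A *m P *m A) = \tr ((H *m P *m H) *m (H *m P *m H)).
      by rewrite AE !mulmxA [RHS]mxtrace_mulC !mulmxA [RHS]mxtrace_mulC !mulmxA.
    rewrite HPH mulmxBl !mulmxBr !mxtraceB (mxtrace_mulC (H *m Q *m H) A); lra.
  have CT : (V^T *m P *m A *m P *m V)^T = V^T *m P *m A *m P *m V.
    by rewrite !trmx_mul trmxK PT AT !mulmxA.
  have psdC : psdmx (V^T *m P *m A *m P *m V).
    have -> : V^T *m P *m A *m P *m V = (H *m P *m V)^T *m (H *m P *m V).
      by rewrite !trmx_mul HT PT AE !mulmxA.
    exact: psdmx_gram.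
  have symW : (V^T *m Y *m V)^T = V^T *m Y *m V.
    by rewrite !trmx_mul trmxK symY mulmxA.
  apply: le_trans (pos_sqnorm_ge symW CT psdC).
  have -> : \tr (V^T *m P *m A *m P *m V *m (V^T *m Y *m V)) =
            \tr (P *m A *m P *m A).
    rewrite -!mulmxA mxtrace_mulC !mulmxA -(mulmxA (P *m A *m P) V V^T).
    rewrite -(mulmxA (P *m A)) PV -(mulmxA _ V V^T) mxtrace_mulC !mulmxA VP.
    by rewrite mxtrace_mulC !mulmxA YP [RHS]mxtrace_mulC !mulmxA.
  have -> : \tr (V^T *m P *m A *m P *m V *m (V^T *m P *m A *m P *m V)) =
            \tr (P *m A *m P *m A).
    rewrite -!mulmxA mxtrace_mulC !mulmxA -(mulmxA (P *m A *m P) V V^T).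
    rewrite -(mulmxA (P *m A)) PV -(mulmxA _ V V^T) mxtrace_mulC !mulmxA VP.
    by rewrite -(mulmxA (P *m A) P P) PP mxtrace_mulC !mulmxA PP.
  lra.
Qed.

(** * Norm and topology of the parameter space *)

Section Inner.
Context {R : realType} {d q : nat}.
Local Notation E := (param R d q).
Implicit Types (x y z : E).

Lemma vsval_trmx n (A : sym R n) : (vsval A)^T = vsval A.
Proof. by apply/symvP; exact: subvsP. Qed.

Lemma vsvalD n (A B : sym R n) : vsval (A + B) = vsval A + vsval B.
Proof. exact: (raddfD (@vsval _ _ (symv R n))). Qed.

Lemma vsvalZ n (a : R) (A : sym R n) : vsval (a *: A) = a *: vsval A.
Proof. exact: (@linearZZ R (subvs_of (symv R n)) _ (@vsval _ _ (symv R n))). Qed.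

Lemma vsvalB n (A B : sym R n) : vsval (A - B) = vsval A - vsval B.
Proof. exact: (raddfB (@vsval _ _ (symv R n))). Qed.

Lemma vsval0 n : vsval (0 : sym R n) = 0.
Proof. exact: (raddf0 (@vsval _ _ (symv R n))). Qed.

Lemma vsproj_trmx n (A : 'M[R]_n) : A^T = A -> vsval (vsproj (symv R n) A) = A.
Proof. by move=> /symvP; exact: vsprojK. Qed.

Lemma innerC x y : inner x y = inner y x.
Proof.
rewrite /inner mxtrace_mulC; congr (_ + _).
by rewrite -[in RHS](trmxK x.1) -trmx_mul [in RHS]mxE.
Qed.

Lemma innerDl x y z : inner (x + y) z = inner x z + inner y z.
Proof.
rewrite /inner -[(x + y).1]/(x.1 + y.1) -[(x + y).2]/(x.2 + y.2) vsvalD mulmxDl.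
by rewrite ![(_ + _)^T]linearD ![\tr (_ + _)]linearD /= mulmxDl entryD addrACA.
Qed.

Lemma innerZl (a : R) x y : inner (a *: x) y = a * inner x y.
Proof.
rewrite /inner -[(a *: x).1]/(a *: x.1) -[(a *: x).2]/(a *: x.2) vsvalZ.
by rewrite -scalemxAl !linearZ /= -scalemxAl entryZ mulrDr.
Qed.

Lemma innerDr x y z : inner x (y + z) = inner x y + inner x z.
Proof. by rewrite ![inner x _]innerC innerDl. Qed.

Lemma innerZr (a : R) x y : inner x (a *: y) = a * inner x y.
Proof. by rewrite ![inner x _]innerC innerZl. Qed.

Lemma innerNl x y : inner (- x) y = - inner x y.
Proof. by rewrite -scaleN1r innerZl mulN1r. Qed.

Lemma innerNr x y : inner x (- y) = - inner x y.
Proof. by rewrite -scaleN1r innerZr mulN1r. Qed.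

Lemma innerBl x y z : inner (x - y) z = inner x z - inner y z.
Proof. by rewrite innerDl innerNl. Qed.

Lemma innerBr x y z : inner x (y - z) = inner x y - inner x z.
Proof. by rewrite innerDr innerNr. Qed.

Lemma inner0l y : inner 0 y = 0.
Proof. by rewrite -(scale0r (0 : E)) innerZl mul0r. Qed.

Lemma inner_ge0 x : 0 <= inner x x.
Proof.
rewrite /inner addr_ge0//; first by have := row_sqnorm_ge0 x.1^T; rewrite trmxK.
by rewrite -{2}vsval_trmx; exact: mxtrace_gram_ge0.
Qed.

Lemma inner_eq0 x : (inner x x == 0) = (x == 0).
Proof.
apply/idP/eqP => [|->]; last by rewrite inner0l.
have h1 := row_sqnorm_ge0 x.1^T; rewrite trmxK in h1.
have h2 := mxtrace_gram_ge0 (vsval x.2); rewrite vsval_trmx in h2.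
rewrite /inner paddr_eq0// -{2}(trmxK x.1) row_sqnorm_eq0.
rewrite -{2}vsval_trmx mxtrace_gram_eq0 => /andP[/eqP x1 /eqP x2].
case: x x1 x2 {h1 h2} => a b /= a0 b0; congr (_, _).
  by rewrite -[a]trmxK a0 trmx0.
by apply: val_inj; rewrite [LHS]b0; exact/esym/vsval0.
Qed.

Lemma enorm_ge0 x : 0 <= enorm x. Proof. exact: sqrtr_ge0. Qed.

Lemma sqr_enorm x : enorm x ^+ 2 = inner x x.
Proof. by rewrite sqr_sqrtr// inner_ge0. Qed.

Lemma enorm0 : enorm (0 : E) = 0. Proof. by rewrite /enorm inner0l sqrtr0. Qed.

Lemma inner_le x y : `|inner x y| <= enorm x * enorm y.
Proof.
rewrite -(ler_pXn2r (n := 2))// ?nnegrE ?mulr_ge0 ?enorm_ge0//.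
rewrite exprMn !sqr_enorm real_normK ?num_real//.
have [->|y0] := eqVneq y 0; first by rewrite (innerC x 0) !inner0l mulr0 expr0n.
have yy : 0 < inner y y by rewrite lt_def inner_ge0 inner_eq0 y0.
have := inner_ge0 (inner y y *: x - inner x y *: y).
rewrite innerBl !innerBr !innerZl !innerZr (innerC y x) => h.
have : 0 <= inner y y * (inner x x * inner y y - inner x y ^+ 2) by lra.
by rewrite pmulr_rge0// subr_ge0.
Qed.

Lemma enormD x y : enorm (x + y) <= enorm x + enorm y.
Proof.
rewrite -(ler_pXn2r (n := 2))// ?nnegrE ?addr_ge0 ?enorm_ge0//.
rewrite sqr_enorm innerDl !innerDr (innerC y x) sqrrD !sqr_enorm.
have := le_trans (ler_norm _) (inner_le x y); lra.
Qed.

Lemma enormZ (a : R) x : enorm (a *: x) = `|a| * enorm x.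
Proof.
by rewrite /enorm innerZl innerZr mulrA -expr2 sqrtrM ?sqr_ge0// sqrtr_sqr.
Qed.

Lemma enormN x : enorm (- x) = enorm x.
Proof. by rewrite -scaleN1r enormZ normrN normr1 mul1r. Qed.

Lemma enorm_distC x y : enorm (x - y) = enorm (y - x).
Proof. by rewrite -enormN opprB. Qed.

Lemma enorm_sum (J : Type) (s : seq J) (F : J -> E) :
  enorm (\sum_(j <- s) F j) <= \sum_(j <- s) enorm (F j).
Proof.
elim: s => [|j s IH]; first by rewrite !big_nil enorm0.
by rewrite !big_cons (le_trans (enormD _ _))// lerD2l.
Qed.

Let J : finType := ('I_d + 'I_q * 'I_q)%type.

(** The coordinates of the matrix component are redundant: a spanning family is
    enough to reduce continuity and boundedness to real functions. *)
Definition coordinate (j : J) (x : E) : R :=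
  match j with inl i => x.1 i 0 | inr ij => vsval x.2 ij.1 ij.2 end.

Definition coordinate_vector (j : J) : E :=
  match j with
  | inl i => (delta_mx i 0, 0)
  | inr ij => (0, vsproj (symv R q) (delta_mx ij.1 ij.2))
  end.

Lemma coordinate_expansion x :
  x = \sum_(j : J) coordinate j x *: coordinate_vector j.
Proof.
rewrite big_sumType /=.
have -> : \sum_(i < d) x.1 i 0 *: ((delta_mx i 0, 0) : E) = (x.1, 0).
  transitivity ((\sum_(i < d) x.1 i 0 *: delta_mx i 0, 0) : E).
    elim/big_rec2: _ => [//|i y1 y2 _ ->].
    by congr (_, _); rewrite /= ?scaler0 ?addr0.
  congr (_, _); rewrite [RHS]matrix_sum_delta; apply: eq_bigr => i _.
  by rewrite big_ord1.
have -> : \sum_(ij : 'I_q * 'I_q) vsval x.2 ij.1 ij.2 *: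
    ((0, vsproj (symv R q) (delta_mx ij.1 ij.2)) : E) = (0, x.2).
  transitivity ((0, \sum_(ij : 'I_q * 'I_q) vsval x.2 ij.1 ij.2 *:
    vsproj (symv R q) (delta_mx ij.1 ij.2)) : E).
    elim/big_rec2: _ => [//|i y1 y2 _ ->].
    by congr (_, _); rewrite /= ?scaler0 ?addr0.
  congr (_, _); rewrite -[RHS]vsvalK [X in vsproj _ X]matrix_sum_delta.
  rewrite pair_big linear_sum; apply: eq_bigr => ij _; by rewrite linearZ.
by case: x => a b /=; congr (_, _); rewrite /= ?addr0 ?add0r.
Qed.

Lemma coordinate_le j x : `|coordinate j x| <= enorm x.
Proof.
rewrite -(ler_pXn2r (n := 2))// ?nnegrE ?enorm_ge0//.
rewrite real_normK ?num_real// sqr_enorm /inner.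
have h1 := row_sqnorm_ge0 x.1^T; rewrite trmxK in h1.
have h2 := mxtrace_gram_ge0 (vsval x.2); rewrite vsval_trmx in h2.
case: j => [i|[i j]] /=.
  rewrite -[leLHS]addr0 lerD// mxE (bigD1 i)//= mxE -expr2 lerDl sumr_ge0// => l _.
  by rewrite mxE -expr2 sqr_ge0.
rewrite -[leLHS]add0r lerD// /mxtrace (bigD1 i)//= mxE (bigD1 j)//=.
rewrite -{3}vsval_trmx mxE -expr2 -addrA lerDl addr_ge0//.
  by rewrite sumr_ge0// => l _; rewrite -{2}vsval_trmx mxE -expr2 sqr_ge0.
rewrite sumr_ge0// => l _; rewrite mxE sumr_ge0// => l' _.
by rewrite -{2}vsval_trmx mxE -expr2 sqr_ge0.
Qed.

Lemma coordinateD j x y : coordinate j (x + y) = coordinate j x + coordinate j y.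
Proof. by case: j => [i|ij] /=; rewrite ?vsvalD !mxE. Qed.

Lemma coordinateZ j (a : R) x : coordinate j (a *: x) = a * coordinate j x.
Proof. by case: j => [i|ij] /=; rewrite ?vsvalZ !mxE. Qed.

End Inner.

Lemma operator_bound (R : realType) (d1 q1 d2 q2 : nat)
    (A : 'Hom(param R d1 q1, param R d2 q2)) :
  exists2 M : R, 0 <= M & forall x, enorm (A x) <= M * enorm x.
Proof.
pose J : finType := ('I_d1 + 'I_q1 * 'I_q1)%type.
exists (\sum_(j : J) enorm (A (coordinate_vector j))).
  by rewrite sumr_ge0// => j _; exact: enorm_ge0.
move=> x; rewrite {1}(coordinate_expansion x) linear_sum.
rewrite (le_trans (enorm_sum _ _))// mulr_suml ler_sum// => j _.
rewrite linearZ enormZ mulrC ler_wpM2l ?enorm_ge0//; exact: coordinate_le.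
Qed.

Section Topology.
Context {R : realType} {d q : nat}.
Local Notation E := (param R d q).

Lemma cvg_sumr (T : Type) (F : set_system T) (FF : Filter F)
    (V : normedModType R) (I : Type) (s : seq I) (f : I -> T -> V) (l : I -> V) :
  (forall i, f i @ F --> l i) ->
  (fun t => \sum_(i <- s) f i t) @ F --> \sum_(i <- s) l i.
Proof.
move=> fl; elim: s => [|i s IH].
  by rewrite big_nil; under eq_fun do rewrite big_nil; exact: cvg_cst.
by rewrite big_cons; under eq_fun do rewrite big_cons; exact: cvgD.
Qed.

(** The topology of the parameters is a product topology and is not defined
    from [enorm]; the two are compared through the coordinates. *)
Lemma coordinate_continuous j : continuous (@coordinate R d q j).
Proof.
case: j => [i|[i j]] x.
  apply: (@continuous_comp _ _ _ (fst : E -> 'cV[R]_d) (fun M => M i 0)).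
    exact: cvg_fst.
  exact: coord_continuous.
apply: (@continuous_comp _ _ _ (fun x : E => vsval x.2 : 'M[R]_q) (fun M => M i j)).
  apply: (@continuous_comp _ _ _ (snd : E -> sym R q) vsval); first exact: cvg_snd.
  exact: initial_continuous.
exact: coord_continuous.
Qed.

Lemma linear_functional_continuous (f : {linear E -> R^o}) :
  continuous (f : E -> R).
Proof.
have -> : (f : E -> R) = fun x => \sum_j coordinate j x * f (coordinate_vector j).
  apply/funext => x; rewrite {1}(coordinate_expansion x) linear_sum.
  by apply: eq_bigr => j _; rewrite linearZ.
move=> x; apply: cvg_sumr => j; apply: cvgM; last exact: cvg_cst.
exact: coordinate_continuous.
Qed.

Lemma inner_continuous (h : E) : continuous (inner h).
Proof.
have linf : linear (inner h : E -> R^o).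
  by move=> a x y; rewrite innerDr innerZr.
pose L := GRing.isLinear.Build R E R^o _ (inner h : E -> R^o) linf.
pose f : {linear E -> R^o} := HB.pack (inner h : E -> R^o) L.
exact: (@linear_functional_continuous f).
Qed.

Lemma quadratic_continuous (A : E -> E) : linear A ->
  continuous (fun x => inner x (A x)).
Proof.
move=> linA x.
pose L := GRing.isLinear.Build R E E _ A linA.
pose A' : {linear E -> E} := HB.pack A L.
have -> : (fun x => inner x (A x)) = fun x => \sum_j coordinate j x *
    (\sum_i coordinate i x * inner (coordinate_vector j) (A (coordinate_vector i))).
  apply/funext => y; rewrite {1}(coordinate_expansion y).
  transitivity (\sum_j inner (coordinate j y *: coordinate_vector j) (A y)).
    elim/big_rec2: _ => [|j b x' _ <-]; first by rewrite inner0l.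
    by rewrite innerDl.
  apply: eq_bigr => j _; rewrite innerZl; congr (_ * _).
  rewrite {1}(coordinate_expansion y) -[A]/(A' : _ -> _) linear_sum.
  elim/big_rec2: _ => [|i b x' _ <-]; first by rewrite innerC inner0l.
  by rewrite innerDr linearZ innerZr.
apply: cvg_sumr => j; apply: cvgM; first exact: coordinate_continuous.
apply: cvg_sumr => i; apply: cvgM; last exact: cvg_cst.
exact: coordinate_continuous.
Qed.

Lemma enorm_sub_continuous (a : E) : continuous (fun x : E => enorm (x - a)).
Proof.
move=> x; apply: (@continuous_comp _ _ _ (fun x : E => inner (x - a) (x - a)) Num.sqrt);
  last exact: sqrt_continuous.
have -> : (fun x : E => inner (x - a) (x - a)) =
    fun x => inner x x - 2 * inner a x + inner a a.
  apply/funext => y; rewrite innerBl !innerBr (innerC y a); lra.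
apply: cvgD; last exact: cvg_cst.
apply: cvgB; first exact: (@quadratic_continuous id).
apply: cvgM; [exact: cvg_cst|exact: inner_continuous].
Qed.

Lemma nbhs_enorm (a : E) (e : R) : 0 < e -> \forall x \near a, enorm (x - a) < e.
Proof.
move=> e0; have := @enorm_sub_continuous a a; rewrite /continuous_at subrr enorm0.
by move/cvgr_lt; exact.
Qed.

(** The image of a cube of coordinates. *)
Lemma compact_covering_ball (rho : R) :
  exists2 C : set E, compact C & forall x, enorm x <= rho -> C x.
Proof.
pose J : finType := ('I_d + 'I_q * 'I_q)%type.
pose Phi (v : 'rV[R]_#|J|) : E := \sum_(j : J) v 0 (enum_rank j) *: coordinate_vector j.
pose B := [set v : 'rV[R]_#|J| | forall i, `[- rho, rho]%classic (v ord0 i)].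
have cB : compact B.
  by apply: (@rV_compact R _ (fun=> `[- rho, rho]%classic)) => i; exact: segment_compact.
have cPhi : continuous Phi.
  move=> v; have h1 : (fst \o Phi) @ v --> (Phi v).1.
    have -> : fst \o Phi = fun v : 'rV[R]_#|J| =>
        \sum_(j : J) v 0 (enum_rank j) *: (coordinate_vector j : E).1.
      apply/funext => u; rewrite /Phi /=.
      by elim/big_rec2: _ => // j x y _ <-.
    have -> : (Phi v).1 = \sum_(j : J) v 0 (enum_rank j) *: (coordinate_vector j : E).1.
      by rewrite /Phi; elim/big_rec2: _ => // j x y _ <-.
    apply: (@cvg_sumr _ (nbhs v) _ 'cV[R]_d _ _
      (fun j u => u 0 (enum_rank j) *: (coordinate_vector j : E).1)) => j.
    apply: (@cvgZr_tmp _ 'cV[R]_d _ (nbhs v)); exact: coord_continuous.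
  have h2 : (snd \o Phi) @ v --> (Phi v).2.
    apply: (@continuous_comp_initial _ _ _ (vsval : subvs_of (symv R q) -> 'M[R]_q)
      (snd \o Phi)) => v0.
    have E2 u : vsval (Phi u).2 = \sum_(j : J) u 0 (enum_rank j) *:
        vsval (coordinate_vector j : E).2 :> 'M[R]_q.
      rewrite /Phi; elim/big_rec2: _ => [|j x y _ <-]; first exact: vsval0.
      by rewrite -vsvalZ -vsvalD.
    rewrite /continuous_at /=; have -> : vsval \o (snd \o Phi) = fun u =>
        \sum_(j : J) u 0 (enum_rank j) *: vsval (coordinate_vector j : E).2 :> 'M[R]_q.
      by apply/funext => u; exact: E2.
    rewrite E2; apply: (@cvg_sumr _ (nbhs v0) _ 'M[R]_q _ _
      (fun j u => u 0 (enum_rank j) *: vsval (coordinate_vector j : E).2)) => j.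
    apply: (@cvgZr_tmp _ 'M[R]_q _ (nbhs v0)); exact: coord_continuous.
  have E : (fun x => ((fst \o Phi) x, (snd \o Phi) x)) = Phi.
    by apply/funext => x /=; rewrite -surjective_pairing.
  by have := cvg_pair h1 h2; rewrite E; apply.
exists (Phi @` B).
  by apply: continuous_compact => //; exact: continuous_subspaceT.
move=> x xr; exists (\row_i coordinate (enum_val i) x).
  move=> i; rewrite /= in_itv /= mxE -ler_norml (le_trans _ xr)//.
  exact: coordinate_le.
rewrite /Phi [RHS]coordinate_expansion; apply: eq_bigr => j _.
by rewrite mxE enum_rankK.
Qed.

End Topology.

Section Entrywise_convergence.
Context {R : realType}.

(** Convergence by entries: products, traces and determinants then follow from
    the arithmetic of real limits. *)
Definition mx_cvg m n (A : nat -> 'M[R]_(m, n)) (B : 'M[R]_(m, n)) : Prop :=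
  forall i j, (fun k => A k i j) @ \oo --> B i j.

Lemma mx_cvg_cst m n (B : 'M[R]_(m, n)) : mx_cvg (fun=> B) B.
Proof. by move=> i j; exact: cvg_cst. Qed.

Lemma mx_cvg_mul m n p (A : nat -> 'M[R]_(m, n)) A' (B : nat -> 'M[R]_(n, p)) B' :
  mx_cvg A A' -> mx_cvg B B' -> mx_cvg (fun k => A k *m B k) (A' *m B').
Proof.
move=> cA cB i j; rewrite mxE; under eq_fun do rewrite mxE.
by apply: cvg_sumr => l; apply: cvgM.
Qed.

Lemma mx_cvg_tr m n (A : nat -> 'M[R]_(m, n)) A' :
  mx_cvg A A' -> mx_cvg (fun k => (A k)^T) A'^T.
Proof. by move=> cA i j; rewrite mxE; under eq_fun do rewrite mxE; exact: cA. Qed.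

Lemma mx_cvg_trace n (A : nat -> 'M[R]_n) A' :
  mx_cvg A A' -> (fun k => \tr (A k)) @ \oo --> \tr A'.
Proof. by move=> cA; apply: cvg_sumr => i; exact: cA. Qed.

Lemma mx_cvg_det n (A : nat -> 'M[R]_n) A' :
  mx_cvg A A' -> (fun k => \det (A k)) @ \oo --> \det A'.
Proof.
move=> cA; apply: cvg_sumr => s; apply: cvgM; first exact: cvg_cst.
elim: (index_enum _) => [|i r IH].
  by rewrite big_nil; under eq_fun do rewrite big_nil; exact: cvg_cst.
by rewrite big_cons; under eq_fun do rewrite big_cons; exact: cvgM.
Qed.

(** One-sided inverses of the bases of the limit compress it to an identity
    matrix, of determinant one, while the compressed sequence would have
    determinant zero if its rank were smaller than that of the limit. *)
Lemma mxrank_limit m n p (A : nat -> 'M[R]_(m, n)) A' :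
  mx_cvg A A' -> (forall k, (\rank (A k) <= p)%N) -> (\rank A' <= p)%N.
Proof.
move=> cA rA; rewrite leqNgt; apply/negP => pA.
have /row_fullP[L LA] := col_base_full A'.
have /row_freeP[K AK] := row_base_free A'.
have E : L *m A' *m K = 1%:M.
  transitivity (L *m (col_base A' *m row_base A') *m K).
    by rewrite mulmx_base.
  by rewrite mulmxA LA mul1mx AK.
have := mx_cvg_det (mx_cvg_mul (mx_cvg_mul (@mx_cvg_cst _ _ L) cA) (@mx_cvg_cst _ _ K)).
rewrite E det1; have -> : (fun k => \det (L *m A k *m K)) = fun=> 0.
  apply/funext => k; apply/eqP; rewrite -[_ == _]negbK -unitfE -unitmxE.
  apply/negP => /mxrank_unit r; move: pA; rewrite ltnNge => /negP; apply.
  rewrite -r; apply: leq_trans (mxrankM_maxl _ _) _.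
  exact: leq_trans (mxrankM_maxr _ _) (rA k).
move=> c1.
have e : (0 : R) = 1 by apply: (cvg_unique (@Rhausdorff R) _ c1); exact: cvg_cst.
by move/eqP: e; rewrite eq_sym oner_eq0.
Qed.

Lemma psdmx_limit n (A : nat -> 'M[R]_n) A' :
  mx_cvg A A' -> (forall k, psdmx (A k)) -> psdmx A'.
Proof.
move=> cA pA x.
have := mx_cvg_mul (mx_cvg_mul (@mx_cvg_cst _ _ x^T) cA) (@mx_cvg_cst _ _ x).
by move=> /(_ 0 0) c; apply: cvgr_to_ge c _; apply: nearW => k; exact: pA.
Qed.

End Entrywise_convergence.

Section Compression.
Context {R : realType} {q k : nat} (U : 'M[R]_(q, k)).

Lemma compressE (H : sym R q) : vsval (compress U H) = U^T *m vsval H *m U.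
Proof.
pose f (H : sym R q) : sym R k := vsproj (symv R k) (U^T *m vsval H *m U).
have lf : linear f.
  move=> a A B; rewrite /f -linearP vsvalD vsvalZ mulmxDr mulmxDl.
  by rewrite -scalemxAr -scalemxAl.
pose L := GRing.isLinear.Build R (sym R q) (sym R k) _ f lf.
pose g : {linear sym R q -> sym R k} := HB.pack f L.
rewrite [compress U H](lfunE g) /= vsproj_trmx//.
by rewrite !trmx_mul trmxK vsval_trmx mulmxA.
Qed.

Lemma compress_adjE (B : sym R k) : vsval (compress_adj U B) = U *m vsval B *m U^T.
Proof.
pose f (B : sym R k) : sym R q := vsproj (symv R q) (U *m vsval B *m U^T).
have lf : linear f.
  move=> a A C; rewrite /f -linearP vsvalD vsvalZ mulmxDr mulmxDl.
  by rewrite -scalemxAr -scalemxAl.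
pose L := GRing.isLinear.Build R (sym R k) (sym R q) _ f lf.
pose g : {linear sym R k -> sym R q} := HB.pack f L.
rewrite [compress_adj U B](lfunE g) /= vsproj_trmx//.
by rewrite !trmx_mul trmxK vsval_trmx mulmxA.
Qed.

(** Drifts of null paths are limits of rescaled null parameters, so tangency
    to the null set is obtained by closedness. *)
Lemma cone0_closed d (m : nat) (h : param R d q) :
  (forall e : R, 0 < e -> exists2 h', cone0 m U h' & enorm (h - h') < e) ->
  cone0 m U h.
Proof.
move=> H; have {}H n : exists h', cone0 m U h' /\ enorm (h - h') < n.+1%:R^-1.
  by have [|h' h1 h2] := H n.+1%:R^-1; [rewrite invr_gt0|exists h'].
have [u Hu] := choice H.
have cu : mx_cvg (fun n => vsval (u n).2) (vsval h.2).
  move=> i j; apply/cvgrPdist_lt => e e0; near=> n.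
  have [_ un] := Hu n.
  have hle := coordinate_le (inr (i, j)) (h - u n).
  rewrite coordinateD -[- u n]scaleN1r coordinateZ mulN1r scaleN1r /= in hle.
  rewrite (le_lt_trans hle)// (lt_trans un)//.
  by near: n; exact: (near_infty_natSinv_lt (PosNum e0)).
have cB : mx_cvg (fun n => vsval (compress U (u n).2)) (vsval (compress U h.2)).
  rewrite compressE; under eq_fun do rewrite compressE.
  apply: mx_cvg_mul (@mx_cvg_cst _ _ _ U).
  by apply: mx_cvg_mul cu; exact: mx_cvg_cst.
split.
  by apply: (psdmx_limit cB) => n; have [[]] := Hu n.
by apply: (mxrank_limit cB) => n; have [[]] := Hu n.
Unshelve. all: by end_near. Qed.

End Compression.

(** * Reduced covariance *)

Section Reduced_covariance.
Context {R : realType} {d q k : nat}.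
Local Notation E := (param R d q).
Variable (I : 'End(E)).
Hypotheses (saI : self_adjoint I) (pdI : positive_definite I).

Lemma positive_definite_inj v : I v = 0 -> v = 0.
Proof.
move=> Iv; apply: contrapT => /eqP /pdI.
by rewrite Iv innerC inner0l ltxx.
Qed.

Lemma positive_definite_lker0 : lker I == 0%VS.
Proof.
apply/lker0P => x y Ixy; apply/eqP; rewrite -subr_eq0.
by apply/eqP/positive_definite_inj; rewrite linearB /= Ixy subrr.
Qed.

Lemma positive_definite_lfunVK v : I ((I^-1)%VF v) = v.
Proof. by rewrite lker0_lfunVK// positive_definite_lker0. Qed.

Lemma positive_definite_lfunK v : (I^-1)%VF (I v) = v.
Proof. by rewrite lker0_lfunK// positive_definite_lker0. Qed.

Lemma in_psiE (a : 'cV[R]_d) : in_psi R d q a = (a, 0).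
Proof.
pose f (a : 'cV[R]_d) : E := (a, 0).
have lf : linear f by move=> l u v; congr (_, _); rewrite /= scaler0 addr0.
pose L := GRing.isLinear.Build R 'cV[R]_d E _ f lf.
pose g : {linear 'cV[R]_d -> E} := HB.pack f L.
exact: (lfunE g).
Qed.

Lemma in_sigmaE (H : sym R q) : in_sigma R d q H = (0, H).
Proof.
pose f (H : sym R q) : E := (0, H).
have lf : linear f by move=> l u v; congr (_, _); rewrite /= scaler0 addr0.
pose L := GRing.isLinear.Build R (sym R q) E _ f lf.
pose g : {linear sym R q -> E} := HB.pack f L.
exact: (lfunE g).
Qed.

Lemma pr_psiE (x : E) : pr_psi R d q x = x.1.
Proof. by rewrite lfunE. Qed.

Lemma pr_sigmaE (x : E) : pr_sigma R d q x = x.2.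
Proof. by rewrite lfunE. Qed.

(** Block inversion: the inverse of the Schur complement is the corresponding
    block of the inverse. *)
Lemma efficient_informationV (D : sym R q) :
  (efficient_information I)^-1%VF D = ((I^-1)%VF ((0, D) : E)).2.
Proof.
pose A : 'End('cV[R]_d) := (pr_psi R d q \o I \o in_psi R d q)%VF.
have AE a : A a = (I ((a, 0) : E)).1 by rewrite !comp_lfunE in_psiE pr_psiE.
have A0 : lker A == 0%VS.
  apply/lker0P => x y Axy; apply/eqP; rewrite -subr_eq0; apply/eqP.
  have A0 : A (x - y) = 0 by rewrite linearB /= Axy subrr.
  apply: contrapT => /eqP xy0.
  have /pdI : ((x - y, 0) : E) != 0 by apply: contraNneq xy0 => -[->].
  by rewrite /inner -AE A0 mulmx0 mxE vsval0 mul0mx mxtrace0 addr0 ltxx.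
have key v : I ((- (A^-1)%VF (I ((0, v) : E)).1, v) : E) =
    (0, efficient_information I v).
  set a := (A^-1)%VF _.
  have -> : ((- a, v) : E) = ((0, v) : E) - ((a, 0) : E).
    by congr (_, _); rewrite /= ?sub0r ?subr0.
  rewrite linearB /=; apply/pair_equal_spec; split.
    by rewrite -[LHS]/((I _).1 - (I _).1) -AE /a lker0_lfunVK// subrr.
  rewrite /efficient_information -[LHS]/((I _).2 - (I _).2) add_lfunE opp_lfunE !comp_lfunE.
  by rewrite !in_sigmaE !pr_psiE !pr_sigmaE in_psiE.
have eff0 : lker (efficient_information I) == 0%VS.
  apply/lker0P => x y xy; apply/eqP; rewrite -subr_eq0; apply/eqP.
  have := key (x - y); rewrite linearB /= xy subrr => /positive_definite_inj.
  exact: (congr1 snd).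
rewrite -[in RHS](lker0_lfunVK eff0 D) -key positive_definite_lfunK//.
Qed.

Variable U : 'M[R]_(q, k).

Lemma reduced_covarianceE (B : sym R k) :
  reduced_covariance I U B = compress U ((I^-1)%VF ((0, compress_adj U B) : E)).2.
Proof. by rewrite /reduced_covariance !comp_lfunE efficient_informationV. Qed.

Lemma inner_compress_adj (B : sym R k) (x : E) :
  inner ((0, compress_adj U B) : E) x = \tr (vsval B *m vsval (compress U x.2)).
Proof.
rewrite /inner /= trmx0 mul0mx mxE add0r compress_adjE compressE.
by rewrite -!mulmxA mxtrace_mulC !mulmxA.
Qed.

Hypothesis UU : U^T *m U = 1%:M.

Lemma compress_adjK (B : sym R k) : compress U (compress_adj U B) = B.
Proof.
apply: val_inj; rewrite [LHS]compressE compress_adjE !mulmxA UU mul1mx.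
by rewrite -mulmxA UU mulmx1.
Qed.

(** Isotropy provides some real factor; it is positive as the diagonal value of
    an inverse information as soon as the active block is not empty. *)
Lemma isotropic_scale_gt0 (c0 : R) : (0 < k)%N ->
  (forall B, reduced_covariance I U B = c0 *: B) -> 0 < c0.
Proof.
move=> k0 iso; pose B : sym R k := vsproj (symv R k) 1%:M.
have BE : vsval B = 1%:M by rewrite vsproj_trmx// trmx1.
pose x : E := (0, compress_adj U B).
have x0 : x != 0.
  apply: contraTneq k0 => /(congr1 snd) /= x0.
  have := compress_adjK B; rewrite x0 linear0 => /(congr1 vsval).
  rewrite vsval0 BE => /matrixP h; case: (k) h => [//|k'] /(_ 0 0).
  by rewrite !mxE eqxx => /eqP; rewrite eq_sym oner_eq0.
have : (I^-1)%VF x != 0.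
  by apply: contraNneq x0 => /(congr1 I); rewrite positive_definite_lfunVK linear0 => ->.
move=> /pdI; rewrite positive_definite_lfunVK innerC inner_compress_adj.
rewrite -reduced_covarianceE iso vsvalZ BE mul1mx mxtraceZ mxtrace1.
by rewrite pmulr_lgt0// ltr0n.
Qed.

End Reduced_covariance.

(** * Likelihood ratio of the limiting experiment *)

(** A symmetric matrix seen as a parameter without nuisance component: its
    Frobenius norm is an [enorm], to which [operator_bound] applies. *)
Notation frob B := (in_sigma _ 0 _ B).

Section Lipschitz.
Context {R : realType} {n : nat}.
Implicit Types A B : sym R n.

Lemma inner_frob A B : inner (frob A) (frob B) = \tr (vsval A *m vsval B).
Proof. by rewrite !in_sigmaE /inner /= mulmx0 mxE add0r. Qed.

Lemma sqr_frob A : enorm (frob A) ^+ 2 = \tr (vsval A *m vsval A).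
Proof. by rewrite sqr_enorm inner_frob. Qed.

Lemma pos_sqnorm_lipschitz A B :
  pos_sqnorm (vsval A) - pos_sqnorm (vsval B) <=
  2 * enorm (frob A) * enorm (frob (A - B)).
Proof.
have [X [symX psdX pX pX2]] := pos_sqnorm_attained (vsval_trmx A).
have := pos_sqnorm_ge (vsval_trmx B) symX psdX.
have XE := vsproj_trmx symX; set X' := vsproj _ X in XE.
have XA : enorm (frob X') <= enorm (frob A).
  rewrite -(ler_pXn2r (n := 2))// ?nnegrE ?enorm_ge0// !sqr_frob XE -pX2.
  exact: pos_sqnorm_le (vsval_trmx A).
have := le_trans (ler_norm _) (inner_le (frob X') (frob (A - B))).
rewrite inner_frob XE vsvalB mulmxBr mxtraceB.
have := ler_wpM2r (enorm_ge0 (frob (A - B))) XA.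
rewrite {1}pX; lra.
Qed.

End Lipschitz.

Section Quadratic_form.
Context {R : realType} {d q : nat}.
Local Notation E := (param R d q).
Variable I : 'End(E).
Hypotheses (saI : self_adjoint I) (pdI : positive_definite I).
Implicit Types h z : E.

(** The limiting log-likelihood ratio at the local parameter [h] when the score
    is [z]. *)
Definition lan_form h z : R := inner h z - inner h (I h) / 2.

Lemma posdef_inner_ge0 h : 0 <= inner h (I h).
Proof.
have [->|h0] := eqVneq h 0; first by rewrite inner0l.
exact/ltW/pdI.
Qed.

(** Completing the square around the unconstrained maximiser [I^-1 z]. *)
Lemma lan_form_square h z : 2 * lan_form h z =
  inner z ((I^-1)%VF z) - inner (h - (I^-1)%VF z) (I (h - (I^-1)%VF z)).
Proof.
rewrite /lan_form (linearB I) /= (positive_definite_lfunVK pdI) innerBl !innerBr.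
rewrite -(saI ((I^-1)%VF z) h) (positive_definite_lfunVK pdI).
rewrite (innerC ((I^-1)%VF z) z) (innerC z h); lra.
Qed.

Lemma lan_form_lipschitz M h h' z : (forall x, enorm (I x) <= M * enorm x) ->
  `|lan_form h z - lan_form h' z| <=
  enorm (h - h') * (enorm z + M * (enorm h + enorm h')).
Proof.
move=> IM.
have -> : lan_form h z - lan_form h' z =
    inner (h - h') z - 2^-1 * (inner (h - h') (I h) + inner (h - h') (I h')).
  by rewrite /lan_form !innerBl -(saI h h') (innerC (I h) h'); lra.
have h1 := inner_le (h - h') z.
have h2 := inner_le (h - h') (I h); have h3 := inner_le (h - h') (I h').
have h4 := ler_wpM2l (enorm_ge0 (h - h')) (IM h).
have h5 := ler_wpM2l (enorm_ge0 (h - h')) (IM h').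
have h6 := le_trans h2 h4; have h7 := le_trans h3 h5.
have n1 := normr_ge0 (inner (h - h') (I h)); have n2 := normr_ge0 (inner (h - h') (I h')).
apply: le_trans (ler_normB _ _) _; rewrite normrM ger0_norm ?invr_ge0//.
apply: le_trans (lerD h1 (ler_wpM2l _ (ler_normD _ _))) _ => //.
by lra.
Qed.

Lemma lan_form_continuous h : continuous (lan_form h).
Proof.
move=> z; apply: cvgB; first exact: inner_continuous.
exact: cvg_cst.
Qed.

End Quadratic_form.

Section Reduction.
Context {R : realType} {d q k m p : nat}.
Local Notation E := (param R d q).
Variables (I : 'End(E)) (U : 'M[R]_(q, k)) (V : 'M[R]_(k, p)) (c0 : R).
Hypotheses (saI : self_adjoint I) (pdI : positive_definite I).
Hypotheses (VV : V^T *m V = 1%:M).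
Hypotheses (kmp : (k <= m + p)%N) (c0_gt0 : 0 < c0).
Hypothesis iso : forall B, reduced_covariance I U B = c0 *: B.

Local Notation sc := (Num.sqrt c0).
Local Notation invI := (I^-1)%VF.

Let sc0 : sc != 0. Proof. by rewrite gt_eqF// sqrtr_gt0. Qed.
Let scsc : sc * sc = c0. Proof. by rewrite -expr2 sqr_sqrtr// ltW. Qed.

(** The isometric embedding of the active block in the information geometry;
    its image is the [I]-orthogonal complement of the directions that do not
    move the active block. *)
Definition active_lift : 'Hom(sym R k, E) :=
  (sc^-1 *: (invI \o in_sigma R d q \o compress_adj U))%VF.

(** The active block of the unconstrained maximiser, scaled to have a standard
    Gaussian law. *)
Definition active_score : 'Hom(E, sym R k) :=
  (sc^-1 *: (compress U \o pr_sigma R d q \o invI))%VF.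

Definition reduced_score : 'Hom(E, sym R p) := (compress V \o active_score)%VF.

Definition reduced_lift : 'Hom(sym R p, E) := (active_lift \o compress_adj V)%VF.

Lemma active_liftE B : active_lift B = sc^-1 *: invI ((0, compress_adj U B) : E).
Proof. by rewrite scale_lfunE !comp_lfunE in_sigmaE. Qed.

Lemma active_scoreE z : active_score z = sc^-1 *: compress U (invI z).2.
Proof. by rewrite scale_lfunE !comp_lfunE pr_sigmaE. Qed.

Lemma inner_active_lift B x :
  inner (active_lift B) (I x) = sc^-1 * \tr (vsval B *m vsval (compress U x.2)).
Proof.
by rewrite active_liftE innerZl -saI (positive_definite_lfunVK pdI) inner_compress_adj.
Qed.

Lemma compress_active_lift B : compress U (active_lift B).2 = sc *: B.
Proof.
rewrite active_liftE -[(_ *: _).2]/(_ *: (invI _).2) linearZ /=.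
by rewrite -(reduced_covarianceE pdI) iso scalerA -[X in _ * X]scsc mulrA mulVf// mul1r.
Qed.

Lemma inner_active_score B z :
  inner (active_lift B) z = \tr (vsval B *m vsval (active_score z)).
Proof.
rewrite -{1}(positive_definite_lfunVK pdI z) inner_active_lift active_scoreE.
by rewrite vsvalZ -scalemxAr mxtraceZ.
Qed.

Lemma active_lift_isometry B C :
  inner (active_lift B) (I (active_lift C)) = \tr (vsval B *m vsval C).
Proof.
rewrite inner_active_lift compress_active_lift vsvalZ -scalemxAr mxtraceZ.
by rewrite mulrA mulVf// mul1r.
Qed.

Lemma compress_score z : compress U (invI z).2 = sc *: active_score z.
Proof. by rewrite active_scoreE scalerA mulfV// scale1r. Qed.

(** The lift of the active block of [u] is the [I]-orthogonal projection of
    [u], so its norm is at most that of [u]. *)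
Lemma active_block_le u :
  \tr (vsval (sc^-1 *: compress U u.2) *m vsval (sc^-1 *: compress U u.2))
  <= inner u (I u).
Proof.
set B := sc^-1 *: _.
have := posdef_inner_ge0 pdI (u - active_lift B).
rewrite (linearB I) /= innerBl !innerBr active_lift_isometry -(saI u (active_lift B)) (innerC (I u) (active_lift B)).
rewrite inner_active_lift.
have -> : sc^-1 * \tr (vsval B *m vsval (compress U u.2)) = \tr (vsval B *m vsval B).
  by rewrite -mxtraceZ scalemxAr -vsvalZ.
lra.
Qed.

Lemma inner_reduced_lift t z :
  \tr (vsval t *m vsval (reduced_score z)) = inner (reduced_lift t) z.
Proof.
rewrite !comp_lfunE inner_active_score compressE compress_adjE.
by rewrite -!mulmxA [RHS]mxtrace_mulC !mulmxA.
Qed.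

Lemma reduced_lift_isometry t u :
  inner (reduced_lift t) (I (reduced_lift u)) = \tr (vsval t *m vsval u).
Proof.
rewrite !comp_lfunE active_lift_isometry !compress_adjE.
rewrite -!mulmxA mxtrace_mulC -!mulmxA VV mulmx1 (mulmxA V^T) VV mul1mx.
by rewrite mxtrace_mulC.
Qed.

Lemma reduced_lift_orthogonal h t : vsval (compress U h.2) *m V = 0 ->
  inner h (I (reduced_lift t)) = 0.
Proof.
move=> hV; rewrite -saI innerC comp_lfunE inner_active_lift compress_adjE.
by rewrite -!mulmxA mxtrace_mulC -!mulmxA hV !mulmx0 mxtrace0 mulr0.
Qed.

(** Maximising [lan_form] over a cone is projecting [I^-1 z] onto it in the
    information norm. The cones only constrain the active block, so by
    [active_block_le] and [active_lift_isometry] both projections reduce to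
    projecting [active_score z], onto the positive semidefinite cone and onto
    its matrices of rank at most [m]; [psd_rank_truncation] compares the two
    distances. The point [h] is explicit and depends on [z] with a linear
    bound. *)
Lemma lr_bound : exists2 M : R, 0 <= M &
  forall z, exists h, [/\ cone0 m U h, enorm h <= M * enorm z &
    forall h1, cone1 U h1 -> 2 * (lan_form I h1 z - lan_form I h z)
      <= pos_sqnorm (vsval (reduced_score z))].
Proof.
have [M1 M10 I1] := @operator_bound R d q d q invI.
have [M2 M20 L2] := @operator_bound R 0 k d q (active_lift \o pr_sigma R 0 k)%VF.
have [M3 M30 S3] := @operator_bound R d q 0 k (in_sigma R 0 k \o active_score)%VF.
have [M4 M40 S4] := @operator_bound R d q 0 p (in_sigma R 0 p \o reduced_score)%VF.
exists (M1 + M2 * (M3 + M4)); first by rewrite addr_ge0 ?mulr_ge0 ?addr_ge0.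
move=> z; pose Y := active_score z.
have [B [symB psdB rB trB]] := psd_rank_truncation (vsval_trmx Y) VV kmp.
have BE := vsproj_trmx symB; set B' := vsproj _ B in BE.
have BYE : vsval (B' - Y) = B - vsval Y.
  by rewrite vsvalB BE.
have WE : V^T *m vsval Y *m V = vsval (reduced_score z).
  by rewrite comp_lfunE compressE.
rewrite WE in trB.
pose h := invI z + active_lift (B' - Y).
have cE : compress U h.2 = sc *: B'.
  rewrite -[h.2]/((invI z).2 + (active_lift (B' - Y)).2) linearD /=.
  rewrite compress_score compress_active_lift -scalerDr; congr (_ *: _).
  by rewrite addrC subrK.
exists h; split.
- rewrite /cone0 /= cE; split; rewrite /psd vsvalZ BE; last first.
    by apply: leq_trans rB; exact: mxrank_scale.
  move=> x; rewrite -scalemxAr -scalemxAl mxE mulr_ge0 ?sqrtr_ge0//; exact: psdB.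
- apply: le_trans (enormD _ _) _; rewrite mulrDl lerD// -mulrA.
  have := L2 (frob (B' - Y)); rewrite comp_lfunE pr_sigmaE in_sigmaE /=.
  move/le_trans; apply; rewrite ler_wpM2l// -in_sigmaE.
  have S3z := S3 z; have S4z := S4 z; rewrite !comp_lfunE -/Y in S3z S4z.
  rewrite mulrDl; apply: le_trans (lerD S3z S4z).
  rewrite -(ler_pXn2r (n := 2))// ?nnegrE ?addr_ge0 ?enorm_ge0//.
  rewrite sqrrD !sqr_frob BYE.
  have p0 := pos_sqnorm_ge0 (vsval Y).
  have pW := pos_sqnorm_le (vsval_trmx (reduced_score z)).
  have e0 : 0 <= enorm (frob Y) * enorm (frob (reduced_score z)).
    by rewrite mulr_ge0 ?enorm_ge0.
  by rewrite comp_lfunE in pW trB e0 *; lra.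
- move=> h1 h1c; rewrite mulrBr !(lan_form_square saI pdI).
  have -> : h - invI z = active_lift (B' - Y) by rewrite /h addrC addKr.
  rewrite active_lift_isometry BYE.
  pose B1 : sym R k := sc^-1 *: compress U h1.2.
  have := active_block_le (h1 - invI z).
  have -> : sc^-1 *: compress U (h1 - invI z).2 = B1 - Y.
    rewrite -[(h1 - _).2]/(h1.2 - (invI z).2) linearB /= compress_score scalerBr.
    by rewrite [in X in _ - X]scalerA mulVf// scale1r.
  have symB1 := vsval_trmx B1.
  have psdB1 : psdmx (vsval B1).
    move=> x; rewrite vsvalZ -scalemxAr -scalemxAl mxE mulr_ge0//.
  have -> : vsval (B1 - Y) = vsval B1 - vsval Y.
    exact: vsvalB.
  have := pos_sqnorm_ge (vsval_trmx Y) symB1 psdB1.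
  rewrite mulmxBl !mulmxBr !mxtraceB (mxtrace_mulC (vsval Y) (vsval B1)); lra.
Qed.

Lemma reduced_score_continuous :
  continuous (fun z => pos_sqnorm (vsval (reduced_score z))).
Proof.
have [M M0 WM] : exists2 M : R, 0 <= M &
    forall z, enorm (frob (reduced_score z)) <= M * enorm z.
  have [M M0 WM] := @operator_bound R d q 0 p (in_sigma R 0 p \o reduced_score)%VF.
  by exists M => // z; have := WM z; rewrite comp_lfunE.
move=> z; apply/cvgrPdist_le => e e0.
pose b := 2 * M * (enorm z + 1) * M + 1.
have b0 : 0 < b by rewrite ltr_wpDl// !mulr_ge0 ?addr_ge0 ?enorm_ge0.
near=> y.
have y1 : enorm (y - z) < 1 by near: y; exact: nbhs_enorm.
have yb : enorm (y - z) < e / b by near: y; apply: nbhs_enorm; rewrite divr_gt0.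
have yz : enorm y <= enorm z + 1.
  by rewrite -[y](subrK z) (le_trans (enormD _ _))// addrC lerD2l ltW.
have est x x' : enorm x <= enorm z + 1 -> enorm (x - x') = enorm (y - z) ->
    pos_sqnorm (vsval (reduced_score x)) - pos_sqnorm (vsval (reduced_score x')) <= e.
  move=> xz xx'; apply: le_trans (pos_sqnorm_lipschitz _ _) _.
  rewrite -linearB /=.
  have h1 : enorm (frob (reduced_score x)) <= M * (enorm z + 1).
    by apply: le_trans (WM x) _; rewrite ler_wpM2l.
  have h2 := WM (x - x'); rewrite xx' in h2.
  have h3 : b * enorm (y - z) <= e by rewrite mulrC -ler_pdivlMr// ltW.
  have h4 := ler_pM (enorm_ge0 _) (enorm_ge0 _) h1 h2.
  have h5 := enorm_ge0 (y - z).
  rewrite /b in h3; rewrite mulrDl in h3; lra.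
rewrite ler_norml; apply/andP; split.
  rewrite lerNl opprB; apply: est => //.
apply: est; last by rewrite enorm_distC.
by rewrite lerDl.
Unshelve. all: by end_near. Qed.

End Reduction.

(** * Gaussian laws *)

Import HBNNSimple.

(** Simple functions extend the defining identity of a density from sets to
    functions; [p] may take the value [+oo], as the densities of an experiment
    may. *)
Lemma ge0_integral_density d (T : measurableType d) (R : realType)
    (mu m : {measure set T -> \bar R}) (p : T -> \bar R) :
  measurable_fun setT p -> (forall x, 0 <= p x)%E ->
  (forall A, measurable A -> m A = \int[mu]_(x in A) p x)%E ->
  forall f : T -> \bar R, measurable_fun setT f -> (forall x, 0 <= f x)%E ->
  (\int[m]_x f x = \int[mu]_x (f x * p x))%E.
Proof.
move=> mp p0 mE f mf f0; pose h := nnsfun_approx measurableT mf.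
have hf x : (fun n => (h n x)%:E) @ \oo --> f x.
  exact: (@cvg_nnsfun_approx _ _ _ _ measurableT f mf (fun x _ => f0 x) x).
have ndh x : {homo (fun n => (h n x)%:E) : a b / (a <= b)%N >-> (a <= b)%E}.
  by move=> a b ab; rewrite lee_fin; exact/lefP/nd_nnsfun_approx.
have hle n x : ((h n x)%:E <= f x)%E.
  have -> := cvg_unique (@ereal_hausdorff R) (hf x) (ereal_nondecreasing_cvgn (ndh x)).
  by apply/ereal_sup_ubound; exists n.
have mh n : measurable_fun setT (fun x => (h n x)%:E).
  exact/measurable_EFinP.
have -> : (\int[m]_x f x = limn (fun n => \int[m]_x (h n x)%:E))%E.
  rewrite -monotone_convergence//.
  - by apply: eq_integral => x _; apply/esym/cvg_lim => //; exact: hf.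
  - by move=> n x _; rewrite lee_fin.
have -> : (\int[mu]_x (f x * p x) =
    limn (fun n => \int[mu]_x ((h n x)%:E * p x)))%E.
  rewrite -monotone_convergence//.
  - apply: eq_integral => x _; apply/esym/cvg_lim => //.
    have [p_oo|p_fin] := eqVneq (p x) +oo%E; last first.
      by apply: cvgeZr => //; rewrite ge0_fin_numE// ltey.
    rewrite p_oo; have [f00|f_neq0] := eqVneq (f x) 0%E.
      have h0 n : (h n x)%:E = 0%E.
        apply/eqP; rewrite eq_le -{1}f00 hle lee_fin; exact/fun_ge0.
      by rewrite f00 mul0e; under eq_fun do rewrite h0 mul0e; exact: cvg_cst.
    have [N hN] : exists N, 0 < h N x.
      apply: contrapT => /forallNP hN; move: f_neq0; apply/negP; rewrite negbK.
      rewrite eq_le f0 andbT; apply: (cvge_le _ (hf x)).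
      by apply: nearW => n; rewrite lee_fin leNgt; exact/negP.
    have f_gt0 : (0 < f x)%E by rewrite lt_def f_neq0 f0.
    rewrite (gt0_muley f_gt0).
    apply: (@cvg_trans _ ((fun=> +oo%E) @ \oo)); last exact: cvg_cst.
    apply: near_eq_cvg; near=> n.
    rewrite gt0_muley// lte_fin (lt_le_trans hN)// -lee_fin ndh//.
    by near: n; exact: nbhs_infty_ge.
  - by move=> n; apply: emeasurable_funM.
  - by move=> n x _; rewrite mule_ge0// lee_fin; exact/fun_ge0.
  - by move=> x _ a b ab; rewrite lee_wpmul2r//; exact: ndh.
congr (limn _); apply/funext => n.
under eq_integral do rewrite fimfunE -fsumEFin//.
rewrite ge0_integral_fsum//; last 2 first.
  - by move=> y; exact/measurable_EFinP/measurable_funM.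
  - by move=> y x _; rewrite nnfun_muleindic_ge0.
under [RHS]eq_integral => x _.
  rewrite fimfunE -fsumEFin// ge0_mule_fsuml; last first.
    by move=> y; rewrite nnfun_muleindic_ge0.
  over.
rewrite [RHS]ge0_integral_fsum//; last 2 first.
  - move=> y; apply: emeasurable_funM => //.
    exact/measurable_EFinP/measurable_funM.
  - by move=> y x _; rewrite mule_ge0// nnfun_muleindic_ge0.
apply: eq_fsbigr => r /[!inE] -[t _ hr].
rewrite integralZl_indic_nnsfun// integral_indic// setIT mE//.
under [RHS]eq_integral do rewrite EFinM -muleA.
rewrite ge0_integralZl//; last 3 first.
  - by apply: emeasurable_funM => //; exact/measurable_EFinP.
  - by move=> x _; rewrite mule_ge0// lee_fin.
  - by rewrite lee_fin -hr.
congr (_ * _)%E; rewrite integral_mkcond; apply: eq_integral => x _.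
rewrite patchE indicE; case: ifP => _; by rewrite ?mul1e ?mul0e.
Unshelve. all: by end_near. Qed.

Lemma measurable_affine (R : realType) (s a : R) :
  measurable_fun setT (fun x : R => s * x + a).
Proof. by apply: measurable_funD => //; exact: measurable_funM. Qed.

Lemma lebesgue_measure_affine_gt0 (R : realType) (s a : R) (B : set R) :
  0 < s -> measurable B ->
  (s%:E * lebesgue_measure ((fun x : R => s * x + a)%R @^-1` B) =
   lebesgue_measure B)%E.
Proof.
move=> s0 mB; apply/esym.
pose f (x : measurableTypeR R) : measurableTypeR R := s * x + a.
have mf : measurable_fun setT f by exact: measurable_affine.
pose pf : {measure set (measurableTypeR R) -> \bar R} :=
  measure_function_pushforward__canonical__measure_function_Measure lebesgue_measure mf.
pose m : {measure set (measurableTypeR R) -> \bar R} :=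
  mscale (NngNum (ltW s0)) pf.
rewrite (@lebesgue_measure_unique R m)// => _ [[x y] _ <-].
rewrite /m /= /mscale /= /pushforward.
have -> : f @^-1` `]x, y] = [set` `](x - a) / s, (y - a) / s]].
  apply/seteqP; split=> z; rewrite /= !in_itv /= /f ltr_pdivrMr// ler_pdivlMr//.
    by rewrite ltrBlDr lerBrDr (mulrC s).
  by rewrite ltrBlDr lerBrDr (mulrC s).
rewrite !lebesgue_measure_itv /= !lte_fin ltr_pM2r ?invr_gt0// ltrBlDr subrK.
case: ifP => _; last by rewrite mule0.
rewrite -!EFinD -EFinM; congr EFin; field; exact: lt0r_neq0.
Qed.

Lemma lebesgue_measure_affine (R : realType) (s a : R) (B : set R) :
  s != 0 -> measurable B ->
  (`|s|%:E * lebesgue_measure ((fun x : R => s * x + a)%R @^-1` B) =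
   lebesgue_measure B)%E.
Proof.
move=> s0 mB; have [sp|sn|s00] := ltgtP 0 s; last by rewrite s00 eqxx in s0.
  by rewrite gtr0_norm// lebesgue_measure_affine_gt0.
rewrite ltr0_norm// -(@lebesgue_measureN R (_ @^-1` B)); last first.
  by rewrite -[X in measurable X]setTI; exact: measurable_affine.
rewrite /pushforward -[RHS](@lebesgue_measure_affine_gt0 _ (- s) a)//; last lra.
congr (_ * lebesgue_measure _)%E.
by apply/funext => x /=; rewrite mulrN mulNr.
Qed.

Lemma ge0_integral_affine (R : realType) (s a : R) (f : R -> \bar R) :
  s != 0 -> measurable_fun setT f -> (forall x, 0 <= f x)%E ->
  (`|s|%:E * \int[lebesgue_measure]_x f (s * x + a)%R =
   \int[lebesgue_measure]_x f x)%E.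
Proof.
move=> s0 mf f0.
pose g (x : measurableTypeR R) : measurableTypeR R := s * x + a.
have mg : measurable_fun setT g by exact: measurable_affine.
pose pg : {measure set (measurableTypeR R) -> \bar R} :=
  measure_function_pushforward__canonical__measure_function_Measure lebesgue_measure mg.
have -> : (\int[lebesgue_measure]_x f (s * x + a)%R = \int[pg]_x f x)%E.
  by rewrite ge0_integral_pushforward.
rewrite -(@ge0_integral_mscale _ _ _ pg _ _ (NngNum (normr_ge0 s)))//.
apply: eq_measure_integral => A mA _ /=; rewrite /mscale /=.
exact: lebesgue_measure_affine.
Qed.

Section Gaussian_line.
Variable R : realType.
Local Notation leb := (@lebesgue_measure R).
Local Notation phi := (@normal_pdf R 0 1).

Lemma normal_pdf01E (x : R) : phi x = normal_peak 1 * expR (- x ^+ 2 / 2).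
Proof.
by rewrite normal_pdfE ?oner_neq0// /normal_fun subr0 expr1n.
Qed.

Lemma ge0_integral_normal (f : R -> \bar R) :
  measurable_fun setT f -> (forall x, 0 <= f x)%E ->
  (\int[normal_prob 0 1]_x f x = \int[leb]_x (f x * (phi x)%:E))%E.
Proof.
move=> mf f0; apply: ge0_integral_density => //.
- by apply/measurable_EFinP; exact: measurable_normal_pdf.
- by move=> x; rewrite lee_fin normal_pdf_ge0.
Qed.

Lemma normal_prob_indicE (s : R) (B : set R) : measurable B ->
  (normal_prob 0 s B = \int[leb]_x (\1_B x * normal_pdf 0 s x)%:E)%E.
Proof.
move=> mB; rewrite /normal_prob integral_mkcond; apply: eq_integral => x _.
by rewrite patchE indicE; case: ifP => _; rewrite ?mul1r ?mul0r.
Qed.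

Lemma measurable_indic_pdf (s : R) (B : set R) : measurable B ->
  measurable_fun setT (fun x => (\1_B x * normal_pdf 0 s x)%:E).
Proof.
move=> mB; apply/measurable_EFinP/measurable_funM => //.
exact: measurable_normal_pdf.
Qed.

Lemma indic_pdf_ge0 (s : R) (B : set R) x :
  (0 <= (\1_B x * normal_pdf 0 s x)%:E)%E.
Proof. by rewrite lee_fin mulr_ge0// normal_pdf_ge0. Qed.

(** The law of [s] times a standard normal variable; [s] may vanish, so that
    degenerate linear combinations need no separate statement. *)
Definition gauss_law (s : R) (B : set R) : \bar R :=
  normal_prob 0 1 [set x : R | B (s * x)].

Lemma measurable_scale (s : R) (B : set R) : measurable B ->
  measurable [set x : R | B (s * x)].
Proof.
move=> mB; rewrite -[X in measurable X]setTI.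
suff : measurable_fun setT (fun x : R => s * x) by exact.
exact: measurable_funM.
Qed.

Lemma normal_prob_scale (s : R) (B : set R) : 0 < s -> measurable B ->
  normal_prob 0 s B = gauss_law s B.
Proof.
move=> s0 mB; have sn0 : s != 0 by exact: lt0r_neq0.
rewrite /gauss_law !normal_prob_indicE//; last exact: measurable_scale.
rewrite -(@ge0_integral_affine _ s 0)//; last 2 first.
- exact: measurable_indic_pdf.
- exact: indic_pdf_ge0.
rewrite gtr0_norm// -ge0_integralZl_EFin ?ltW//; last 2 first.
- by move=> x _; exact: indic_pdf_ge0.
- apply: (measurableT_comp (measurable_indic_pdf s mB)).
  exact: measurable_affine.
apply: eq_integral => x _; rewrite addr0 !indicE -EFinM.
have -> : (s * x \in B) = (x \in [set x0 | B (s * x0)]).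
  by apply/idP/idP; rewrite !inE.
rewrite mulrCA; congr (_ * _)%:E.
rewrite normal_pdf01E normal_pdfE// /normal_fun subr0 mulrA; congr (_ * expR _).
  rewrite /normal_peak expr1n mul1r -mulrnAr sqrtrM ?sqr_ge0// sqrtr_sqr gtr0_norm//.
  by rewrite invfM mulrA divff// mul1r.
by rewrite exprMn -mulr_natr; field.
Qed.

Lemma normal_probN (B : set R) : measurable B ->
  gauss_law (-1) B = normal_prob 0 1 B.
Proof.
move=> mB; rewrite /gauss_law !normal_prob_indicE//; last exact: measurable_scale.
rewrite -[RHS](@ge0_integral_affine _ (-1) 0); last 3 first.
- by rewrite oppr_eq0 oner_neq0.
- exact: measurable_indic_pdf.
- exact: indic_pdf_ge0.
rewrite normrN normr1 mul1e; apply: eq_integral => x _.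
rewrite addr0 !indicE !normal_pdf01E.
have -> : (x \in [set y | B (-1 * y)]) = (-1 * x \in B).
  by apply/idP/idP; rewrite !inE.
by rewrite exprMn sqrrN expr1n mul1r.
Qed.

Lemma gauss_law_probability (s : R) :
  exists m : probability (measurableTypeR R) R, forall B, m B = gauss_law s B.
Proof.
pose f (x : measurableTypeR R) : measurableTypeR R := s * x.
have mf : measurable_fun setT f by exact: measurable_funM.
pose g : {mfun measurableTypeR R >-> measurableTypeR R} := HB.pack f
  (isMeasurableFun.Build _ _ _ _ f mf).
by exists (distribution (normal_prob 0 1) g).
Qed.

Lemma gauss_lawN (s : R) (B : set R) : measurable B ->
  gauss_law (- s) B = gauss_law s B.
Proof.
move=> mB; rewrite /gauss_law -[RHS]normal_probN; last exact: measurable_scale.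
by congr (normal_prob 0 1 _); apply/funext => x /=; rewrite mulN1r mulrN mulNr.
Qed.

(** Completing the square: for [a ^+ 2 + b ^+ 2 = 1] the joint density of [x]
    and [u = a * x + b * y] is that of [u] times a normal density in [x]. *)
Lemma normal_rotation (a b : R) (B : set R) : b != 0 -> a ^+ 2 + b ^+ 2 = 1 ->
  measurable B ->
  (\int[normal_prob 0 1]_x normal_prob 0 1 [set y : R | B (a * x + b * y)%R] =
   normal_prob 0 1 B)%E.
Proof.
move=> b0 ab mB.
have mphi : measurable_fun setT phi by exact: measurable_normal_pdf.
pose k (x u : R) := `|b|^-1 * phi ((u - a * x) / b) * phi x.
have kE x u : k x u = `|b|^-1 * phi ((x - a * u) / b) * phi u.
  rewrite /k !normal_pdf01E; set p := normal_peak 1.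
  have E c e : `|b|^-1 * (p * expR (- c ^+ 2 / 2)) * (p * expR (- e ^+ 2 / 2)) =
      `|b|^-1 * p * p * expR (- (c ^+ 2 + e ^+ 2) / 2).
    have -> : - (c ^+ 2 + e ^+ 2) / 2 = - c ^+ 2 / 2 + - e ^+ 2 / 2 by lra.
    rewrite expRD; ring.
  rewrite !E; congr (_ * expR (- _ / 2)).
  have b2 : b ^+ 2 = 1 - a ^+ 2 by rewrite -ab addrAC subrr add0r.
  rewrite !exprMn exprVn b2; field.
  by rewrite -b2 expf_neq0.
have k0 x u : 0 <= k x u.
  by rewrite !mulr_ge0// ?normal_pdf_ge0// invr_ge0.
have mk : measurable_fun setT (fun z : R * R => (k z.1 z.2)%:E).
  apply/measurable_EFinP; apply: measurable_funM; last first.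
    exact: measurableT_comp.
  apply: measurable_funM => //; apply: measurableT_comp => //.
  apply: measurable_funM => //; apply: measurable_funB => //.
  exact: measurable_funM.
pose F (z : R * R) := (\1_B z.2 * k z.1 z.2)%:E.
have mF : measurable_fun setT F.
  apply/measurable_EFinP; apply: measurable_funM; last exact/measurable_EFinP.
  exact: measurableT_comp.
have F0 z : (0 <= F z)%E by rewrite lee_fin mulr_ge0.
transitivity (\int[leb]_x \int[leb]_u F (x, u))%E.
  have mC : measurable [set z : R * R | B (a * z.1 + b * z.2)].
    rewrite -[X in measurable X]setTI.
    suff : measurable_fun setT (fun z : R * R => a * z.1 + b * z.2) by exact.
    by apply: measurable_funD; exact: measurable_funM.
  have secE x : [set y : R | B (a * x + b * y)] =
      xsection [set z : R * R | B (a * z.1 + b * z.2)] x.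
    by apply/seteqP; split=> y /=; rewrite /xsection /= inE.
  rewrite ge0_integral_normal; last 2 first.
  - under eq_fun do rewrite secE.
    exact: (measurable_fun_xsection (normal_prob 0 1) mC).
  - by move=> x; exact: measure_ge0.
  apply: eq_integral => x _.
  have mBx : measurable [set y : R | B (a * x + b * y)].
    by rewrite secE; exact: measurable_xsection.
  rewrite normal_prob_indicE//.
  have mFx : measurable_fun setT (fun u => F (x, u)).
    by apply: measurableT_comp => //; exact: measurable_fun_pair.
  rewrite -[RHS](@ge0_integral_affine _ b (a * x))//.
  rewrite muleC -ge0_integralZl_EFin//; last 3 first.
  - by move=> y _; exact: indic_pdf_ge0.
  - exact: measurable_indic_pdf.
  - exact: normal_pdf_ge0.
  rewrite -ge0_integralZl_EFin//; last first.
    by apply: (measurableT_comp mFx); exact: measurable_affine.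
  apply: eq_integral => y _; rewrite /F /= /k addrK -!EFinM; congr EFin.
  rewrite !indicE.
  have -> : (b * y + a * x \in B) = (y \in [set y0 | B (a * x + b * y0)]).
    by rewrite addrC; apply/idP/idP; rewrite !inE.
  rewrite [b * y]mulrC mulfK//.
  by field; rewrite normr_eq0.
rewrite (@fubini_tonelli _ _ _ _ _ lebesgue_measure lebesgue_measure F mF F0).
rewrite normal_prob_indicE//; apply: eq_integral => u _.
have mFu : measurable_fun setT (fun x => F (x, u)).
  by apply: measurableT_comp => //; exact: measurable_fun_pair.
rewrite -[LHS](@ge0_integral_affine _ b (a * u))// -ge0_integralZl_EFin//; last first.
  by apply: (measurableT_comp mFu); exact: measurable_affine.
rewrite -[RHS]mule1 -(integral_normal_pdf 0 1).
rewrite -[RHS]ge0_integralZl_EFin//; last 3 first.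
- by move=> y _; rewrite lee_fin normal_pdf_ge0.
- exact/measurable_EFinP.
- by rewrite mulr_ge0// normal_pdf_ge0.
apply: eq_integral => y _; rewrite /F /= kE addrK [b * y]mulrC mulfK//.
by rewrite -!EFinM; congr EFin; field; rewrite normr_eq0.
Qed.

End Gaussian_line.

Section Gaussian_sum.
Variable R : realType.
Local Notation RR := (measurableTypeR R).

Lemma gauss_law_eqsq (s t : R) (B : set R) : s ^+ 2 = t ^+ 2 -> measurable B ->
  gauss_law s B = gauss_law t B.
Proof.
by move=> /eqP; rewrite eqf_sqr => /orP[|] /eqP -> // mB; exact: gauss_lawN.
Qed.

Lemma gauss_law_convolution (s t u : R) (B : set R) : measurable B ->
  s ^+ 2 + t ^+ 2 = u ^+ 2 ->
  (\int[normal_prob 0 1]_x normal_prob 0 1 [set y : R | B (s * x + t * y)%R] =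
   gauss_law u B)%E.
Proof.
move=> mB stu; have [t0|t0] := eqVneq t 0.
  rewrite (@gauss_law_eqsq u s)//; last by rewrite -stu t0 expr0n addr0.
  rewrite /gauss_law -[in RHS](setIT [set x : R | _]) -integral_indic//; last first.
    exact: measurable_scale.
  apply: eq_integral => x _; rewrite indicE.
  have [xB|xB] := boolP (x \in _).
    rewrite -(@probability_setT _ _ _ (normal_prob 0 1)); congr (normal_prob 0 1 _).
    apply/seteqP; split=> // y _ /=; rewrite t0 mul0r addr0.
    by rewrite inE in xB.
  transitivity (normal_prob 0 1 (set0 : set RR)); last exact: measure0.
  congr (normal_prob 0 1 _).
  apply/seteqP; split=> // y /=; rewrite t0 mul0r addr0 => xB'.
  by move/negP: xB; apply; rewrite inE.
have u0 : u != 0.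
  rewrite -sqrf_eq0 -stu gt_eqF// ltr_wpDl ?sqr_ge0// lt_def sqr_ge0.
  by rewrite sqrf_eq0 t0.
rewrite /gauss_law -[RHS](@normal_rotation _ (s / u) (t / u))//; last 3 first.
- by rewrite mulf_neq0// invr_eq0.
- by rewrite !exprMn exprVn -mulrDl stu mulfV// sqrf_eq0.
- exact: measurable_scale.
apply: eq_integral => x _; congr (normal_prob 0 1 _).
apply/funext => y /=; congr B; field; exact: u0.
Qed.

(** The factor [k] lets [m] be a joint law restricted to an independent event,
    which is how variables are added one at a time below. *)
Lemma gauss_law_sum (m : {measure set (RR * RR) -> \bar R}) (k s t u : R) :
  0 <= k -> s ^+ 2 + t ^+ 2 = u ^+ 2 ->
  (forall A B, measurable A -> measurable B ->
    m (A `*` B) = k%:E * (gauss_law s A * gauss_law t B))%E ->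
  forall B : set R, measurable B ->
  (m [set z : R * R | B (z.1 + z.2)%R] = k%:E * gauss_law u B)%E.
Proof.
move=> k0 stu mE B mB.
have mX : measurable [set z : R * R | B (z.1 + z.2)].
  rewrite -[X in measurable X]setTI.
  suff : measurable_fun setT (fun z : RR * RR => z.1 + z.2) by exact.
  exact: measurable_funD.
have [k00|kn0] := eqVneq k 0.
  rewrite k00 mul0e; apply/eqP; rewrite eq_le measure_ge0 andbT.
  have <- : m setT = 0%E.
    by rewrite -setXTT mE// k00 mul0e.
  by apply: le_measure; rewrite ?inE.
have kp : 0 < k by rewrite lt_def kn0.
have [gs gsE] := gauss_law_probability s.
have [gt gtE] := gauss_law_probability t.
have ki0 : 0 <= k^-1 by rewrite invr_ge0.
pose m1 : {measure set (RR * RR) -> \bar R} := mscale (NngNum ki0) m.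
pose f (z : RR * RR) : RR * RR := (s * z.1, t * z.2).
have mf : measurable_fun setT f.
  by apply: measurable_fun_pair; exact: measurable_funM.
pose m2 : {measure set (RR * RR) -> \bar R} :=
  measure_function_pushforward__canonical__measure_function_Measure
    (normal_prob 0 1 \x normal_prob 0 1)%E mf.
have E1 : (gs \x gt)%E [set z : R * R | B (z.1 + z.2)] = m1 [set z : R * R | B (z.1 + z.2)].
  apply: product_measure_unique => // A C mA mC.
  rewrite /m1 /= /mscale /= mE// gsE gtE muleA -EFinM mulVf// mul1e//.
have E2 : (gs \x gt)%E [set z : R * R | B (z.1 + z.2)] = m2 [set z : R * R | B (z.1 + z.2)].
  apply: product_measure_unique => // A C mA mC.
  rewrite /m2 /= /pushforward gsE gtE.
  rewrite -product_measure1E//; last 2 first.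
  - exact: measurable_scale.
  - exact: measurable_scale.
have -> : (m [set z : R * R | B (z.1 + z.2)%R] = k%:E * m1 [set z : R * R | B (z.1 + z.2)%R])%E.
  by rewrite /m1 /= /mscale /= muleA -EFinM mulfV// mul1e.
rewrite -E1 E2; congr (_ * _)%E; rewrite -(gauss_law_convolution mB stu).
rewrite /m2 /= /pushforward /product_measure1; apply: eq_integral => x _ /=.
congr (normal_prob 0 1 _); apply/seteqP; split => y; by rewrite /xsection /= inE.
Qed.

End Gaussian_sum.

Section Has_gauss_law.
Context {R : realType} {dT : measure_display} {T : measurableType dT}.
Variable P : probability T R.

Definition has_gauss_law (X : T -> R) (s : R) : Prop :=
  measurable_fun setT X /\
  forall B, measurable B -> P (X @^-1` B) = gauss_law s B.

Lemma measurable_preimage (X : T -> R) (B : set R) : measurable_fun setT X ->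
  measurable B -> measurable (X @^-1` B).
Proof. by move=> mX mB; rewrite -[X in measurable X]setTI; exact: mX. Qed.

Variables (J : finType) (Y : J -> T -> R).
Hypothesis mY : forall j, measurable_fun setT (Y j).
Hypothesis YN : forall j B, measurable B -> P (Y j @^-1` B) = normal_prob 0 1 B.
Hypothesis indY : mutually_independent P Y.
Variable a : J -> R.

Local Notation S l w := (\sum_(j <- l) a j * Y j w).

(** One variable is added at a time. Keeping an event on the variables that
    have not been summed yet is what makes independence usable in the
    induction. *)
Lemma gauss_partial_sum (l : seq J) : uniq l ->
  forall (D : {set J}) (B : set R) (C : J -> set R),
  (forall j, j \in l -> j \notin D) -> measurable B ->
  (forall j, measurable (C j)) ->
  (P ([set w | B (S l w)] `&` \bigcap_(j in [set` D]) (Y j @^-1` C j)) =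
   gauss_law (Num.sqrt (\sum_(j <- l) a j ^+ 2)) B *
   P (\bigcap_(j in [set` D]) (Y j @^-1` C j)))%E.
Proof.
have mS s : measurable_fun setT (fun w => S s w).
  by apply: measurable_sum => j; exact: measurable_funM.
have mcap (D : {set J}) C : (forall j, measurable (C j)) ->
    measurable (\bigcap_(j in [set` D]) (Y j @^-1` C j)).
  move=> mC; apply: fin_bigcap_measurable => // j _.
  exact: measurable_preimage.
elim: l => [_ D B C _ mB mC|i l IH /= /andP[il ul] D B C lD mB mC].
  set K := \bigcap_(j in _) _.
  have -> : gauss_law (Num.sqrt (\sum_(j <- [::]) a j ^+ 2)) B =
            (if 0 \in B then 1%E else 0%E).
    rewrite big_nil sqrtr0 /gauss_law; case: ifP => B0.
      rewrite -(@probability_setT _ _ _ (normal_prob 0 1)); congr (normal_prob 0 1 _).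
      by apply/seteqP; split=> // y _ /=; rewrite mul0r; rewrite inE in B0.
    transitivity (normal_prob 0 1 (set0 : set (measurableTypeR R))); last exact: measure0.
    congr (normal_prob 0 1 _); apply/seteqP; split=> // y /=; rewrite mul0r => B0'.
    by move/negP: B0; apply; rewrite inE.
  case: ifP => B0.
    rewrite mul1e; congr (P _); apply/seteqP; split => [w []//|w Kw]; split => //=.
    by rewrite big_nil; rewrite inE in B0.
  rewrite mul0e -(@measure0 _ _ _ P); congr (P _); apply/seteqP; split => // w [] /=.
  by rewrite big_nil => B0'; move/negP: B0; case; rewrite inE.
have iD : i \notin D by apply: lD; rewrite mem_head.
set K := \bigcap_(j in _) _.
have mK : measurable K by exact: mcap.
pose f w : measurableTypeR R * measurableTypeR R := (a i * Y i w, S l w).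
have mf : measurable_fun setT f.
  apply: measurable_fun_pair; last exact: (mS l).
  by apply: (@measurable_funM _ _ _ setT (fun=> a i) (Y i)).
pose m : {measure set (measurableTypeR R * measurableTypeR R) -> \bar R} :=
  measure_function_pushforward__canonical__measure_function_Measure (mrestr P mK) mf.
set u := Num.sqrt _.
have stu : a i ^+ 2 + Num.sqrt (\sum_(j <- l) a j ^+ 2) ^+ 2 = u ^+ 2.
  have h (s : seq J) : 0 <= \sum_(j <- s) a j ^+ 2.
    by rewrite sumr_ge0// => j _; rewrite sqr_ge0.
  by rewrite !sqr_sqrtr// big_cons.
have -> : [set w | B (\sum_(j <- i :: l) a j * Y j w)] `&` K =
    f @^-1` [set z : R * R | B (z.1 + z.2)] `&` K.
  by congr (_ `&` _); apply/funext => w; rewrite /f /= big_cons.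
have -> : P (f @^-1` [set z : R * R | B (z.1 + z.2)] `&` K) =
   m [set z : R * R | B (z.1 + z.2)] by [].
have PKE : P K = (fine (P K))%:E by rewrite fineK// fin_num_measure.
rewrite (@gauss_law_sum _ m (fine (P K)) _ _ u _ stu)//.
- by rewrite muleC PKE.
- by rewrite fine_ge0.
move=> A E mA mE; rewrite -PKE /m /= /pushforward /mrestr.
pose C' j := if j == i then [set y : R | A (a i * y)] else C j.
have mC' j : measurable (C' j).
  by rewrite /C'; case: eqP => // _; exact: measurable_scale.
have capE (Z : set T) : f @^-1` (A `*` E) `&` K =
    [set w | E (S l w)] `&` \bigcap_(j in [set` i |: D]) (Y j @^-1` C' j).
  apply/seteqP; split => w.
    move=> [[/= Aw Ew] Kw]; split => //= j /=; rewrite in_setU1 /C'.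
    by case: eqP => [-> _|_ /= jD]; [exact: Aw|exact: Kw].
  move=> [/= Ew Kw]; split; first split => //=.
    by have := Kw i; rewrite /C' /= eqxx; apply; rewrite in_setU1 eqxx.
  move=> j /= jD; have := Kw j; rewrite /C' /= in_setU1 jD orbT => /(_ isT).
  by case: eqP jD iD => // -> ->.
rewrite (capE set0) IH//; last first.
  move=> j jl; rewrite in_setU1 negb_or lD ?inE ?jl ?orbT// andbT.
  by apply: contraNneq il => <-.
rewrite !indY// big_setU1//= {1}/C' eqxx YN; last exact: measurable_scale.
have -> : (\prod_(j in D) P (Y j @^-1` C' j) = \prod_(j in D) P (Y j @^-1` C j))%E.
  apply: eq_bigr => j jD; rewrite /C'; case: eqP => // ji.
  by rewrite ji (negPf iD) in jD.
rewrite -[normal_prob 0 1 _]/(gauss_law (a i) A).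
move: (gauss_law _ E) (gauss_law _ A) (\prod_(j in D) _)%E => x y z.
by rewrite [LHS]muleC (muleC y z) -muleA.
Qed.

Lemma gauss_linear_combination :
  has_gauss_law (fun w => \sum_j a j * Y j w) (Num.sqrt (\sum_j a j ^+ 2)).
Proof.
split; first by apply: measurable_sum => j; exact: measurable_funM.
move=> B mB.
have := @gauss_partial_sum (index_enum J) (index_enum_uniq J) finset.set0 B
  (fun=> setT) _ mB (fun=> measurableT).
rewrite (_ : \bigcap_(j in _) _ = setT) ?setIT ?probability_setT ?mule1.
  by apply => j _; rewrite finset.in_set0.
by apply/seteqP; split => // w _ j _.
Qed.

End Has_gauss_law.

(** * The Cramer-Wold device for half-spaces *)

Section Sign_approximation.
Variable R : realType.

(** Iterating this odd polynomial pushes every nonzero point of [-1, 1]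
    towards its sign: the sign becomes a bounded limit of polynomials. *)
Definition sharpen (v : R) : R := (3 * v - v ^+ 3) / 2.

Lemma sharpenN v : sharpen (- v) = - sharpen v.
Proof. by rewrite /sharpen; lra. Qed.

Lemma iter_sharpenN n v : iter n sharpen (- v) = - iter n sharpen v.
Proof. by elim: n => //= n ->; rewrite sharpenN. Qed.

Lemma iter_sharpen_pos n v : 0 < v <= 1 ->
  v <= iter n sharpen v <= 1 /\
  1 - iter n sharpen v <= (1 - v / 2) ^+ n.
Proof.
move=> /andP[v0 v1]; elim: n => [|n [/andP[IH1 IH2] IH3]] /=.
  by rewrite lexx v1 expr0; split => //; lra.
set x := iter n sharpen v in IH1 IH2 IH3 *.
have x0 : 0 < x by exact: lt_le_trans IH1.
have h : 1 - sharpen x = (1 - x) * (1 - (x + x ^+ 2) / 2).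
  by rewrite /sharpen; field.
have x2 : 0 <= x ^+ 2 <= x by rewrite sqr_ge0 expr2 ler_piMl// ltW.
split.
  have -> : sharpen x = x + x * ((1 - x ^+ 2) / 2) by rewrite /sharpen; field.
  have hx : 0 <= x * ((1 - x ^+ 2) / 2) by rewrite mulr_ge0//; lra.
  rewrite -[X in _ && (_ <= X)](subrK (1 - (x + x * ((1 - x ^+ 2) / 2)))).
  have h' : 0 <= 1 - (x + x * ((1 - x ^+ 2) / 2)).
    have -> : 1 - (x + x * ((1 - x ^+ 2) / 2)) = 1 - sharpen x.
      by rewrite /sharpen; field.
    rewrite h mulr_ge0//; lra.
  lra.
rewrite h [leRHS]exprSr; apply: ler_pM => //; lra.
Qed.

Lemma iter_sharpen_le1 n v : -1 <= v <= 1 -> `|iter n sharpen v| <= 1.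
Proof.
move=> /andP[v1 v2]; have [v0|v0|v0] := ltgtP 0 v.
- have [] := @iter_sharpen_pos n v; first by rewrite v0.
  by rewrite ler_norml => /andP[h1 h2] _; lra.
- have [] := @iter_sharpen_pos n (- v); first by apply/andP; split; lra.
  by rewrite iter_sharpenN ler_norml => /andP[h1 h2] _; lra.
- rewrite -v0; suff -> : iter n sharpen 0 = 0 by rewrite normr0.
  by elim: n => //= n ->; rewrite /sharpen mulr0 expr0n subr0 mul0r.
Qed.

Lemma cvg_iter_sharpen v : -1 <= v <= 1 ->
  (fun n => iter n sharpen v) @ \oo --> Num.sg v.
Proof.
have pos u : 0 < u -> u <= 1 -> (fun n => iter n sharpen u) @ \oo --> (1 : R).
  move=> u0 u1; have H n := @iter_sharpen_pos n u (introT andP (conj u0 u1)).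
  apply: (@squeeze_cvgr _ _ _ _ (fun n => 1 - (1 - u / 2) ^+ n) (cst 1)).
  - by near=> n; have [/andP[h1 h2] h3] := H n; apply/andP; split => /=; lra.
  - rewrite -[X in _ --> X]subr0; apply: cvgB; first exact: cvg_cst.
    by apply: cvg_expr; rewrite ger0_norm; lra.
  - exact: cvg_cst.
move=> /andP[v1 v2]; have [v0|v0|v0] := ltgtP 0 v.
- by rewrite gtr0_sg//; exact: pos.
- rewrite ltr0_sg//.
  have -> : (fun n => iter n sharpen v) = (fun n => - iter n sharpen (- v)).
    by apply/funext => n; rewrite iter_sharpenN opprK.
  by apply: cvgN; apply: pos; lra.
- rewrite -v0 sgr0; have -> : (fun n => iter n sharpen (0:R)) = cst 0.
    apply/funext => n; elim: n => //= n ->; by rewrite /sharpen mulr0 expr0n subr0 mul0r.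
  exact: cvg_cst.
Unshelve. all: by end_near. Qed.

Lemma sgr_sin (x : R) : `|x| < pi -> Num.sg (sin x) = Num.sg x.
Proof.
move=> xpi; have [x0|x0|<-] := ltgtP 0 x.
- rewrite !gtr0_sg//; apply: sin_gt0_pi; rewrite x0 /=.
  by rewrite gtr0_norm in xpi.
- rewrite !ltr0_sg// -oppr_gt0 -sinN; apply: sin_gt0_pi.
  by rewrite ltr0_norm// in xpi; rewrite oppr_gt0 x0.
- by rewrite sin0.
Qed.

Lemma cvg_sgr_sin (x : R) :
  (fun n => Num.sg (sin (n.+1%:R^-1 * x))) @ \oo --> Num.sg x.
Proof.
apply: (@cvg_trans _ ((fun=> Num.sg x) @ \oo)); last exact: cvg_cst.
apply: near_eq_cvg; near=> n; rewrite sgr_sin.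
  by rewrite sgrM (gtr0_sg (_ : 0 < n.+1%:R^-1)) ?mul1r ?invr_gt0.
rewrite normrM ger0_norm ?invr_ge0// mulrC ltr_pdivrMr//.
rewrite -ltr_pdivrMl ?pi_gt0// mulrC (@lt_trans _ _ n%:R)// ?ltr_nat//.
by near: n; exact: nbhs_infty_gtr.
Unshelve. all: by end_near. Qed.

End Sign_approximation.

Section Tied.
Context {R : realType} {d1 d2 : measure_display}.
Context {T1 : measurableType d1} {T2 : measurableType d2}.
Variables (P1 : probability T1 R) (P2 : probability T2 R).
Context {V : lmodType R}.
Variables (X : V -> T1 -> R) (Y : V -> T2 -> R).

(** Pairs of bounded functions of the families [X] and [Y] built in the same
    way from trigonometric functions by linear combinations and bounded
    pointwise limits. *)
Inductive tied : (T1 -> R) -> (T2 -> R) -> Prop :=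
| tied_cos u p : tied (fun w => cos (X u w + p)) (fun w => cos (Y u w + p))
| tied_lin a F1 F2 G1 G2 : tied F1 F2 -> tied G1 G2 ->
    tied (fun w => a * F1 w + G1 w) (fun w => a * F2 w + G2 w)
| tied_lim M (F1 : nat -> T1 -> R) (F2 : nat -> T2 -> R) G1 G2 :
    (forall n, tied (F1 n) (F2 n)) ->
    (forall n w, `|F1 n w| <= M) -> (forall n w, `|F2 n w| <= M) ->
    (forall w, F1 ^~ w @ \oo --> G1 w) -> (forall w, F2 ^~ w @ \oo --> G2 w) ->
    tied G1 G2.

Lemma tied_bounded F1 F2 : tied F1 F2 ->
  exists M, (forall w, `|F1 w| <= M) /\ (forall w, `|F2 w| <= M).
Proof.
elim=> [u p|a {}F1 {}F2 G1 G2 _ [M [M1 M2]] _ [N [N1 N2]]|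
        M {}F1 {}F2 G1 G2 _ _ M1 M2 c1 c2].
- by exists 1; split => w; exact: cos_max.
- by exists (`|a| * M + N); split => w; rewrite (le_trans (ler_normD _ _))//;
    rewrite lerD// normrM ler_wpM2l.
- exists M; split => w.
    by apply: cvgr_to_le (cvg_norm (c1 w)) _; exact: nearW.
  by apply: cvgr_to_le (cvg_norm (c2 w)) _; exact: nearW.
Qed.

Hypothesis mX : forall u, measurable_fun setT (X u).
Hypothesis mY : forall u, measurable_fun setT (Y u).

Lemma tied_measurable F1 F2 : tied F1 F2 ->
  measurable_fun setT F1 /\ measurable_fun setT F2.
Proof.
have mcos d (T : measurableType d) (f : T -> R) p : measurable_fun setT f ->
    measurable_fun setT (fun w => cos (f w + p)).
  move=> mf; apply: (measurableT_comp (f := cos)).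
    by apply: continuous_measurable_fun; exact: continuous_cos.
  exact: measurable_funD.
elim=> [u p|a {}F1 {}F2 G1 G2 _ [m1 m2] _ [n1 n2]|
        M {}F1 {}F2 G1 G2 _ h _ _ c1 c2].
- by split; exact: mcos.
- by split; apply: measurable_funD => //; exact: measurable_funM.
- split.
    by apply: (measurable_fun_cvg (h := F1)) => [n|w _]; [have [] := h n|exact: c1].
  by apply: (measurable_fun_cvg (h := F2)) => [n|w _]; [have [] := h n|exact: c2].
Qed.

Lemma bounded_integrable d (T : measurableType d) (P : probability T R)
    (f : T -> R) M : measurable_fun setT f -> (forall w, `|f w| <= M) ->
  P.-integrable setT (EFin \o f).
Proof.
move=> mf fM.
apply: (le_integrable _ _ _ (finite_measure_integrable_cst P M measurableT)) => //.
  exact/measurable_EFinP.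
by move=> w _ /=; rewrite lee_fin (le_trans (fM w))// ler_norm.
Qed.

Hypothesis XY_cos : forall u p,
  (\int[P1]_w (cos (X u w + p))%:E = \int[P2]_w (cos (Y u w + p))%:E)%E.

Lemma tied_integral F1 F2 : tied F1 F2 ->
  (\int[P1]_w (F1 w)%:E = \int[P2]_w (F2 w)%:E)%E.
Proof.
have lin d (T : measurableType d) (P : probability T R) (f g : T -> R) a M N :
    measurable_fun setT f -> (forall w, `|f w| <= M) ->
    measurable_fun setT g -> (forall w, `|g w| <= N) ->
    (\int[P]_w (a * f w + g w)%:E =
     a%:E * \int[P]_w (f w)%:E + \int[P]_w (g w)%:E)%E.
  move=> mf fM mg gN.
  have fi := bounded_integrable P mf fM; have gi := bounded_integrable P mg gN.
  transitivity (\int[P]_w (a%:E * (EFin \o f) w + (EFin \o g) w))%E.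
    by apply: eq_integral => w _; rewrite /= EFinD EFinM.
  rewrite integralD//; last exact: (integrableZl measurableT a fi).
  by rewrite integralZl.
have lim d (T : measurableType d) (P : probability T R) (f : nat -> T -> R) g M :
    (forall n, measurable_fun setT (f n)) -> (forall n w, `|f n w| <= M) ->
    (forall w, f ^~ w @ \oo --> g w) ->
    (\int[P]_w (f n w)%:E @[n --> \oo] --> \int[P]_w (g w)%:E)%E.
  move=> mf fM fg.
  apply: (@dominated_cvg _ _ _ _ _ _ _ _ (EFin \o cst M)) => //.
  - by move=> n; exact/measurable_EFinP.
  - by move=> w _; apply: cvg_EFin; [exact: nearW|exact: fg].
  - exact: finite_measure_integrable_cst.
  - by move=> n w _; rewrite /= lee_fin.
elim=> [u p|a {}F1 {}F2 G1 G2 tF IF tG IG|M {}F1 {}F2 G1 G2 tF IF M1 M2 c1 c2].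
- exact: XY_cos.
- have [M [M1 M2]] := tied_bounded tF; have [N [N1 N2]] := tied_bounded tG.
  have [m1 m2] := tied_measurable tF; have [n1 n2] := tied_measurable tG.
  by rewrite (lin _ _ _ _ _ _ M N)// (lin _ _ _ _ _ _ M N)// IF IG.
- have c1' := lim _ _ P1 F1 G1 M (fun n => (tied_measurable (tF n)).1) M1 c1.
  have c2' := lim _ _ P2 F2 G2 M (fun n => (tied_measurable (tF n)).2) M2 c2.
  apply: (cvg_unique (@ereal_hausdorff R) c1').
  suff -> : (fun n => \int[P1]_w (F1 n w)%:E)%E = (fun n => \int[P2]_w (F2 n w)%:E)%E.
    exact: c2'.
  by apply/funext => n; exact: IF.
Qed.

Hypothesis XD : forall u v w, X (u + v) w = X u w + X v w.
Hypothesis YD : forall u v w, Y (u + v) w = Y u w + Y v w.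
Hypothesis XZ : forall a u w, X (a *: u) w = a * X u w.
Hypothesis YZ : forall a u w, Y (a *: u) w = a * Y u w.

Lemma tied_ext F1 F2 G1 G2 : tied F1 F2 -> F1 =1 G1 -> F2 =1 G2 -> tied G1 G2.
Proof. by move=> t /funext <- /funext <-. Qed.

Lemma tied_cst c : tied (fun=> c) (fun=> c).
Proof.
have z : tied (fun=> 0) (fun=> 0).
  apply: tied_ext (tied_lin (-1) (tied_cos 0 0) (tied_cos 0 0)) _ _ => w;
  by rewrite mulN1r addNr.
apply: tied_ext (tied_lin c (tied_cos 0 0) z) _ _ => w.
  by rewrite -(scale0r 0) XZ mul0r !addr0 cos0 mulr1.
by rewrite -(scale0r 0) YZ mul0r !addr0 cos0 mulr1.
Qed.

Lemma tied_scale a F1 F2 : tied F1 F2 ->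
  tied (fun w => a * F1 w) (fun w => a * F2 w).
Proof.
move=> t; apply: tied_ext (tied_lin a t (tied_cst 0)) _ _ => w;
by rewrite addr0.
Qed.

Lemma tied_mul F1 F2 G1 G2 : tied F1 F2 -> tied G1 G2 ->
  tied (fun w => F1 w * G1 w) (fun w => F2 w * G2 w).
Proof.
move=> tF; elim: tF G1 G2 => [u p|a {}F1 {}F2 H1 H2 _ IF _ IH|
    M {}F1 {}F2 H1 H2 _ IF M1 M2 c1 c2] G1 G2 tG.
- elim: tG => [v q|a {}F1 {}F2 H1 H2 _ IF _ IH|M {}F1 {}F2 H1 H2 _ IF M1 M2 c1 c2].
  + have E (x y : R) : cos x * cos y = 1 / 2 * cos (x + y) + 1 / 2 * cos (x - y).
      by rewrite cosD cosB; lra.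
    apply: tied_ext (tied_lin (1 / 2) (tied_cos (u + v) (p + q))
      (tied_scale (1 / 2) (tied_cos (u + (-1) *: v) (p - q)))) _ _ => w.
      rewrite XD XD XZ E; congr (_ * cos _ + _ * cos _); lra.
    rewrite YD YD YZ E; congr (_ * cos _ + _ * cos _); lra.
  + apply: tied_ext (tied_lin a IF IH) _ _ => w; ring.
  + apply: (@tied_lim M _ _ _ _ IF) => [n w|n w|w|w].
    * rewrite normrM -[leRHS]mul1r; apply: ler_pM => //; exact: cos_max.
    * rewrite normrM -[leRHS]mul1r; apply: ler_pM => //; exact: cos_max.
    * by apply: cvgM => //; exact: cvg_cst.
    * by apply: cvgM => //; exact: cvg_cst.
- apply: tied_ext (tied_lin a (IF _ _ tG) (IH _ _ tG)) _ _ => w; ring.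
- have [N [N1 N2]] := tied_bounded tG.
  apply: (@tied_lim (M * N) _ _ _ _ (fun n => IF n _ _ tG)) => [n w|n w|w|w].
  + by rewrite normrM; apply: ler_pM.
  + by rewrite normrM; apply: ler_pM.
  + by apply: cvgM => //; exact: cvg_cst.
  + by apply: cvgM => //; exact: cvg_cst.
Qed.

(** The indicator of a half-line is a quadratic polynomial in the sign; the
    sign of [x] is the limit of the sign of [sin (x / n)], which is in turn the
    limit of polynomials in [sin (x / n)]. *)
Lemma tied_halfspace u b :
  tied (\1_[set w | X u w <= b]) (\1_[set w | Y u w <= b]).
Proof.
have sin1 (x : R) : -1 <= sin x <= 1 by rewrite sin_geN1 sin_le1.
have t_sharpen H1 H2 : tied H1 H2 ->
    tied (fun w => sharpen (H1 w)) (fun w => sharpen (H2 w)).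
  move=> h; have h3 := tied_mul (tied_mul h h) h.
  apply: tied_ext (tied_lin (3 / 2) h (tied_scale (- 1 / 2) h3)) _ _ => w;
  by rewrite /sharpen !exprS expr0; field.
have t_sin n : tied (fun w => sin (n.+1%:R^-1 * (X u w - b)))
                    (fun w => sin (n.+1%:R^-1 * (Y u w - b))).
  apply: tied_ext (tied_cos (n.+1%:R^-1 *: u) (- (n.+1%:R^-1 * b) - pi / 2)) _ _ => w.
    by rewrite XZ addrA -mulrBr cosBpihalf.
  by rewrite YZ addrA -mulrBr cosBpihalf.
have t_sg_sin n : tied (fun w => Num.sg (sin (n.+1%:R^-1 * (X u w - b))))
                       (fun w => Num.sg (sin (n.+1%:R^-1 * (Y u w - b)))).
  apply: (@tied_lim 1
    (fun k w => iter k (@sharpen R) (sin (n.+1%:R^-1 * (X u w - b))))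
    (fun k w => iter k (@sharpen R) (sin (n.+1%:R^-1 * (Y u w - b))))) => //.
  - by elim=> [|k IH]; [exact: t_sin|exact: t_sharpen].
  - by move=> k w; exact: iter_sharpen_le1.
  - by move=> k w; exact: iter_sharpen_le1.
  - by move=> w; exact: cvg_iter_sharpen.
  - by move=> w; exact: cvg_iter_sharpen.
have sg1 (x : R) : `|Num.sg x| <= 1 by rewrite normr_sg; case: eqP.
have t_sg : tied (fun w => Num.sg (X u w - b)) (fun w => Num.sg (Y u w - b)).
  apply: (@tied_lim 1 _ _ _ _ t_sg_sin) => //.
  - by move=> w; exact: cvg_sgr_sin.
  - by move=> w; exact: cvg_sgr_sin.
have E (x : R) : - 1 / 2 * (Num.sg (x - b) * Num.sg (x - b)) +
    (- 1 / 2 * Num.sg (x - b) + 1) = (x <= b)%R%:R.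
  rewrite -subr_le0; have [h|h|h] := ltgtP 0 (x - b).
  - by rewrite gtr0_sg// mulr0n; lra.
  - by rewrite ltr0_sg// mulr1n; lra.
  - by rewrite -h sgr0 mulr1n; lra.
apply: tied_ext (tied_lin (- 1 / 2) (tied_mul t_sg t_sg)
  (tied_lin (- 1 / 2) t_sg (tied_cst 1))) _ _ => w.
  by rewrite E indicE; congr (_%:R); congr nat_of_bool; apply/idP/idP; rewrite inE.
by rewrite E indicE; congr (_%:R); congr nat_of_bool; apply/idP/idP; rewrite inE.
Qed.

(** The Cramer-Wold device without Fourier inversion. Trigonometric functions
    of the two families have the same integrals, this passes to products and
    bounded limits, and indicators of half-spaces are obtained in this way. *)
Lemma cramer_wold_halfspaces (u : nat -> V) (b : nat -> R) :
  P1 [set w | forall i, X (u i) w <= b i] =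
  P2 [set w | forall i, Y (u i) w <= b i].
Proof.
pose A1 n := [set w | forall i, (i < n)%N -> X (u i) w <= b i].
pose A2 n := [set w | forall i, (i < n)%N -> Y (u i) w <= b i].
have AS T' (Z : V -> T' -> R) n :
    \1_[set w | forall i, (i < n.+1)%N -> Z (u i) w <= b i] =1
    (fun w => \1_[set w | forall i, (i < n)%N -> Z (u i) w <= b i] w *
             \1_[set w | Z (u n) w <= b n] w : R).
  move=> w; rewrite !indicE -natrM mulnb; congr (_%:R); congr nat_of_bool.
  apply/idP/andP; rewrite !inE /=.
    by move=> h; split; [move=> i ni; apply: h; exact: ltnW|exact: h].
  by move=> [h1 h2] i; rewrite ltnS leq_eqVlt => /orP[/eqP ->//|]; exact: h1.
have tA n : tied (\1_(A1 n)) (\1_(A2 n)).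
  elim: n => [|n IH].
    apply: tied_ext (tied_cst 1) _ _ => w; rewrite indicE mem_set//.
  apply: tied_ext (tied_mul IH (tied_halfspace (u n) (b n))) _ _ => w.
    by rewrite AS.
  by rewrite AS.
have cA T' (Z : V -> T' -> R) w :
    (fun n => \1_[set w | forall i, (i < n)%N -> Z (u i) w <= b i] w : R) @ \oo -->
    (\1_[set w | forall i, Z (u i) w <= b i] w : R).
  apply: (@cvg_trans _ ((fun=> \1_[set w | forall i, Z (u i) w <= b i] w : R) @ \oo));
    last exact: cvg_cst.
  apply: near_eq_cvg; have [h|/existsNP[i hi]] := pselect (forall i, Z (u i) w <= b i).
    by apply: nearW => n; rewrite !indicE !mem_set//.
  near=> n; rewrite !indicE !memNset//= => h; apply: hi => //; apply: h.
  by near: n; exact: nbhs_infty_gt.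
have ind1 T' (A : set T') w : `|\1_A w : R| <= 1.
  by rewrite indicE; case: (_ \in _); rewrite ?normr1 ?normr0.
have t : tied (\1_[set w | forall i, X (u i) w <= b i])
              (\1_[set w | forall i, Y (u i) w <= b i]).
  apply: (@tied_lim 1 _ _ _ _ tA) => //.
  - by move=> w; exact: (cA _ X).
  - by move=> w; exact: (cA _ Y).
have mA d (T : measurableType d) (Z : V -> T -> R) :
    (forall u, measurable_fun setT (Z u)) ->
    measurable [set w | forall i, Z (u i) w <= b i].
  move=> mZ.
  have -> : [set w | forall i, Z (u i) w <= b i] =
      \bigcap_i (Z (u i) @^-1` `]-oo, b i]).
    apply/seteqP; split => w /=; first by move=> h i _; rewrite /= in_itv /= h.
    by move=> h i; have := h i I; rewrite /= in_itv.
  apply: bigcapT_measurable => i; rewrite -[X in measurable X]setTI; exact: mZ.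
have := tied_integral t; rewrite !integral_indic ?setIT//; exact: mA.
Unshelve. all: by end_near. Qed.

End Tied.

(** * Gaussian symmetric matrices *)

Lemma measurable_continuous_random dT (T : measurableType dT) (R : realType)
    (V : topologicalType) (X : T -> V) (g : V -> R) :
  random_element X -> continuous g -> measurable_fun setT (g \o X).
Proof.
move=> rX cg; apply: (measurability _ (RGenInftyO.measurableE R)).
move=> _ [_ [x ->] <-]; rewrite setTI -[_ @^-1` _]/(X @^-1` (g @^-1` `]-oo, x[)).
by apply: rX; move/continuousP : cg; apply; exact: interval_open.
Qed.

Section Sym_gaussian.
Context {R : realType} {n : nat}.

Definition mxdot (A B : 'M[R]_n) : R := \tr (A *m B).

Lemma mxdot_sum (A B : 'M[R]_n) : B^T = B ->
  mxdot A B = \sum_(ij : 'I_n * 'I_n) A ij.1 ij.2 * B ij.1 ij.2.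
Proof.
move=> BT; rewrite -(pair_bigA _ (fun i j => A i j * B i j)) /=.
apply: eq_bigr => i _; rewrite mxE; apply: eq_bigr => j _.
by rewrite -{1}BT mxE.
Qed.

Lemma mxtrace_sym_basis (A : 'M[R]_n) ij : A^T = A ->
  \tr (A *m sym_basis R ij) =
  (if ij.1 == ij.2 then 1 else Num.sqrt 2) * A ij.1 ij.2.
Proof.
move=> AT; have tr_delta i j : \tr (A *m delta_mx i j) = A j i.
  rewrite /mxtrace (bigD1 j)//= big1 ?addr0 => [|l lj].
    rewrite mxE (bigD1 i)//= big1 ?addr0 => [|l li].
      by rewrite !mxE !eqxx mulr1.
    by rewrite !mxE (negPf li) mulr0.
  by rewrite mxE big1// => l' _; rewrite !mxE (negPf lj) andbF mulr0.
rewrite /sym_basis; case: eqP => [<-|_]; first by rewrite tr_delta mul1r.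
have AE : A ij.2 ij.1 = A ij.1 ij.2 by rewrite -{1}AT mxE.
rewrite -scalemxAr mulmxDr mxtraceZ mxtraceD !tr_delta AE.
have s2 : Num.sqrt 2 != 0 :> R by rewrite sqrtr_eq0 -ltNge ltr0n.
have s22 : Num.sqrt 2 * Num.sqrt 2 = 2 :> R by rewrite -expr2 sqr_sqrtr.
apply: (mulfI s2); rewrite mulrA divff// mul1r mulrA s22; lra.
Qed.

(** The matrices [sym_basis] are an orthonormal basis of the symmetric
    matrices. *)
Lemma mxdot_sym_basis (A B : 'M[R]_n) : A^T = A -> B^T = B ->
  mxdot A B = \sum_(ij : {ij : 'I_n * 'I_n | (ij.1 <= ij.2)%N})
    \tr (A *m sym_basis R (val ij)) * \tr (B *m sym_basis R (val ij)).
Proof.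
move=> AT BT; pose x (ij : 'I_n * 'I_n) := A ij.1 ij.2 * B ij.1 ij.2.
have xs ij : x (ij.2, ij.1) = x ij by rewrite /x /= -{1}AT -{1}BT !mxE.
rewrite mxdot_sum// -[LHS]/(\sum_ij x ij).
transitivity (\sum_(ij : 'I_n * 'I_n | (ij.1 <= ij.2)%N)
    (if ij.1 == ij.2 then 1 else 2) * x ij); last first.
  rewrite (big_sub [pred ij : 'I_n * 'I_n | (ij.1 <= ij.2)%N]
    (fun ij => (if ij.1 == ij.2 then 1 else 2) * x ij)).
  apply: eq_bigr => ij _; rewrite !mxtrace_sym_basis// /x.
  case: eqP => _; first by rewrite !mul1r.
  by rewrite mulrACA -expr2 sqr_sqrtr ?ler0n.
rewrite (bigID [pred ij : 'I_n * 'I_n | (ij.1 <= ij.2)%N]) /=.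
have -> : \sum_(ij : 'I_n * 'I_n | ~~ (ij.1 <= ij.2)%N) x ij =
    \sum_(ij : 'I_n * 'I_n | (ij.1 < ij.2)%N) x ij.
  rewrite (reindex (fun ij : 'I_n * 'I_n => (ij.2, ij.1))) /=; last first.
    by exists (fun ij : 'I_n * 'I_n => (ij.2, ij.1)) => -[].
  by apply: eq_big => ij; [rewrite -ltnNge|rewrite xs].
rewrite (bigID (fun ij : 'I_n * 'I_n => ij.1 == ij.2)) [RHS](bigID (fun ij : 'I_n * 'I_n => ij.1 == ij.2)) /=.
rewrite -addrA; congr (_ + _).
  by apply: eq_bigr => ij /andP[_ ->]; rewrite mul1r.
have E (ij : 'I_n * 'I_n) : (ij.1 < ij.2)%N = (ij.1 <= ij.2)%N && (ij.1 != ij.2).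
  by move: ij => [i j] /=; rewrite ltn_neqAle andbC.
rewrite (eq_bigl _ _ E) -big_split /=; apply: eq_bigr => ij /andP[_ /negPf ->].
by rewrite mulr_natl mulr2n.
Qed.

Lemma sym_linear_continuous (t : 'M[R]_n) :
  continuous (fun A : sym R n => \tr (t *m vsval A) : R).
Proof.
move=> A; rewrite /continuous_at.
have -> : (fun A : sym R n => \tr (t *m vsval A) : R) =
    fun A => \sum_i \sum_j t i j * vsval A j i.
  by apply/funext => B; apply: eq_bigr => i _; rewrite mxE.
have -> : \tr (t *m vsval A) = \sum_i \sum_j t i j * vsval A j i.
  by apply: eq_bigr => i _; rewrite mxE.
apply: (cvg_sumr (nbhs_filter A)) => i; apply: (cvg_sumr (nbhs_filter A)) => j.
apply: cvgM; first exact: cvg_cst.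
apply: (@continuous_comp _ _ _ (vsval : sym R n -> 'M[R]_n) (fun M => M j i)).
  exact: initial_continuous.
exact: coord_continuous.
Qed.

Lemma standard_gaussian_linear dT (T : measurableType dT) (P : probability T R)
    (G : T -> sym R n) (t : sym R n) : standard_gaussian P G ->
  has_gauss_law P (fun w => \tr (vsval t *m vsval (G w)))
    (Num.sqrt (\tr (vsval t *m vsval t))).
Proof.
move=> [rG GN indG].
have mG ij : measurable_fun setT (sym_coord G ij).
  have -> : sym_coord G ij = (fun A : sym R n => \tr (sym_basis R (val ij) *m vsval A)) \o G.
    by apply/funext => w; rewrite /sym_coord mxtrace_mulC.
  exact: measurable_continuous_random rG (@sym_linear_continuous _).
have := gauss_linear_combination mG GN indG
  (fun ij => \tr (vsval t *m sym_basis R (val ij))).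
congr (has_gauss_law _ _ _).
  by apply/funext => w; rewrite -mxdot_sym_basis ?vsval_trmx.
by rewrite -[in RHS]/(mxdot _ _) mxdot_sym_basis ?vsval_trmx.
Qed.

End Sym_gaussian.

Section Halfspaces.
Context {R : realType} {n : nat}.

(** Countably many directions, dense among the positive semidefinite ones: a
    level set of [pos_sqnorm] becomes a countable intersection of half-spaces. *)
Definition rat_psd (i : nat) : sym R n :=
  if unpickle i is Some M then
    vsproj (symv R n) ((map_mx ratr (M : 'M[rat]_n))^T *m map_mx ratr M)
  else 0.

Lemma rat_psdE (M : 'M[rat]_n) : vsval (rat_psd (pickle M)) =
  (map_mx ratr M)^T *m map_mx ratr M.
Proof. by rewrite /rat_psd pickleK vsproj_trmx// trmx_mul trmxK. Qed.

Lemma psd_rat_psd i : psdmx (vsval (rat_psd i)).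
Proof.
rewrite /rat_psd; case: unpickle => [M|].
  by rewrite vsproj_trmx ?trmx_mul ?trmxK//; exact: psdmx_gram.
by move=> x; rewrite vsval0 mulmx0 mul0mx mxE.
Qed.

Lemma rat_approximation (A : 'M[R]_n) :
  exists M : nat -> 'M[rat]_n, mx_cvg (fun k => map_mx ratr (M k)) A.
Proof.
have H k ij : exists x : rat, `|A ij.1 ij.2 - ratr x| < k.+1%:R^-1.
  have k0 : 0 < k.+1%:R^-1 :> R by rewrite invr_gt0.
  have := @rat_in_itvoo R (A ij.1 ij.2) (A ij.1 ij.2 + k.+1%:R^-1).
  rewrite ltrDl => /(_ k0)[x]; rewrite in_itv /= => /andP[h1 h2].
  exists x; move: (ratr x : R) (k.+1%:R^-1 : R) k0 h1 h2 => y e k0 h1 h2.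
  by rewrite ltr_norml; apply/andP; split; lra.
have [f Hf] : {f : nat -> 'I_n * 'I_n -> rat &
    forall k ij, `|A ij.1 ij.2 - ratr (f k ij)| < k.+1%:R^-1}.
  exists (fun k ij => projT1 (cid (H k ij))) => k ij.
  exact: (projT2 (cid (H k ij))).
exists (fun k => \matrix_(i, j) f k (i, j)) => i j.
apply/cvgrPdist_lt => e e0; near=> k; rewrite !mxE.
rewrite (lt_trans (Hf k (i, j)))//.
by near: k; exact: (near_infty_natSinv_lt (PosNum e0)).
Unshelve. all: by end_near. Qed.

(** The supremum of [pos_sqnorm_ge] may be restricted to the Gram matrices of
    rational matrices, because these approximate any square. *)
Lemma pos_sqnorm_halfspaces (W : 'M[R]_n) (c : R) : W^T = W ->
  pos_sqnorm W <= c <->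
  forall i, \tr (vsval (rat_psd i) *m W) <=
            (c + \tr (vsval (rat_psd i) *m vsval (rat_psd i))) / 2.
Proof.
move=> symW; split => [Wc i|H].
  have := pos_sqnorm_ge symW (vsval_trmx (rat_psd i)) (psd_rat_psd i); lra.
have [B [symB psdB WB _]] := pos_sqnorm_attained symW.
have [S ST BS] := psdmx_sqrt symB psdB.
have [M cM] := rat_approximation S.
have cB : mx_cvg (fun k => vsval (rat_psd (pickle (M k)))) B.
  move=> i j; under eq_fun do rewrite rat_psdE.
  by rewrite BS -{1}ST; apply: mx_cvg_mul => //; exact: mx_cvg_tr.
have c1 := mx_cvg_trace (mx_cvg_mul cB (@mx_cvg_cst _ _ _ W)).
have c2 := mx_cvg_trace (mx_cvg_mul cB cB).
rewrite WB; apply: cvgr_to_le (cvgB (cvgM (cvg_cst (2 : R)) c1) c2) _.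
apply: nearW => k; set D := vsval (rat_psd (pickle (M k))).
suff : 2 * \tr (D *m W) - \tr (D *m D) <= c by [].
have := H (pickle (M k)); rewrite -/D; lra.
Qed.

End Halfspaces.

Section Product_gauss.
Context {R : realType} {d1 d2 : measure_display}.
Context {T1 : measurableType d1} {T2 : measurableType d2}.
Variables (P1 : probability T1 R) (P2 : probability T2 R).

Lemma has_gauss_law_product (X1 : T1 -> R) (X2 : T2 -> R) (s t u : R) :
  has_gauss_law P1 X1 s -> has_gauss_law P2 X2 t -> s ^+ 2 + t ^+ 2 = u ^+ 2 ->
  has_gauss_law (P1 \x P2)%E (fun z => X1 z.1 + X2 z.2) u.
Proof.
move=> [mX1 X1E] [mX2 X2E] stu.
have m1 : measurable_fun setT (fun z : T1 * T2 => X1 z.1) by exact: measurableT_comp.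
have m2 : measurable_fun setT (fun z : T1 * T2 => X2 z.2) by exact: measurableT_comp.
split; first exact: measurable_funD.
move=> B mB.
pose f (z : T1 * T2) : measurableTypeR R * measurableTypeR R := (X1 z.1, X2 z.2).
have mf : measurable_fun setT f by exact: measurable_fun_pair.
pose m : {measure set (measurableTypeR R * measurableTypeR R) -> \bar R} :=
  measure_function_pushforward__canonical__measure_function_Measure (P1 \x P2)%E mf.
have := @gauss_law_sum R m 1 s t u ler01 stu _ B mB; rewrite mul1e; apply.
move=> A C mA mC; rewrite mul1e -X1E// -X2E// -product_measure1E//.
- exact: measurable_preimage.
- exact: measurable_preimage.
Qed.

End Product_gauss.

Lemma has_gauss_law_scale dT (T : measurableType dT) (R : realType)
    (P : probability T R) (X : T -> R) (a s : R) :
  has_gauss_law P X s -> has_gauss_law P (fun w => a * X w) (a * s).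
Proof.
move=> [mX XE]; split; first exact: measurable_funM.
move=> B mB; rewrite -[_ @^-1` B]/(X @^-1` [set x | B (a * x)]).
rewrite XE; last exact: measurable_scale.
by congr (normal_prob 0 1 _); apply/funext => x /=; rewrite mulrA.
Qed.

Lemma has_gauss_law_id (R : realType) :
  has_gauss_law (normal_prob 0 1 : probability (measurableTypeR R) R)
    (fun x => x : R) 1.
Proof.
split; first exact: measurable_id.
move=> B mB; rewrite /gauss_law; congr (normal_prob 0 1 _).
by apply/funext => x /=; rewrite mul1r.
Qed.

(** With a free phase [p], this is the equality of characteristic functions. *)
Lemma has_gauss_law_cos dT1 dT2 (T1 : measurableType dT1) (T2 : measurableType dT2)
    (R : realType) (P1 : probability T1 R) (P2 : probability T2 R)
    (X : T1 -> R) (Y : T2 -> R) (s p : R) :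
  has_gauss_law P1 X s -> has_gauss_law P2 Y s ->
  (\int[P1]_w (cos (X w + p))%:E = \int[P2]_w (cos (Y w + p))%:E)%E.
Proof.
have mc : measurable_fun setT (fun x : R => cos (x + p)).
  apply: (measurableT_comp (f := cos)).
    by apply: continuous_measurable_fun; exact: continuous_cos.
  exact: measurable_funD.
have [gs gsE] := gauss_law_probability s.
have main dT (T : measurableType dT) (P : probability T R) (Z : T -> R) :
    has_gauss_law P Z s ->
    (\int[P]_w (cos (Z w + p))%:E = \int[gs]_x (cos (x + p))%:E)%E.
  move=> [mZ ZE].
  transitivity (\int[pushforward P (Z : T -> measurableTypeR R)]_x (cos (x + p))%:E)%E.
    rewrite integral_pushforward//.
    - exact/measurable_EFinP.
    - apply: (@bounded_integrable R _ T P (fun w => cos (Z w + p)) 1); first exact: (measurableT_comp mc mZ).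
      by move=> w; exact: cos_max.
  have mZ' : measurable_fun setT (Z : T -> measurableTypeR R) by exact: mZ.
  pose pf : {measure set (measurableTypeR R) -> \bar R} :=
    measure_function_pushforward__canonical__measure_function_Measure P mZ'.
  by apply: (@eq_measure_integral _ _ _ _ gs pf) => A mA _; rewrite /pf /= /pushforward ZE// gsE.
by move=> hX hY; rewrite main// [RHS]main.
Qed.

Section Sym_gaussian_law.
Context {R : realType} {n : nat}.

(** The standard Gaussian law on symmetric matrices through its one-dimensional
    projections, a form that does not mention a basis. *)
Definition sym_gaussian {dT} {T : measurableType dT} (P : probability T R)
    (W : T -> sym R n) : Prop :=
  forall t : sym R n, has_gauss_law P (fun w => \tr (vsval t *m vsval (W w)))
    (Num.sqrt (\tr (vsval t *m vsval t))).

Definition pos_sqnorm_le_set {T} (W : T -> sym R n) (c : R) : set T :=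
  [set w | pos_sqnorm (vsval (W w)) <= c].

Lemma pos_sqnorm_le_setE T (W : T -> sym R n) (c : R) :
  pos_sqnorm_le_set W c = [set w | forall i,
    \tr (vsval (rat_psd i : sym R n) *m vsval (W w)) <=
    (c + \tr (vsval (rat_psd i : sym R n) *m vsval (rat_psd i : sym R n))) / 2].
Proof.
by apply/seteqP; split=> w /=; rewrite /pos_sqnorm_le_set /=;
  move/(pos_sqnorm_halfspaces c (vsval_trmx (W w))).
Qed.

Lemma measurable_pos_sqnorm_le dT (T : measurableType dT) (P : probability T R)
    (W : T -> sym R n) c : sym_gaussian P W -> measurable (pos_sqnorm_le_set W c).
Proof.
move=> gW; rewrite pos_sqnorm_le_setE.
pose b i := (c + \tr (vsval (rat_psd i : sym R n) *m vsval (rat_psd i : sym R n))) / 2.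
have -> : [set w | forall i, \tr (vsval (rat_psd i) *m vsval (W w)) <= b i] =
    \bigcap_i ((fun w => \tr (vsval (rat_psd i) *m vsval (W w))) @^-1` `]-oo, b i]).
  apply/seteqP; split => w /=; first by move=> h i _; rewrite /= in_itv /= h.
  by move=> h i; have := h i Logic.I; rewrite /= in_itv.
apply: bigcapT_measurable => i; rewrite -[X in measurable X]setTI.
by apply: (gW (rat_psd i)).1.
Qed.

Lemma mxtrace_vsvalD (A : 'M[R]_n) (t u : sym R n) :
  \tr (vsval (t + u) *m A) = \tr (vsval t *m A) + \tr (vsval u *m A).
Proof. by rewrite vsvalD mulmxDl linearD. Qed.

Lemma mxtrace_vsvalZ (A : 'M[R]_n) (a : R) (t : sym R n) :
  \tr (vsval (a *: t) *m A) = a * \tr (vsval t *m A).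
Proof. by rewrite vsvalZ -scalemxAl linearZ. Qed.

Lemma sym_gaussian_pos_sqnorm dT1 dT2 (T1 : measurableType dT1)
    (T2 : measurableType dT2) (P1 : probability T1 R) (P2 : probability T2 R)
    (W1 : T1 -> sym R n) (W2 : T2 -> sym R n) c :
  sym_gaussian P1 W1 -> sym_gaussian P2 W2 ->
  P1 (pos_sqnorm_le_set W1 c) = P2 (pos_sqnorm_le_set W2 c).
Proof.
move=> g1 g2; rewrite !pos_sqnorm_le_setE.
apply: (@cramer_wold_halfspaces R _ _ T1 T2 P1 P2 (sym R n)
  (fun t w => \tr (vsval t *m vsval (W1 w))) (fun t w => \tr (vsval t *m vsval (W2 w)))).
- by move=> u; exact: (g1 u).1.
- by move=> u; exact: (g2 u).1.
- by move=> u p; exact: has_gauss_law_cos (g1 u) (g2 u).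
- by move=> u v w; exact: mxtrace_vsvalD.
- by move=> u v w; exact: mxtrace_vsvalD.
- by move=> a u w; exact: mxtrace_vsvalZ.
- by move=> a u w; exact: mxtrace_vsvalZ.
Qed.

(** The maximiser [B] of [pos_sqnorm_attained] has positive trace, so adding a
    multiple of the identity increases the value at [B] strictly. *)
Lemma pos_sqnorm_shift (A : 'M[R]_n) (e : R) : A^T = A -> 0 < e ->
  0 < pos_sqnorm A -> pos_sqnorm A < pos_sqnorm (A + e%:M).
Proof.
move=> symA e0 A0; have [B [symB psdB AE AB]] := pos_sqnorm_attained symA.
have symAe : (A + e%:M)^T = A + e%:M by rewrite linearD /= symA tr_scalar_mx.
apply: lt_le_trans (pos_sqnorm_ge symAe symB psdB).
rewrite mulmxDr linearD /= mul_mx_scalar linearZ /= AE.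
suff : 0 < e * \tr B by lra.
have [S ST BS] := psdmx_sqrt symB psdB.
rewrite mulr_gt0// lt_def BS -{2 4}ST mxtrace_gram_ge0 andbT mxtrace_gram_eq0.
apply: contraTN A0 => /eqP S0; rewrite AB BS S0 !mul0mx linear0; lra.
Qed.

Hypothesis n_gt0 : (0 < n)%N.

(** Replacing the trace part of a Gaussian matrix by an independent Gaussian
    multiple of the identity does not change its law. *)
Definition retrace {T} (W : T -> sym R n) (z : T * R) : sym R n :=
  vsproj (symv R n) (vsval (W z.1) +
    (z.2 / Num.sqrt n%:R - \tr (vsval (W z.1)) / n%:R)%:M).

Lemma retraceE T (W : T -> sym R n) z : vsval (retrace W z) =
  vsval (W z.1) + (z.2 / Num.sqrt n%:R - \tr (vsval (W z.1)) / n%:R)%:M.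
Proof. by rewrite vsproj_trmx// linearD /= vsval_trmx tr_scalar_mx. Qed.

Lemma sym_gaussian_retrace dT (T : measurableType dT) (P : probability T R)
    (W : T -> sym R n) : sym_gaussian P W ->
  sym_gaussian (P \x (normal_prob 0 1 : probability (measurableTypeR R) R))%E
    (retrace W).
Proof.
move=> gW t.
have n0 : n%:R != 0 :> R by rewrite pnatr_eq0 -lt0n.
have s0 : Num.sqrt n%:R != 0 :> R by rewrite sqrtr_eq0 -ltNge ltr0n.
pose a := \tr (vsval t); pose id1 : sym R n := vsproj (symv R n) 1%:M.
have id1E : vsval id1 = 1%:M by rewrite vsproj_trmx// trmx1.
pose t' : sym R n := t + (- (a / n%:R)) *: id1.
have := has_gauss_law_product (gW t')
  (has_gauss_law_scale (a / Num.sqrt n%:R) (has_gauss_law_id R)).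
move=> /(_ (Num.sqrt (\tr (vsval t *m vsval t)))).
have -> : (fun z : T * measurableTypeR R => \tr (vsval t' *m vsval (W z.1)) +
    a / Num.sqrt n%:R * z.2) =
    (fun z => \tr (vsval t *m vsval (retrace W z))).
  apply/funext => z; rewrite retraceE mulmxDr mxtraceD mul_mx_scalar mxtraceZ.
  rewrite /t' mxtrace_vsvalD mxtrace_vsvalZ id1E mul1mx -/a.
  by field; rewrite n0 s0.
apply; rewrite !sqr_sqrtr; last 2 first.
- by rewrite -{2}vsval_trmx mxtrace_gram_ge0.
- by rewrite -{2}vsval_trmx mxtrace_gram_ge0.
rewrite mulr1 exprMn exprVn sqr_sqrtr ?ler0n//.
rewrite {1}/t' mxtrace_vsvalD mxtrace_vsvalZ id1E mul1mx (mxtrace_mulC (vsval t)).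
rewrite /t' mxtrace_vsvalD mxtrace_vsvalZ id1E mul1mx vsvalD vsvalZ id1E.
rewrite mxtraceD mxtraceZ mxtrace1 -/a; field; exact: n0.
Qed.

Lemma normal_prob_set1 (x : R) : normal_prob 0 1 [set x] = 0%E.
Proof.
apply: null_set_integral => //; last exact: lebesgue_measure_set1.
by apply/measurable_EFinP/measurable_funTS; exact: measurable_normal_pdf.
Qed.

(** After [retrace], the statistic is a function of an independent normal
    variable that is strictly increasing where it is positive, so each section
    of a positive level set has at most one point. *)
Lemma sym_gaussian_no_atom dT (T : measurableType dT) (P : probability T R)
    (W : T -> sym R n) (c : R) : sym_gaussian P W -> 0 < c ->
  (fun k => P (pos_sqnorm_le_set W (c - k.+1%:R^-1))) @ \oo -->
  P (pos_sqnorm_le_set W c).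
Proof.
move=> gW c0; pose N : probability (measurableTypeR R) R := normal_prob 0 1.
pose Q : probability (T * measurableTypeR R)%type R := (P \x N)%E.
pose W' := retrace W : T * measurableTypeR R -> sym R n.
have gW' : sym_gaussian Q W' by exact: sym_gaussian_retrace.
have WE c' : P (pos_sqnorm_le_set W c') = Q (pos_sqnorm_le_set W' c').
  exact: sym_gaussian_pos_sqnorm.
under eq_fun do rewrite WE; rewrite WE.
pose A k := pos_sqnorm_le_set W' (c - k.+1%:R^-1).
have mA k : measurable (A k) by exact: measurable_pos_sqnorm_le gW'.
have mU : measurable (\bigcup_k A k) by exact: bigcupT_measurable.
have mC := measurable_pos_sqnorm_le c gW'.
have AC : \bigcup_k A k `<=` pos_sqnorm_le_set W' c.
  move=> z [k _]; rewrite /A /pos_sqnorm_le_set /= => /le_trans; apply.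
  by rewrite gerBl invr_ge0.
have D0 : Q (pos_sqnorm_le_set W' c `\` \bigcup_k A k) = 0%E.
  set D := _ `\` _.
  have mD : measurable D by exact: measurableD.
  have DE z : D z -> pos_sqnorm (vsval (W' z)) = c.
    rewrite /D /pos_sqnorm_le_set /= => -[zc zA]; apply/eqP; rewrite eq_le zc /=.
    rewrite leNgt; apply/negP => zlt; apply: zA.
    have [k hk] : exists k, k.+1%:R^-1 < c - pos_sqnorm (vsval (W' z)).
      have e0 : 0 < c - pos_sqnorm (vsval (W' z)) by rewrite subr_gt0.
      have [k _ hk] := near_infty_natSinv_lt (PosNum e0).
      by exists k; apply: (hk k) => /=.
    exists k => //; rewrite /A /pos_sqnorm_le_set /=; rewrite lerBrDr -lerBrDl ltW//.
  transitivity (\int[P]_w (N \o xsection D) w)%E; first by [].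
  under eq_integral => w _.
    have -> : (N \o xsection D) w = 0%E.
      have [[x Dx]|D0] := pselect (exists x, D (w, x)); last first.
        rewrite /= (_ : xsection D w = set0) ?measure0//.
        apply/seteqP; split => // x; rewrite /xsection /= inE => Dx.
        by apply: D0; exists x.
      apply/eqP; rewrite eq_le measure_ge0 andbT -(normal_prob_set1 x).
      apply: le_measure; rewrite ?inE//; first exact: measurable_xsection.
      move=> y; rewrite /xsection /= inE => Dy; apply/eqP; rewrite eq_sym.
      suff main u v : D (w, u) -> D (w, v) -> ~ u < v.
        rewrite eq_le !leNgt; apply/andP; split; apply/negP; exact: main.
      move=> Du Dv uv.
      have e0 : 0 < (v - u) / Num.sqrt n%:R.
        by rewrite divr_gt0 ?subr_gt0// sqrtr_gt0 ltr0n.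
      have := pos_sqnorm_shift (vsval_trmx (W' (w, u))) e0.
      rewrite (DE _ Du) => /(_ c0).
      have -> : vsval (W' (w, u)) + ((v - u) / Num.sqrt n%:R)%:M = vsval (W' (w, v)).
        rewrite !retraceE /= -addrA -raddfD /=; congr (_ + _%:M).
        by rewrite mulrBl; lra.
      by rewrite (DE _ Dv) ltxx.
    over.
  exact: integral0.
have -> : Q (pos_sqnorm_le_set W' c) = Q (\bigcup_k A k).
  have mD : measurable (pos_sqnorm_le_set W' c `\` \bigcup_k A k) by exact: measurableD.
  have dD : \bigcup_k A k `&` (pos_sqnorm_le_set W' c `\` \bigcup_k A k) = set0.
    by apply/seteqP; split => // z [h [_ /(_ h)]].
  by rewrite -[in LHS](setDUK AC) (measureU Q mU mD dD) [X in (_ + X)%E]D0 adde0.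
apply: nondecreasing_cvg_mu => // k l kl; apply/subsetPset => z.
rewrite /A /pos_sqnorm_le_set /= => /le_trans; apply.
by rewrite lerB// lef_pV2 ?posrE// ler_nat.
Qed.

End Sym_gaussian_law.

(** * Critical value and tilting *)

Lemma standard_sym_gaussian dT (T : measurableType dT) (R : realType)
    (P : probability T R) n (G : T -> sym R n) :
  standard_gaussian P G -> sym_gaussian P G.
Proof. by move=> gG t; exact: standard_gaussian_linear. Qed.

(** The distribution function is at least [1 - alpha] at [c] by continuity from
    the right, and nearly so just below [c] because there is no atom. *)
Lemma critical_value_left dT (T : measurableType dT) (R : realType)
    (P : probability T R) n (G : T -> sym R n) (alpha c : R) :
  (0 < n)%N -> standard_gaussian P G ->
  c = upper_critical (top_stratum_cdf P G) alpha -> 0 < c ->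
  forall e : R, 0 < e -> exists2 c', c' < c &
    ((1 - alpha - e)%:E <= P (pos_sqnorm_le_set G c'))%E.
Proof.
move=> n0 gG cE c0 e e0; have sG := standard_sym_gaussian gG.
pose F := top_stratum_cdf P G.
have FE x : (F x)%:E = P (pos_sqnorm_le_set G x).
  by rewrite /F /top_stratum_cdf fineK// fin_num_measure//; exact: measurable_pos_sqnorm_le sG.
pose S := [set x | 1 - alpha <= F x].
have Fmono x y : x <= y -> F x <= F y.
  move=> xy; rewrite -lee_fin !FE; apply: le_measure.
  - by rewrite inE; exact: measurable_pos_sqnorm_le sG.
  - by rewrite inE; exact: measurable_pos_sqnorm_le sG.
  - by move=> w; rewrite /pos_sqnorm_le_set /= => /le_trans; apply.
have cS : c = inf S by [].
have infS : has_inf S.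
  by apply: contrapT => /inf_out; rewrite -cS => c00; rewrite c00 ltxx in c0.
have Fk k : 1 - alpha <= F (c + k.+1%:R^-1).
  have k0 : 0 < k.+1%:R^-1 :> R by rewrite invr_gt0.
  have [x Sx xc] := inf_adherent k0 infS.
  by apply: le_trans Sx (Fmono _ _ _); rewrite cS ltW.
have Fc : ((1 - alpha)%:E <= P (pos_sqnorm_le_set G c))%E.
  have -> : pos_sqnorm_le_set G c = \bigcap_k pos_sqnorm_le_set G (c + k.+1%:R^-1).
    apply/seteqP; split => w; rewrite /pos_sqnorm_le_set /=.
      by move=> wc k _ /=; rewrite (le_trans wc)// lerDl invr_ge0.
    move=> wc; rewrite leNgt; apply/negP => cw.
    have e1 : 0 < pos_sqnorm (vsval (G w)) - c by rewrite subr_gt0.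
    have [k _ hk] := near_infty_natSinv_lt (PosNum e1).
    have := hk k (leqnn k); have := wc k Logic.I; rewrite /= -lerBlDl => h1 h2.
    by have := le_lt_trans h1 h2; rewrite ltxx.
  have mk k : measurable (pos_sqnorm_le_set G (c + k.+1%:R^-1)).
    exact: measurable_pos_sqnorm_le sG.
  have cv : P (pos_sqnorm_le_set G (c + k.+1%:R^-1)) @[k --> \oo] -->
      P (\bigcap_k pos_sqnorm_le_set G (c + k.+1%:R^-1)).
    apply: nonincreasing_cvg_mu => //.
    - by rewrite -ge0_fin_numE// fin_num_measure.
    - exact: bigcapT_measurable.
    - move=> k l kl; apply/subsetPset => w; rewrite /pos_sqnorm_le_set /= => /le_trans.
      by apply; rewrite lerD2l lef_pV2 ?posrE// ler_nat.
  by apply: cvge_ge cv; apply: nearW => k /=; rewrite -FE lee_fin.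
have cv := sym_gaussian_no_atom n0 sG c0.
have lt1 : ((1 - alpha - e)%:E < P (pos_sqnorm_le_set G c))%E.
  by apply: lt_le_trans Fc; rewrite lte_fin gtrBl.
have [k _ hk] := cv _ (open_nbhs_nbhs (conj (@open_ereal_gt_ereal R (1 - alpha - e)%:E) lt1)).
exists (c - k.+1%:R^-1); first by rewrite gtrBl invr_gt0.
exact/ltW/(hk k (leqnn k)).
Qed.

Lemma has_gauss_law_zero dT (T : measurableType dT) (R : realType)
    (P : probability T R) : has_gauss_law P (fun=> 0) 0.
Proof.
split; first exact: measurable_cst.
move=> B mB; rewrite /gauss_law.
have [B0|B0] := pselect (B 0).
  rewrite (_ : _ @^-1` B = setT) ?probability_setT; last by apply/seteqP; split.
  rewrite (_ : [set x : measurableTypeR R | B (0 * x)] = setT) ?probability_setT//.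
  by apply/seteqP; split => // x _ /=; rewrite mul0r.
rewrite (_ : _ @^-1` B = set0) ?measure0; last by apply/seteqP; split.
rewrite (_ : [set x : measurableTypeR R | B (0 * x)] = set0) ?measure0//.
by apply/seteqP; split => // x /=; rewrite mul0r.
Qed.

Section Tilt.
Context {R : realType} {d q n : nat}.
Local Notation E := (param R d q).
Context {dT dG : measure_display} {T : measurableType dT} {TG : measurableType dG}.
Variables (P : probability T R) (PG : probability TG R).
Variables (I : 'End(E)) (Z : T -> E).
Hypotheses (saI : self_adjoint I) (pdI : positive_definite I).
Hypothesis gZ : centred_gaussian P I Z.

Lemma centred_gaussian_inner (v : E) :
  has_gauss_law P (fun w => inner v (Z w)) (Num.sqrt (inner v (I v))).
Proof.
have [rZ ZN] := gZ.
have [->|v0] := eqVneq v 0.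
  rewrite inner0l sqrtr0; under eq_fun do rewrite inner0l; exact: has_gauss_law_zero.
split; first exact: measurable_continuous_random rZ (@inner_continuous _ _ _ v).
move=> B mB; rewrite ZN// normal_prob_scale// sqrtr_gt0.
exact: pdI.
Qed.

Lemma integral_exp_normal (s : R) :
  (\int[normal_prob 0 1]_x (expR (s * x - s ^+ 2 / 2))%:E = 1 :> \bar R)%E.
Proof.
rewrite ge0_integral_normal; last 2 first.
- apply/measurable_EFinP; apply: (measurableT_comp (f := expR)).
    exact: measurable_expR.
  by apply: measurable_funB => //; exact: measurable_funM.
- by move=> x; rewrite lee_fin expR_ge0.
rewrite -(integral_normal_pdf s 1); apply: eq_integral => x _.
rewrite -EFinM normal_pdf01E normal_pdfE ?oner_neq0// /normal_fun; congr EFin.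
by rewrite mulrCA -expRD; congr (_ * expR _); field.
Qed.

Variables (g : sym R n -> E) (W : T -> sym R n) (h : E).
Hypothesis gD : forall t u, g (t + u) = g t + g u.
Hypothesis gZl : forall a t, g (a *: t) = a *: g t.
Hypothesis gI : forall t u, inner (g t) (I (g u)) = \tr (vsval t *m vsval u).
Hypothesis hg : forall t, inner h (I (g t)) = 0.
Hypothesis WE : forall t w, \tr (vsval t *m vsval (W w)) = inner (g t) (Z w).

Lemma sym_gaussian_reduced : sym_gaussian P W.
Proof.
move=> t; rewrite -gI; under eq_fun do rewrite WE.
exact: centred_gaussian_inner.
Qed.

Variable G : TG -> sym R n.
Hypothesis sG : sym_gaussian PG G.

(** The variable [<h, Z>] and the matrix [W] are uncorrelated, hence
    independent, by [hg]: tilting by [exp (lan_form I h Z)], of mean one, does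
    not change the law of [W]. Independence comes from applying
    [cramer_wold_halfspaces] to the family of all combinations of both. *)
Lemma tilted_pos_sqnorm (c : R) :
  (\int[P]_w (\1_(pos_sqnorm_le_set W c) w *
     expR (lan_form I h (Z w)))%:E = PG (pos_sqnorm_le_set G c))%E.
Proof.
rewrite /lan_form.
have sW := sym_gaussian_reduced.
have mK := measurable_pos_sqnorm_le c sW; have mKG := measurable_pos_sqnorm_le c sG.
have [h0|h0] := eqVneq h 0.
  rewrite -(sym_gaussian_pos_sqnorm c sW sG) -[X in _ = P X]setIT -integral_indic//.
  apply: eq_integral => w _; rewrite h0 !inner0l mul0r subr0 expR0 mulr1//.
set K := pos_sqnorm_le_set W c in mK *; set KG := pos_sqnorm_le_set G c in mKG *.
have s20 : 0 < inner h (I h) by exact: pdI.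
pose s := Num.sqrt (inner h (I h)).
have s0 : 0 < s by rewrite sqrtr_gt0.
have sn0 : s != 0 by rewrite gt_eqF.
have s2 : s ^+ 2 = inner h (I h) by rewrite sqr_sqrtr// ltW.
pose N : probability (measurableTypeR R) R := normal_prob 0 1.
pose Q : probability (TG * measurableTypeR R)%type R := (PG \x N)%E.
pose S w := inner h (Z w) / s.
have mS : measurable_fun setT S.
  by apply: measurable_funM => //; exact: (centred_gaussian_inner h).1.
pose V : lmodType R := (R^o * sym R n)%type.
pose X (v : V) w := inner ((v.1 / s) *: h + g v.2) (Z w).
pose Y (v : V) (z : TG * measurableTypeR R) := \tr (vsval v.2 *m vsval (G z.1)) + v.1 * z.2.
have var (v : V) : inner ((v.1 / s) *: h + g v.2) (I ((v.1 / s) *: h + g v.2)) =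
    v.1 ^+ 2 + \tr (vsval v.2 *m vsval v.2).
  have gh t : inner (g t) (I h) = 0 by rewrite -saI innerC hg.
  rewrite linearD linearZ /= innerDl !innerDr !innerZl !innerZr hg gh gI -s2.
  by field.
have gX v : has_gauss_law P (X v) (Num.sqrt (v.1 ^+ 2 + \tr (vsval v.2 *m vsval v.2))).
  by rewrite -var; exact: centred_gaussian_inner.
have tr0 (t : sym R n) : 0 <= \tr (vsval t *m vsval t).
  by rewrite -{2}vsval_trmx mxtrace_gram_ge0.
have gY v : has_gauss_law Q (Y v) (Num.sqrt (v.1 ^+ 2 + \tr (vsval v.2 *m vsval v.2))).
  apply: has_gauss_law_product (sG v.2) (has_gauss_law_scale v.1 (has_gauss_law_id R)) _.
  by rewrite mulr1 !sqr_sqrtr ?addr_ge0 ?sqr_ge0// addrC.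
have CW := @cramer_wold_halfspaces R _ _ T (TG * measurableTypeR R)%type P Q V X Y
  (fun v => (gX v).1) (fun v => (gY v).1).
have {}CW := CW (fun v p => has_gauss_law_cos p (gX v) (gY v)).
have {}CW (u : nat -> V) b : P [set w | forall i, X (u i) w <= b i] =
    Q [set z | forall i, Y (u i) z <= b i].
  apply: CW.
  - move=> v v' w; rewrite /X /= -innerDl; congr inner.
    by rewrite gD mulrDl scalerDl addrACA.
  - by move=> v v' z; rewrite /Y /= mxtrace_vsvalD mulrDl addrACA.
  - move=> a v w; rewrite /X /= -innerZl; congr inner.
    by rewrite gZl scalerDr scalerA mulrA.
  - by move=> a v z; rewrite /Y /= mxtrace_vsvalZ mulrDr mulrA.
have z0 A : \tr (vsval (0 : sym R n) *m A) = 0 by rewrite vsval0 mul0mx linear0.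
have half (x : R) : P (S @^-1` `[x, +oo[ `&` K) = (N `[x, +oo[%classic * PG KG)%E.
  pose u (i : nat) : V := if i is i'.+1 then ((0, rat_psd i') : R^o * sym R n) else ((-1, 0) : R^o * sym R n).
  pose b (i : nat) : R := if i is i'.+1 then
    (c + \tr (vsval (rat_psd i' : sym R n) *m vsval (rat_psd i' : sym R n))) / 2 else - x.
  have -> : S @^-1` `[x, +oo[ `&` K = [set w | forall i, X (u i) w <= b i].
    have g0 : g 0 = 0 by rewrite -(scale0r 0) gZl scale0r.
    rewrite /K pos_sqnorm_le_setE; apply/seteqP; split => w /=.
      rewrite in_itv /= andbT => -[xS Kw] [|i]; rewrite /X /=.
        rewrite g0 addr0 innerZl mulN1r mulNr lerN2 mulrC; exact: xS.
      by rewrite mul0r scale0r add0r -WE.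
    move=> H; split.
      have := H 0%N; rewrite /X /= g0 addr0 innerZl mulN1r mulNr lerN2 mulrC.
      by rewrite in_itv /= andbT.
    by move=> i; have := H i.+1; rewrite /X /= mul0r scale0r add0r -WE.
  rewrite CW.
  have -> : [set z | forall i, Y (u i) z <= b i] = KG `*` `[x, +oo[%classic.
    rewrite /KG pos_sqnorm_le_setE; apply/seteqP; split => -[w y] /=.
      move=> H; split.
        by move=> i; have := H i.+1; rewrite /Y /= mul0r addr0.
      have := H 0%N; rewrite /Y /= z0 add0r mulN1r lerN2.
      by rewrite in_itv /= andbT.
    rewrite in_itv /= andbT => -[Kw xy] [|i]; rewrite /Y /=.
      by rewrite z0 add0r mulN1r lerN2.
    by rewrite mul0r addr0.
  by rewrite /Q /= product_measure1E// muleC.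
pose mr : {measure set T -> \bar R} := mrestr P mK.
have mS' : measurable_fun setT (S : T -> measurableTypeR R) by exact: mS.
pose m1 : {measure set (measurableTypeR R) -> \bar R} :=
  measure_function_pushforward__canonical__measure_function_Measure mr mS'.
have k0 : 0 <= fine (PG KG) by rewrite fine_ge0.
pose m2 : {measure set (measurableTypeR R) -> \bar R} := mscale (NngNum k0) N.
have PGE : PG KG = (fine (PG KG))%:E by rewrite fineK// fin_num_measure.
have m12 (A : set (measurableTypeR R)) : measurable A -> m1 A = m2 A.
  apply: (@measure_unique _ R (measurableTypeR R) (@RGenCInfty.G R)
    (fun k => `[- k%:R, +oo[%classic) _ _ _ _ m1 m2).
  - exact: RGenCInfty.measurableE.
  - move=> _ _ [x ->] [y ->]; exists (Num.max x y).
    apply/seteqP; split => z /=; rewrite !in_itv /= !andbT ge_max.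
      by move=> [-> ->].
    by move/andP.
  - by move=> k; exists (- k%:R).
  - apply/seteqP; split => // z _.
    have [k _ hk] := nbhs_infty_ger (- z); exists k => //=.
    by rewrite in_itv /= andbT lerNl; apply: (hk k) => /=.
  - move=> _ [x ->]; rewrite /m1 /= /pushforward /mr /= /mrestr half.
    by rewrite /m2 /= /mscale /= -PGE muleC.
  - move=> k; rewrite /m1 /= /pushforward /mr /= /mrestr.
    apply: le_lt_trans (probability_le1 P _) (ltry _).
    by apply: measurableI => //; exact: measurable_preimage.
pose f (x : R) := (expR (s * x - s ^+ 2 / 2))%:E : \bar R.
have mf : measurable_fun setT f.
  apply/measurable_EFinP; apply: (measurableT_comp (f := expR)).
    exact: measurable_expR.
  by apply: measurable_funB => //; exact: measurable_funM.
have f0 x : (0 <= f x)%E by rewrite lee_fin expR_ge0.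
transitivity (\int[m1]_x f x)%E.
  rewrite ge0_integral_pushforward// preimage_setT.
  rewrite (@ge0_integral_density _ _ _ P mr (fun w => (\1_K w)%:E)).
  - apply: eq_integral => w _; rewrite /f /= -EFinM mulrC; congr (expR _ * _)%:E.
    by rewrite /S mulrCA divff// mulr1 s2.
  - exact/measurable_EFinP.
  - by move=> w; rewrite lee_fin.
  - by move=> A mA; rewrite integral_indic// /mr /= /mrestr setIC.
  - exact: measurableT_comp.
  - by move=> w; exact: f0.
transitivity (\int[m2]_x f x)%E.
  by apply: eq_measure_integral => A mA _; exact: m12.
rewrite ge0_integral_mscale// integral_exp_normal mule1 /= -PGE//.
Qed.

Lemma tilted_total : (\int[P]_w (expR (lan_form I h (Z w)))%:E = 1)%E.
Proof.
rewrite /lan_form.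
have [mT TN] := centred_gaussian_inner h.
set s := Num.sqrt _ in TN.
have s2 : s ^+ 2 = inner h (I h) by rewrite sqr_sqrtr// (posdef_inner_ge0 pdI).
pose f (x : R) := (expR (x - s ^+ 2 / 2))%:E : \bar R.
have mf : measurable_fun setT f.
  apply/measurable_EFinP; apply: (measurableT_comp (f := expR)).
    exact: measurable_expR.
  exact: measurable_funB.
have f0 x : (0 <= f x)%E by rewrite lee_fin expR_ge0.
pose phi w : measurableTypeR R := inner h (Z w).
pose sc (x : measurableTypeR R) : measurableTypeR R := s * x.
have msc : measurable_fun setT sc by exact: measurable_funM.
have mphi : measurable_fun setT phi by exact: mT.
pose m1 : {measure set (measurableTypeR R) -> \bar R} :=
  measure_function_pushforward__canonical__measure_function_Measure P mphi.
pose m2 : {measure set (measurableTypeR R) -> \bar R} :=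
  measure_function_pushforward__canonical__measure_function_Measure (normal_prob 0 1) msc.
transitivity (\int[m1]_x f x)%E.
  rewrite ge0_integral_pushforward// preimage_setT; apply: eq_integral => w _.
  by rewrite /f /= s2.
transitivity (\int[m2]_x f x)%E.
  by apply: eq_measure_integral => A mA _; exact: TN.
rewrite ge0_integral_pushforward// preimage_setT; exact: integral_exp_normal.
Qed.

End Tilt.

(** * Outer probability and contiguity *)

Section Outer.
Context {R : realType} {d q : nat} {X : experiment R d q}.
Local Notation E := (param R d q).

Lemma measurable_expeR (dT : measure_display) (T : measurableType dT) (f : T -> \bar R) :
  measurable_fun setT f -> measurable_fun setT (fun w => expeR (f w)).
Proof.
move=> mf; apply: (measurability _ (ErealGenOInfty.measurableE R)).
move=> _ [_ [x ->] <-]; rewrite setTI.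
have [x0|x0] := ltP x 0.
  rewrite (_ : _ @^-1` _ = setT) //; apply/seteqP; split => // w _ /=.
  by rewrite in_itv /= andbT (lt_le_trans _ (expeR_ge0 _)).
have [y yx] : exists y, expeR y = x%:E by apply: expeR_total; rewrite lee_fin.
rewrite (_ : _ @^-1` _ = setT `&` [set w | y < f w]%E).
  exact: emeasurable_fun_o_infty.
by apply/seteqP; split => w /=; rewrite in_itv /= andbT -yx lte_expeR // => -[].
Qed.

Lemma outer_pr_le n theta (A B : set (obs X n)) :
  A `<=` B -> (outer_pr theta A <= outer_pr theta B)%E.
Proof. exact: le_mu_ext. Qed.

Lemma outer_pr_measurable n theta (A : set (obs X n)) :
  measurable A -> outer_pr theta A = law X n theta A.
Proof. exact: measurable_mu_extE. Qed.

Lemma outer_pr_hull n theta (A : set (obs X n)) (x : R) :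
  (outer_pr theta A < x%:E)%E ->
  exists B, [/\ measurable B, A `<=` B & (law X n theta B < x%:E)%E].
Proof.
rewrite /outer_pr /mu_ext => /ereal_inf_lt[_ [F [mF AF] <-] Fx].
exists (\bigcup_i F i); split => //; first exact: bigcupT_measurable.
apply: le_lt_trans Fx; apply: measure_sigma_subadditive => //.
exact: bigcupT_measurable.
Qed.

Lemma outer_prU n theta (A B : set (obs X n)) :
  (outer_pr theta (A `|` B) <= outer_pr theta A + outer_pr theta B)%E.
Proof. exact: (outer_measureU2 (mu_ext (law X n theta))). Qed.

Lemma outer_pr_near0 theta0 (A : forall n, set (obs X n)) (del : R) :
  outer_pr theta0 (A n) @[n --> \oo] --> 0%E -> 0 < del ->
  \forall n \near \oo, (outer_pr theta0 (A n) <= del%:E)%E.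
Proof.
move=> cA del0; have d0 : (0 < del%:E)%E by rewrite lte_fin.
have : \forall n \near \oo, (outer_pr theta0 (A n) < del%:E)%E.
  exact: (cA _ (open_nbhs_nbhs (conj (@open_ereal_lt_ereal R del%:E) d0))).
by apply: filterS => n /ltW.
Qed.

End Outer.

(** The expansion along paths restricted to bounded scores: it follows from
    either form of the expansion, along given paths or on compact sets. *)
Definition lan_bounded (R : realType) d q (X : experiment R d q)
    (theta0 : param R d q) I (Z : forall n, obs X n -> param R d q) (K : Type)
    (theta : K -> nat -> param R d q) (drift : K -> param R d q) : Prop :=
  forall r eps del : R, 0 < eps -> 0 < del -> \forall n \near \oo, forall k,
    (outer_pr theta0 [set w : obs X n |
      (eps%:E < lan_error theta0 I Z (theta k n) (drift k) w)%E /\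
      (enorm (@Z n w) <= r)%R] <= del%:E)%E.

Section Transfer.
Context {R : realType} {d q : nat} {X : experiment R d q}.
Local Notation E := (param R d q).
Variables (theta0 : E) (I : 'End(E)) (Z : forall n, obs X n -> E).
Arguments Z : clear implicits.
Hypotheses (saI : self_adjoint I) (pdI : positive_definite I).
Hypothesis rZ : forall n, random_element (Z n).
Hypothesis ext0 : ext X theta0.
Context {dT : measure_display} {T : measurableType dT}.
Variables (P : probability T R) (Zlim : T -> E).
Hypothesis cvZ : converges_in_law theta0 Z P Zlim.
Variables (K : Type) (theta : K -> nat -> E) (drift : K -> E).
Hypothesis ext_theta : \forall n \near \oo, forall k, ext X (theta k n).
Hypothesis weak_lan : lan_bounded theta0 I Z theta drift.

(** A finite expansion error forces both log-likelihoods to be finite. *)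
Lemma density_ratio n theta1 h eps (w : obs X n) :
  (lan_error theta0 I Z theta1 h w <= eps%:E)%E ->
  ((expR (lan_form I h (Z n w) - eps))%:E * expeR (loglik theta0 w)
    <= expeR (loglik theta1 w))%E.
Proof.
rewrite /lan_error /lan_form; move: (loglik theta0 w) (loglik theta1 w) => a b.
case: a => [a| |]; last 2 first.
- by case: b => [b| |].
- by move=> _; rewrite /= mule0 expeR_ge0.
case: b => [b| |] //=; rewrite lee_fin => h1.
rewrite -EFinM lee_fin -expRD ler_expR.
by move: h1; rewrite ler_norml => /andP[h1 _]; lra.
Qed.

Variables (chi : E -> R) (r0 : R) (h : E) (L : R).
Hypothesis chi_continuous : continuous chi.
Hypothesis chi01 : forall z, 0 <= chi z <= 1.
Hypothesis chi_support : forall z, chi z != 0 -> enorm z <= r0.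
Hypothesis Lint :
  (L%:E < \int[P]_w (chi (Zlim w) * expR (lan_form I h (Zlim w)))%:E)%E.

(** A quantitative form of contiguity. By [density_ratio] the drifting law
    dominates, up to a factor close to one, the tilted law on the support of
    [chi] outside [D] and the failures of the expansion. The tilted mass of
    [chi] exceeds [L] in the limit, and [D] takes away at most a bounded multiple
    of its probability under [theta0]. *)
Lemma lan_transfer : exists eta del : R, [/\ 0 < eta, 0 < del &
  \forall n \near \oo, forall k, enorm (drift k - h) < eta ->
    forall D : set (obs X n), (outer_pr theta0 D <= del%:E)%E ->
    (outer_pr (theta k n) (D `|` [set w | chi (Z n w) = 0%R]) <= (1 - L)%:E)%E].
Proof.
pose F z := chi z * expR (lan_form I h z).
pose b := expR (enorm h * `|r0|).
have b0 : 0 < b by exact: expR_gt0.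
have F0 z : 0 <= F z by rewrite mulr_ge0 ?expR_ge0//; case/andP: (chi01 z).
have Fe z : F z <= expR (lan_form I h z).
  by rewrite ler_piMl ?expR_ge0//; case/andP: (chi01 z).
have Fb z : F z <= b.
  have [z0|z0] := eqVneq (chi z) 0; first by rewrite /F z0 mul0r ltW.
  apply: le_trans (Fe z) _; rewrite ler_expR /lan_form.
  have h1 := le_trans (ler_norm _) (inner_le h z).
  have h2 := posdef_inner_ge0 pdI h.
  have h3 : enorm h * enorm z <= enorm h * `|r0|.
    by rewrite ler_wpM2l ?enorm_ge0// (le_trans (chi_support z0))// ler_norm.
  lra.
have cF : continuous F.
  move=> z; apply: cvgM; first exact: chi_continuous.
  apply: (@continuous_comp _ _ _ (lan_form I h) expR); last exact: continuous_expR.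
  exact: lan_form_continuous.
have [L' LL' L'int] : exists2 L', L < L' & (L'%:E < \int[P]_w (F (Zlim w))%:E)%E.
  move: Lint; rewrite -[X in (_ < X)%E -> _]/(\int[P]_w (F (Zlim w))%:E)%E.
  case: (\int[P]_w _)%E => [x| |//].
    by rewrite lte_fin => Lx; exists ((L + x) / 2); rewrite ?lte_fin; lra.
  by move=> _; exists (L + 1); rewrite ?ltry// ltrDl.
have Fn : \forall n \near \oo, (L'%:E < \int[law X n theta0]_w (F (Z n w))%:E)%E.
  have bF : exists M, forall z, `|F z| <= M by exists b => z; rewrite ger0_norm.
  exact: (cvZ cF bF (open_nbhs_nbhs (conj (@open_ereal_gt_ereal R L'%:E) L'int))).
have [M M0 IM] := operator_bound I.
(* [gam] is spent twice: on the error of the expansion, through [eps], and on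
   the exceptional set, through [del]; [b] bounds the tilted bump. *)
pose gam := (L' - L) / 2.
have gam0 : 0 < gam by rewrite divr_gt0// subr_gt0.
pose eps := gam / (2 * b).
have eps0 : 0 < eps by rewrite divr_gt0// mulr_gt0.
have epsE : 2 * eps * b = gam.
  by rewrite mulrAC mulrC /eps mulfVK// mulf_neq0// gt_eqF.
pose del := gam / b / 4.
have del0 : 0 < del by apply: divr_gt0 => //; exact: divr_gt0.
(* [c] bounds the Lipschitz constant of [lan_form] between [h] and drifts at
   distance less than one, at scores of norm at most [r0]. *)
pose c := `|r0| + M * (2 * enorm h + 1) + 1.
have c0 : 0 < c by rewrite ltr_wpDl// addr_ge0// mulr_ge0// addr_ge0 ?mulr_ge0 ?enorm_ge0.
pose eta := Num.min 1 (eps / c).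
have eta0 : 0 < eta by rewrite lt_min ltr01 divr_gt0.
exists eta, del; split => //.
have wl := weak_lan r0 eps0 del0.
apply: filterS3 ext_theta Fn wl => n extn FnL wln.
move=> k kh D D_del; have extk := extn k.
pose bad := [set w : obs X n |
  (eps%:E < lan_error theta0 I Z (theta k n) (drift k) w)%E /\ (enorm (Z n w) <= r0)%R].
have bad_del : (outer_pr theta0 bad <= del%:E)%E by exact: wln.
have dd : (del%:E < (2 * del)%:E)%E by rewrite lte_fin; lra.
have [B1 [mB1 DB1 B1d]] := outer_pr_hull (le_lt_trans D_del dd).
have [B2 [mB2 DB2 B2d]] := outer_pr_hull (le_lt_trans bad_del dd).
pose B := B1 `|` B2; have mB : measurable B by exact: measurableU.
have Bd : (law X n theta0 B <= (gam / b)%:E)%E.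
  apply: le_trans (measureU2 _ mB1 mB2) _.
  apply: le_trans (leeD (ltW B1d) (ltW B2d)) _.
  by rewrite -EFinD lee_fin /del; lra.
pose A := ~` B `&` [set w : obs X n | chi (Z n w) != 0].
have mchi : measurable_fun setT (fun w : obs X n => chi (Z n w)).
  exact: measurable_continuous_random (rZ n) chi_continuous.
have mA : measurable A.
  apply: measurableI; first exact: measurableC.
  rewrite (_ : [set _ | _] = (fun w : obs X n => chi (Z n w)) @^-1` (~` [set 0])).
    by rewrite -[X in measurable X]setTI; apply: mchi => //; exact: measurableC.
  by apply/seteqP; split => w /= /eqP.
have mlan g : continuous g -> measurable_fun setT (fun w : obs X n => g (Z n w) : R).
  exact: measurable_continuous_random (rZ n).
have clan : continuous (fun z => expR (lan_form I h z - 2 * eps)).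
  move=> z; apply: (@continuous_comp _ _ _ (fun z => lan_form I h z - 2 * eps) expR);
    last exact: continuous_expR.
  by apply: cvgB; [exact: lan_form_continuous|exact: cvg_cst].
pose G (w : obs X n) := (\1_A w * expR (lan_form I h (Z n w) - 2 * eps))%:E.
have mG : measurable_fun setT G.
  by apply/measurable_EFinP; apply: measurable_funM => //; exact: mlan clan.
have G0 w : (0 <= G w)%E by rewrite lee_fin mulr_ge0// expR_ge0.
have lawA : (\int[law X n theta0]_w G w <= law X n (theta k n) A)%E.
  rewrite (@ge0_integral_density _ _ _ (dominating X n) (law X n theta0)
    (fun w => expeR (loglik theta0 w))) //; last 3 first.
  - by apply: measurable_expeR; exact: measurable_loglik.
  - by move=> w; exact: expeR_ge0.
  - by move=> A' mA'; exact: law_density.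
  rewrite law_density// [leRHS]integral_mkcond.
  apply: ge0_le_integral => //.
  - by move=> w _; rewrite mule_ge0// expeR_ge0.
  - apply: emeasurable_funM => //.
    by apply: measurable_expeR; exact: measurable_loglik.
  - apply/(measurable_restrictT _ mA).
    by apply: measurable_funTS; apply: measurable_expeR; exact: measurable_loglik.
  move=> w _; rewrite patchE /G indicE; case: ifPn => wA; last by rewrite mul0r mul0e.
  rewrite mul1r; move: wA; rewrite inE => -[wB wchi].
  have Zr : enorm (Z n w) <= r0 by exact: chi_support.
  have le_eps : (lan_error theta0 I Z (theta k n) (drift k) w <= eps%:E)%E.
    by rewrite leNgt; apply/negP => lt_eps; apply: wB; right; exact: DB2.
  apply: le_trans (density_ratio le_eps); apply: lee_wpmul2r; first exact: expeR_ge0.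
  rewrite lee_fin ler_expR.
  have := lan_form_lipschitz saI h (drift k) (Z n w) IM.
  rewrite enorm_distC => lip.
  have kn : enorm (drift k) <= enorm h + 1.
    rewrite -[drift k](subrK h) (le_trans (enormD _ _))// addrC lerD2l ltW//.
    by rewrite (lt_le_trans kh)// ge_min lexx.
  have lip' : enorm (drift k - h) * c <= eps.
    by rewrite -ler_pdivlMr// ltW// (lt_le_trans kh)// ge_min lexx orbT.
  have Zc : enorm (Z n w) + M * (enorm h + enorm (drift k)) <= c.
    have := ler_wpM2l M0 kn; have := ler_norm r0; rewrite /c; lra.
  have := ler_wpM2l (enorm_ge0 (drift k - h)) Zc.
  have := le_trans (ler_norm _) lip; lra.
have FG : (\int[law X n theta0]_w (F (Z n w))%:E <=
    law X n (theta k n) A + gam%:E + gam%:E)%E.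
  have gamE : gam%:E = (\int[law X n theta0]_w (cst (2 * eps * b)%:E w))%E.
    by rewrite integral_cst// [X in (_ * X)%E]probability_setT mule1 epsE.
  rewrite {1}gamE.
  apply: (@le_trans _ _ (\int[law X n theta0]_w (G w + cst (2 * eps * b)%:E w + (b * \1_B w)%:E))%E).
    apply: ge0_le_integral => //.
    - by move=> w _; rewrite lee_fin.
    - by apply/measurable_EFinP; exact: mlan cF.
    - apply: emeasurable_funD; first exact: emeasurable_funD.
      by apply/measurable_EFinP; exact: measurable_funM.
    move=> w _; rewrite /G /cst -!EFinD lee_fin.
    have bB : 0 <= b * \1_B w by rewrite mulr_ge0// ltW.
    have eb : 0 <= 2 * eps * b by rewrite epsE ltW.
    have [wB|wB] := pselect (B w).
      rewrite [\1_B w]indicE mem_set// mulr1.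
      have := Fb (Z n w); have := G0 w; rewrite lee_fin; lra.
    have [chi0|chi0] := eqVneq (chi (Z n w)) 0.
      have := G0 w; rewrite lee_fin {1}/F chi0 mul0r; lra.
    rewrite [\1_A w]indicE mem_set// mul1r expRD.
    have e1 : 1 - 2 * eps <= expR (- (2 * eps)) by exact: expR_ge1Dx.
    have e2 := ler_wpM2l (F0 (Z n w)) e1.
    have e3 := ler_wpM2r (expR_ge0 (- (2 * eps))) (Fe (Z n w)).
    have e4 : 2 * eps * F (Z n w) <= 2 * eps * b.
      by apply: ler_wpM2l => //; rewrite mulr_ge0// ltW.
    lra.
  have cst0 w : (0 <= cst (2 * eps * b)%:E w)%E by rewrite /cst lee_fin epsE ltW.
  have B0 w : (0 <= (b * \1_B w)%:E)%E by rewrite lee_fin mulr_ge0// ltW.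
  have mB1' : measurable_fun setT (fun w => (b * \1_B w)%:E).
    by apply/measurable_EFinP; exact: measurable_funM.
  have mGc : measurable_fun setT (fun w => (G w + cst (2 * eps * b)%:E w)%E).
    exact: emeasurable_funD.
  rewrite ge0_integralD//; last by move=> w _; exact: adde_ge0.
  rewrite ge0_integralD//.
  apply: leeD; first exact: leeD.
  under eq_integral do rewrite EFinM.
  rewrite ge0_integralZl//; [|exact/measurable_EFinP|by rewrite lee_fin ltW].
  rewrite integral_indic// setIT.
  have := lee_wpmul2l (_ : (0 <= b%:E)%E) Bd; rewrite lee_fin => /(_ (ltW b0)).
  by move/le_trans; apply; rewrite -EFinM lee_fin mulrCA divff ?mulr1// gt_eqF.
have LA : (L%:E <= law X n (theta k n) A)%E.
  have := le_trans (ltW FnL) FG; rewrite -(fineK (fin_num_measure _ _ mA)).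
  by rewrite -!EFinD !lee_fin /gam; lra.
apply: (@le_trans _ _ (law X n (theta k n) (~` A))).
  rewrite -outer_pr_measurable; last exact: measurableC.
  apply: outer_pr_le => w [Dw|chi0] [wB /eqP wchi] //.
  by apply: wB; left; exact: DB1.
rewrite probability_setC// -(fineK (fin_num_measure _ _ mA)) -EFinB lee_fin lerD2l lerN2.
by rewrite -lee_fin fineK// fin_num_measure.
Qed.

End Transfer.

(** * Local sets and null paths *)

Lemma hausdorff_lt (R : realType) d q (A B : set (param R d q)) (e : R) :
  (hausdorff A B < e%:E)%E ->
  (forall x, A x -> exists2 y, B y & enorm (x - y) < e) /\
  (forall y, B y -> exists2 x, A x & enorm (x - y) < e).
Proof.
rewrite /hausdorff gt_max => /andP[AB BA]; split => [x Ax|y By].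
  have : (ereal_inf [set (enorm (x - y))%:E | y in B] < e%:E)%E.
    by apply: le_lt_trans AB; apply: ereal_sup_ubound; exists x.
  by move=> /ereal_inf_lt[_ [y By <-]]; rewrite lte_fin => ?; exists y.
have : (ereal_inf [set (enorm (x - y))%:E | x in A] < e%:E)%E.
  by apply: le_lt_trans BA; apply: ereal_sup_ubound; exists y.
by move=> /ereal_inf_lt[_ [x Ax <-]]; rewrite lte_fin => ?; exists x.
Qed.

Lemma near_hausdorff (R : realType) d q (A : nat -> set (param R d q)) B (rho e : R) :
  converges_on_bounded A B -> 0 < rho -> 0 < e -> \forall n \near \oo,
  (forall x, A n x -> enorm x <= rho -> exists2 y, B y & enorm (x - y) < e) /\
  (forall y, B y -> enorm y <= rho ->
     exists2 x, A n x & enorm x <= rho /\ enorm (x - y) < e).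
Proof.
move=> cAB rho0 e0.
have e0' : (0 < e%:E)%E by rewrite lte_fin.
have : \forall n \near \oo, (hausdorff (A n `&` [set x | (enorm x <= rho)%R])
    (B `&` [set x | (enorm x <= rho)%R]) < e%:E)%E.
  exact: (cAB _ rho0 _ (open_nbhs_nbhs (conj (@open_ereal_lt_ereal R e%:E) e0'))).
apply: filterS => n /hausdorff_lt[h1 h2]; split => [x Ax xr|y By yr].
  by have [y [By _] xy] := h1 x (conj Ax xr); exists y.
by have [x [Ax xr] xy] := h2 y (conj By yr); exists x.
Qed.

Lemma limn_esup_le (R : realType) (u : nat -> \bar R) (l : R) :
  (forall e : R, 0 < e -> \forall n \near \oo, (u n <= (l + e)%:E)%E) ->
  (limn_esup u <= l%:E)%E.
Proof.
move=> H; apply/lee_addgt0Pr => e e0; rewrite -EFinD /limn_esup /limf_esup.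
have [N _ HN] := H e e0.
apply: le_trans (ereal_inf_lbound (_ : _ (ereal_sup (u @` [set n | (N <= n)%N])))) _.
  by exists [set n | (N <= n)%N] => //; exists N.
by apply: ge_ereal_sup => _ [n Nn <-]; exact: HN.
Qed.

Section Local.
Context {R : realType} {d q : nat}.
Local Notation E := (param R d q).

Lemma rate_gt0 n : (0 < n)%N -> 0 < rate R n.
Proof. by move=> n0; rewrite invr_gt0 sqrtr_gt0 ltr0n. Qed.

Lemma rate_cvg : rate R n @[n --> \oo] --> 0.
Proof.
apply/cvgrPdist_lt => e e0; near=> n.
have n0 : (0 < n)%N by near: n; exact: nbhs_infty_gt.
rewrite sub0r normrN gtr0_norm ?rate_gt0// /rate invf_plt ?posrE// ?sqrtr_gt0 ?ltr0n//.
rewrite -ltr_sqr ?nnegrE ?sqrtr_ge0 ?invr_ge0 ?ltW// sqr_sqrtr ?ler0n//.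
near: n; exact: nbhs_infty_gtr.
Unshelve. all: by end_near. Qed.

Lemma local_pointK (theta0 theta : E) n : (0 < n)%N ->
  local_point theta0 n ((rate R n)^-1 *: (theta - theta0)) = theta.
Proof.
move=> n0; rewrite /local_point scalerA divff ?gt_eqF ?rate_gt0// scale1r.
by rewrite addrC subrK.
Qed.

Lemma null_path_rescaled (Theta0 : set E) theta0 h theta e :
  null_path Theta0 theta0 h theta -> 0 < e -> \forall n \near \oo,
  rescaled Theta0 theta0 n ((rate R n)^-1 *: (theta (rate R n) - theta0)) /\
  enorm ((rate R n)^-1 *: (theta (rate R n) - theta0) - h) < e.
Proof.
move=> [thT thh] e0.
have [del /= del0 Hdel] : \forall t \near 0^'+, enorm (theta t - theta0 - t *: h) / t < e.
  by move/cvgr_lt : thh; exact.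
near=> n; have n0 : (0 < n)%N by near: n; exact: nbhs_infty_gt.
have r0 := rate_gt0 n0.
split; first by rewrite /rescaled /= local_pointK//; exact: thT.
have := Hdel (rate R n); rewrite /= sub0r normrN gtr0_norm// => H.
have {}H := H _ r0; set t := rate R n in r0 H *.
have -> : t^-1 *: (theta t - theta0) - h = t^-1 *: (theta t - theta0 - t *: h).
  by rewrite [in RHS]scalerBr scalerA mulVf ?gt_eqF// scale1r.
have ti : 0 < t^-1 by rewrite invr_gt0.
rewrite enormZ (gtr0_norm ti) mulrC; apply: H.
rewrite /t; near: n; exact: (cvgr_lt _ rate_cvg).
Unshelve. all: by end_near. Qed.

(** The rescaled path converges to the drift and, by the convergence of the
    rescaled null sets, comes close to the null cone, which is closed. *)
Lemma null_path_drift (Theta0 : set E) theta0 h theta k m (U : 'M[R]_(q, k)) :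
  converges_on_bounded (rescaled Theta0 theta0) (cone0 m U) ->
  null_path Theta0 theta0 h theta -> cone0 m U h.
Proof.
move=> cT np; apply: cone0_closed => e e0.
have rho0 : 0 < enorm h + e by rewrite ltr_wpDl ?enorm_ge0.
have e20 : 0 < e / 2 by rewrite divr_gt0.
have [n [[T1 T2] [H _]]] :=
  filter_ex (filterI (null_path_rescaled np e20) (near_hausdorff cT rho0 e20)).
set x := _ *: _ in T1 T2.
have [|y Cy xy] := H x T1.
  by rewrite -[x](subrK h) (le_trans (enormD _ _))// addrC lerD2l; lra.
exists y => //.
have -> : h - y = (h - x) + (x - y) by rewrite addrA subrK.
rewrite (le_lt_trans (enormD _ _))// (enorm_distC h); lra.
Qed.

End Local.

(** * Size of the test along drifting sequences *)

Lemma lan_error_shift (R : realType) d q (X : experiment R d q) theta0 I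
    (Z : forall n, obs X n -> param R d q) n theta1 h1 h2 (e1 e2 : R) (w : obs X n) :
  (lan_error theta0 I Z theta1 h1 w <= e1%:E)%E ->
  `|lan_form I h1 (@Z n w) - lan_form I h2 (@Z n w)| <= e2 ->
  (lan_error theta0 I Z theta1 h2 w <= (e1 + e2)%:E)%E.
Proof.
rewrite /lan_error /lan_form.
move: (loglik theta0 w) (loglik theta1 w) => a b.
case: a => [a| |]; last 2 first.
- by case: b => [b| |].
- by case: b => [b| |].
case: b => [b| |] //.
rewrite -!EFinB -!EFinD !lee_fin !ler_norml => /andP[h3 h4] /andP[h5 h6].
by apply/andP; split; lra.
Qed.

Section Likelihood_ratio.
Context {R : realType} {d q : nat} {X : experiment R d q}.
Local Notation E := (param R d q).
Variables (theta0 : E) (I : 'End(E)) (Z : forall n, obs X n -> E).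
Arguments Z : clear implicits.
Hypotheses (saI : self_adjoint I) (pdI : positive_definite I).

(** Two valid expansions at the same observation compare the log-likelihoods;
    in particular both are finite. *)
Lemma loglik_difference n theta1 theta2 h1 h2 (eps : R) (w : obs X n) :
  (lan_error theta0 I Z theta1 h1 w <= eps%:E)%E ->
  (lan_error theta0 I Z theta2 h2 w <= eps%:E)%E ->
  (loglik theta1 w - loglik theta2 w <=
    (lan_form I h1 (Z n w) - lan_form I h2 (Z n w) + 2 * eps)%:E)%E.
Proof.
rewrite /lan_error /lan_form.
move: (loglik theta0 w) (loglik theta1 w) (loglik theta2 w) => a b c.
case: a => [a| |]; last 2 first.
- by case: b => [b| |].
- by case: b => [b| |].
case: b => [b| |] //; case: c => [c| |] //.
rewrite -!EFinB -!EFinD !lee_fin !ler_norml => /andP[_ h3] /andP[h4 _].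
lra.
Qed.

Lemma sup_loglik_maximiser (Theta : set E) n (w : obs X n) h : (0 < n)%N ->
  local_maximiser Theta theta0 w h ->
  (sup_loglik Theta w <= loglik (local_point theta0 n h) w)%E.
Proof.
move=> n0 [_ hmax]; apply: ge_ereal_sup => _ [theta th <-].
have := hmax ((rate R n)^-1 *: (theta - theta0)).
by rewrite /rescaled /= local_pointK//; exact.
Qed.

Variables (k m p : nat) (U : 'M[R]_(q, k)) (V : 'M[R]_(k, p)) (c0 : R).
Hypotheses (VV : V^T *m V = 1%:M).
Hypotheses (kmp : (k <= m + p)%N) (c0_gt0 : 0 < c0).
Hypothesis iso : forall B, reduced_covariance I U B = c0 *: B.
Variables (Theta0 Theta1 : set E).
Hypothesis cT0 : converges_on_bounded (rescaled Theta0 theta0) (cone0 m U).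
Hypothesis cT1 : converges_on_bounded (rescaled Theta1 theta0) (cone1 U).

(** The supremum over the alternative set is the value at a bounded maximiser,
    which is close to the alternative cone; the supremum over the null set is at
    least the value at a rescaled null parameter close to the point of the null
    cone given by [lr_bound]. The expansion compares both values with
    [lan_form]. *)
Lemma lr_stat_le (r0 M1 slack : R) : 0 < slack ->
  exists (C : set E) (eps : R), [/\ compact C, 0 < eps &
  \forall n \near \oo, forall w : obs X n,
    (forall h, C h -> (lan_error theta0 I Z (local_point theta0 n h) h w <= eps%:E)%E) ->
    enorm (Z n w) <= r0 ->
    (exists h, local_maximiser Theta1 theta0 w h /\ enorm h <= M1) ->
    (lr_stat Theta0 Theta1 w <=
      (pos_sqnorm (vsval (reduced_score I U V c0 (Z n w))) + slack)%:E)%E].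
Proof.
move=> slack0.
have [M M0 bound] := lr_bound saI pdI VV kmp c0_gt0 iso.
have [MI MI0 IM] := operator_bound I.
pose rho := `|M1| + M * `|r0| + 1.
have rho0 : 0 < rho by rewrite ltr_wpDl// addr_ge0// mulr_ge0.
have [C cC CB] := @compact_covering_ball R d q rho.
pose eps := slack / 8.
have eps0 : 0 < eps by rewrite divr_gt0.
(* [c] bounds the Lipschitz constant of [lan_form] on the ball of radius
   [rho + 1] at scores of norm at most [r0]. *)
pose c := `|r0| + MI * (2 * rho + 1) + 1.
have cc0 : 0 < c.
  by rewrite ltr_wpDl// addr_ge0// mulr_ge0// addr_ge0// mulr_ge0// ltW.
pose eta := Num.min 1 (eps / c).
have eta0 : 0 < eta by rewrite lt_min ltr01 divr_gt0.
exists C, eps; split => //.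
apply: filterS3 (nbhs_infty_gt 0) (near_hausdorff cT0 rho0 eta0)
  (near_hausdorff cT1 rho0 eta0) => n n0 [_ H0] [H1 _] w lanC Zr [h1 [hmax h1M]].
have [hs [hs0 hsM hsB]] := bound (Z n w).
have Zr' : enorm (Z n w) <= `|r0| by rewrite (le_trans Zr)// ler_norm.
have hs_rho : enorm hs <= rho.
  have := ler_wpM2l M0 Zr'; have := normr_ge0 M1; rewrite /rho; lra.
have h1_rho : enorm h1 <= rho.
  have := mulr_ge0 M0 (normr_ge0 r0); have := ler_norm M1; rewrite /rho; lra.
have [hn hnT [hn_rho hns]] := H0 hs hs0 hs_rho.
have [g1 g1c g1h] := H1 h1 hmax.1 h1_rho.
have close x y : enorm x <= rho -> enorm (x - y) < eta ->
    `|lan_form I x (Z n w) - lan_form I y (Z n w)| <= eps.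
  move=> xr xy; apply: le_trans (lan_form_lipschitz saI x y (Z n w) IM) _.
  have xy1 : enorm (x - y) < 1 by rewrite (lt_le_trans xy)// ge_min lexx.
  have yr : enorm y <= rho + 1.
    have -> : y = x - (x - y) by rewrite opprB addrC subrK.
    by rewrite (le_trans (enormD _ _))// enormN; lra.
  have xyc : enorm (x - y) * c <= eps.
    by rewrite -ler_pdivlMr// ltW// (lt_le_trans xy)// ge_min lexx orbT.
  apply: le_trans xyc; apply: ler_wpM2l; first exact: enorm_ge0.
  have := ler_wpM2l MI0 xr; have := ler_wpM2l MI0 yr; rewrite /c; lra.
have c1 := close _ _ h1_rho g1h; have c2 := close _ _ hn_rho hns.
have dl := loglik_difference (lanC h1 (CB _ h1_rho)) (lanC hn (CB _ hn_rho)).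
rewrite /lr_stat.
apply: (@le_trans _ _ (2%:E * (loglik (local_point theta0 n h1) w -
    loglik (local_point theta0 n hn) w))%E).
  apply: lee_wpmul2l; first by rewrite lee_fin.
  apply: leeB; first exact: sup_loglik_maximiser.
  by apply: ereal_sup_ubound; exists (local_point theta0 n hn).
apply: (le_trans (lee_wpmul2l _ dl)); first by rewrite lee_fin.
rewrite -EFinM lee_fin; have := hsB g1 g1c.
move: c1 c2; rewrite !ler_norml => /andP[_ c1] /andP[c2 _].
rewrite /eps in c1 c2 *; lra.
Qed.

End Likelihood_ratio.

Section Bump.
Context {R : realType}.

Definition clamp (x : R) : R := Num.min 1 (Num.max 0 x).

Lemma clamp01 x : 0 <= clamp x <= 1.
Proof. by rewrite /clamp le_min ler01 le_max lexx ge_min lexx. Qed.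

Lemma clamp1 x : 1 <= x -> clamp x = 1.
Proof.
move=> x1; rewrite /clamp; have /max_idPr -> : 0 <= x by exact: le_trans x1.
exact/min_idPl.
Qed.

Lemma clamp0 x : x <= 0 -> clamp x = 0.
Proof. by move=> x0; rewrite /clamp (max_idPl x0) min_r. Qed.

Lemma clamp_continuous (T : topologicalType) (f : T -> R) :
  continuous f -> continuous (fun t => clamp (f t)).
Proof.
move=> cf t; apply: (@continuous_min R T (fun=> 1) (fun t => Num.max 0 (f t))).
  exact: cvg_cst.
apply: (@continuous_max R T (fun=> 0) f); first exact: cvg_cst.
exact: cf.
Qed.

Context {d q : nat}.
Local Notation E := (param R d q).

Lemma enorm_continuous : continuous (@enorm R d q).
Proof.
have -> : @enorm R d q = fun x => enorm (x - 0) by apply/funext => x; rewrite subr0.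
exact: enorm_sub_continuous.
Qed.

(** Convergence in law only sees continuous functions: a continuous substitute
    for the indicator function of a ball. *)
Definition ball_bump (N : nat) (z : E) : R := clamp (N.+1%:R - enorm z).

Lemma ball_bump_continuous N : continuous (ball_bump N).
Proof.
apply: clamp_continuous => z; apply: cvgB; first exact: cvg_cst.
exact: enorm_continuous.
Qed.

Lemma ball_bump_support N z : ball_bump N z != 0 -> enorm z <= N.+1%:R.
Proof.
apply: contraNT; rewrite -ltNge => Nz; apply/eqP/clamp0.
by rewrite subr_le0 ltW.
Qed.

Lemma integral_ball_bump dT (T : measurableType dT) (P : probability T R)
    (Z : T -> E) (f : T -> R) (x : R) : random_element Z ->
  measurable_fun setT f -> (forall w, 0 <= f w) ->
  (x%:E < \int[P]_w (f w)%:E)%E ->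
  exists N, (x%:E < \int[P]_w (ball_bump N (Z w) * f w)%:E)%E.
Proof.
move=> rZ mf f0 xf; pose g N w := (ball_bump N (Z w) * f w)%:E.
have mono w : {homo (fun N => g N w) : N N' / (N <= N')%N >-> (N <= N')%E}.
  move=> N N' NN'; rewrite lee_fin ler_wpM2r// /ball_bump /clamp.
  have NR : N.+1%:R - enorm (Z w) <= N'.+1%:R - enorm (Z w) :> R.
    by rewrite lerD2r ler_nat.
  by rewrite le_min !ge_min lexx /= ge_max !le_max lexx NR !orbT.
have mg N : measurable_fun setT (g N).
  apply/measurable_EFinP; apply: measurable_funM => //.
  exact: measurable_continuous_random rZ (@ball_bump_continuous N).
have g0 N w : setT w -> (0 <= g N w)%E.
  by move=> _; rewrite lee_fin mulr_ge0//; have /andP[] := clamp01 (N.+1%:R - enorm (Z w)).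
have cv := @cvg_monotone_convergence _ T R P setT measurableT g mg g0 (fun w _ => mono w).
have E : (\int[P]_w limn (g^~ w) = \int[P]_w (f w)%:E)%E.
  apply: eq_integral => w _; apply: cvg_lim => //.
  apply: (@cvg_trans _ ((fun=> (f w)%:E) @ \oo)); last exact: cvg_cst.
  apply: near_eq_cvg; near=> N; rewrite /g /ball_bump clamp1 ?mul1r//.
  rewrite -addn1 natrD lerBrDr addrC lerD2r.
  by near: N; exact: nbhs_infty_ger.
rewrite E in cv.
have [N _ HN] := cv _ (open_nbhs_nbhs (conj (@open_ereal_gt_ereal R x%:E) xf)).
by exists N; exact: (HN N (leqnn N)).
Unshelve. all: by end_near. Qed.

End Bump.

Section Local_size.
Context {R : realType} {d q : nat} {X : experiment R d q}.
Local Notation E := (param R d q).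
Variables (theta0 : E) (I : 'End(E)) (Z : forall n, obs X n -> E).
Arguments Z : clear implicits.
Hypotheses (saI : self_adjoint I) (pdI : positive_definite I).
Hypothesis rZ : forall n, random_element (Z n).
Hypothesis ext0 : ext X theta0.
Hypothesis lanC : forall (C : set E) (eps : R), compact C -> 0 < eps ->
  (outer_pr theta0 [set w : obs X n | (eps%:E <
    ereal_sup [set lan_error theta0 I Z (local_point theta0 n h) h w | h in C])%E])
  @[n --> \oo] --> 0%E.
Context {dT : measure_display} {T : measurableType dT}.
Variables (P : probability T R) (Zlim : T -> E).
Hypothesis gZ : centred_gaussian P I Zlim.
Hypothesis cvZ : converges_in_law theta0 Z P Zlim.
Variables (k m p : nat) (U : 'M[R]_(q, k)) (c0 : R).
Hypothesis kmp : (k = m + p)%N.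
Hypothesis c0_gt0 : 0 < c0.
Hypothesis iso : forall B, reduced_covariance I U B = c0 *: B.
Variables (Theta0 Theta1 : set E).
Hypothesis cT0 : converges_on_bounded (rescaled Theta0 theta0) (cone0 m U).
Hypothesis cT1 : converges_on_bounded (rescaled Theta1 theta0) (cone1 U).
Context {dG : measure_display} {TG : measurableType dG}.
Variables (PG : probability TG R) (G : TG -> sym R p) (alpha c : R).
Hypothesis sG : sym_gaussian PG G.
Hypothesis level : forall e : R, 0 < e -> exists2 c', c' < c &
  ((1 - alpha - e)%:E <= PG (pos_sqnorm_le_set G c'))%E.
Variables (K : Type) (theta : K -> nat -> E) (drift : K -> E).
Hypothesis ext_theta : \forall n \near \oo, forall k, ext X (theta k n).
Hypothesis weak_lan : lan_bounded theta0 I Z theta drift.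
Hypothesis localised1 : localised_along X Theta1 theta0 theta.

(** Let [V] span the directions that the active block of [h] does not see. Off
    events that are negligible under [theta0], a statistic above [c] forces the
    bump [chi] to vanish, because [lr_stat_le] bounds the statistic by
    [pos_sqnorm] of the reduced score. By [lan_transfer] this has probability at
    most one minus the tilted mass of the bump under the drifting law, and by
    [tilted_pos_sqnorm] the tilt does not change the law of the reduced score,
    whose mass below [c] is nearly [1 - alpha]. *)
Lemma local_size (h : E) (e : R) : cone0 m U h -> 0 < e -> exists2 eta : R, 0 < eta &
  \forall n \near \oo, forall k, enorm (drift k - h) < eta ->
  (outer_pr (theta k n) [set w : obs X n | c%:E < lr_stat Theta0 Theta1 w]
    <= (alpha + e)%:E)%E.
Proof.
move=> [psdh rankh] e0.
have [|V [VV hV]] := @kernel_orthonormal R k m p _ (vsval_trmx (compress U h.2)) rankh.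
  by rewrite kmp.

have e4 : 0 < e / 4 by rewrite divr_gt0.
have [c1 c1c c1level] := level e4.
pose slack := (c - c1) / 2.
have slack0 : 0 < slack by rewrite divr_gt0// subr_gt0.
pose W : 'Hom(E, sym R p) := reduced_score I U V c0.
pose f (z : E) : R := pos_sqnorm (vsval (W z)).
pose f_bump (z : E) : R := clamp ((c - slack - f z) / slack).
have f_bump_support z : f_bump z != 0 -> f z <= c - slack.
  apply: contraNT; rewrite -ltNge => fz; apply/eqP/clamp0.
  by rewrite pmulr_lle0 ?invr_gt0// subr_le0 ltW.
have f_bump1 z : f z <= c1 -> f_bump z = 1.
  by move=> fz; apply: clamp1; rewrite ler_pdivlMr// /slack in slack0 *; lra.
have cf : continuous f by exact: reduced_score_continuous.
have cfb : continuous f_bump.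
  apply: clamp_continuous => z; apply: cvgM; last exact: cvg_cst.
  by apply: cvgB; [exact: cvg_cst|exact: cf].
have rZl : random_element Zlim by case: gZ.
have mcont g : continuous g -> measurable_fun setT (fun w => g (Zlim w) : R).
  exact: measurable_continuous_random rZl.
have cexp : continuous (fun z => expR (lan_form I h z)).
  move=> z; apply: (@continuous_comp _ _ _ (lan_form I h) expR); last exact: continuous_expR.
  exact: lan_form_continuous.
have cfe : continuous (fun z => f_bump z * expR (lan_form I h z)).
  by move=> z; apply: cvgM; [exact: cfb|exact: cexp].
have mass : ((1 - alpha - e / 2)%:E <
    \int[P]_w (f_bump (Zlim w) * expR (lan_form I h (Zlim w)))%:E)%E.
  apply: (@lt_le_trans _ _ (1 - alpha - e / 4)%:E); first by rewrite lte_fin; lra.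
  apply: (le_trans c1level).
  have sW : sym_gaussian P (fun w => W (Zlim w)).
    apply: (@sym_gaussian_reduced R d q p dT T P I Zlim pdI gZ (reduced_lift I U V c0)).
      exact: reduced_lift_isometry.
    by move=> t w; exact: inner_reduced_lift.
  have gD t u : reduced_lift I U V c0 (t + u) =
      reduced_lift I U V c0 t + reduced_lift I U V c0 u by rewrite linearD.
  have gZl a t : reduced_lift I U V c0 (a *: t) = a *: reduced_lift I U V c0 t.
    by rewrite linearZ.
  rewrite -(tilted_pos_sqnorm saI pdI gZ gD gZl
    (reduced_lift_isometry saI pdI VV c0_gt0 iso)
    (fun t => reduced_lift_orthogonal c0 saI pdI t hV)
    (fun t w => inner_reduced_lift U V c0 saI pdI t (Zlim w)) sG).
  apply: ge0_le_integral => //.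
  - apply/measurable_EFinP; apply: measurable_funM.
      by apply: measurable_indic; exact: measurable_pos_sqnorm_le sW.
    exact: mcont cexp.
  - by apply/measurable_EFinP; exact: mcont cfe.
  move=> w _; rewrite lee_fin ler_wpM2r ?expR_ge0//.
  rewrite indicE; case: (boolP (_ \in _)) => [|_].
    by rewrite inE => fw; rewrite f_bump1.
  by have /andP[] := clamp01 ((c - slack - f (Zlim w)) / slack).
have [N massN] : exists N, ((1 - alpha - e / 2)%:E <
    \int[P]_w (ball_bump N (Zlim w) * (f_bump (Zlim w) * expR (lan_form I h (Zlim w))))%:E)%E.
  apply: integral_ball_bump => //; first exact: mcont cfe.
  move=> w; rewrite mulr_ge0 ?expR_ge0//.
  by have /andP[] := clamp01 ((c - slack - f (Zlim w)) / slack).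
pose chi z := ball_bump N z * f_bump z.
have cchi : continuous chi.
  by move=> z; apply: cvgM; [exact: ball_bump_continuous|exact: cfb].
have chi01 z : 0 <= chi z <= 1.
  have /andP[a0 a1] := clamp01 (N.+1%:R - enorm z).
  have /andP[b0 b1] := clamp01 ((c - slack - f z) / slack).
  by rewrite mulr_ge0//= mulr_ile1.
have chi_supp z : chi z != 0 -> enorm z <= N.+1%:R.
  by rewrite mulf_eq0 negb_or => /andP[/ball_bump_support].
have mass_chi : ((1 - alpha - e / 2)%:E <
    \int[P]_w (chi (Zlim w) * expR (lan_form I h (Zlim w)))%:E)%E.
  by move: massN; under eq_integral do rewrite mulrA.
have [eta [del [eta0 del0 transfer]]] :=
  lan_transfer saI pdI rZ ext0 cvZ ext_theta weak_lan cchi chi01 chi_supp mass_chi.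
have [hhat /(_ _ e4)[M1 locM]] := localised1.
have kmp' : (k <= m + p)%N by rewrite kmp.
have [C [eps [cC eps0 lrle]]] :=
  lr_stat_le Z saI pdI VV kmp' c0_gt0 iso cT0 cT1 N.+1%:R M1 slack0.
have badn := outer_pr_near0 (lanC cC eps0) del0.
exists eta => //; apply: filterS2 (filterI badn (locM : \forall n \near \oo, _))
  (filterI transfer lrle) => n [Ddel Le] [tr lr].
set D := [set w | _] in Ddel.
move=> k' k'h.
pose L := [set w : obs X n | ~ (local_maximiser Theta1 theta0 w (hhat n w) /\
  enorm (hhat n w) <= M1)].
have sub : [set w : obs X n | (c%:E < lr_stat Theta0 Theta1 w)%E] `<=`
    (D `|` [set w | chi (Z n w) = 0]) `|` L.
  move=> w /= cw; apply: contrapT => /not_orP[/not_orP[nD /eqP chi0] nL].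
  have {}nL := contrapT nL.
  move: cw; apply/negP; rewrite -leNgt.
  apply: (le_trans (lr w _ (chi_supp _ chi0) _)).
  - move=> g Cg; rewrite leNgt; apply/negP => lt_e; apply: nD.
    by apply: lt_le_trans lt_e _; apply: ereal_sup_ubound; exists g.
  - by exists (hhat n w).
  have fz : f (Z n w) <= c - slack.
    by apply: f_bump_support; move: chi0; rewrite mulf_eq0 negb_or => /andP[].
  by rewrite lee_fin; rewrite /f /W in fz; lra.
apply: le_trans (outer_pr_le _ sub) _.
apply: le_trans (outer_prU _ _ _) _.
apply: le_trans (leeD (tr k' k'h D Ddel) (Le k')) _.
by rewrite -EFinD lee_fin; lra.
Qed.

(** Compactness turns [local_size] into a uniform bound; a point of [C] outside
    the null cone has a neighbourhood without drifts, the cone being closed. *)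
Lemma uniform_size (C : set E) (e : R) : compact C -> (forall k, C (drift k)) ->
  (forall k, cone0 m U (drift k)) -> 0 < e -> \forall n \near \oo, forall k,
  (outer_pr (theta k n) [set w : obs X n | c%:E < lr_stat Theta0 Theta1 w]
    <= (alpha + e)%:E)%E.
Proof.
move=> /compact_near_coveringP cover Cdrift cdrift e0.
pose Q (n : nat) (h : E) := forall k, drift k = h ->
  (outer_pr (theta k n) [set w : obs X n | c%:E < lr_stat Theta0 Theta1 w]
    <= (alpha + e)%:E)%E.
have : \forall n \near \oo, C `<=` Q n.
  apply: cover => h Ch; have [ch|nch] := pselect (cone0 m U h).
    have [eta eta0 H] := local_size ch e0.
    exists ([set x | enorm (x - h) < eta], [set n | forall k, enorm (drift k - h) < eta ->
      (outer_pr (theta k n) [set w : obs X n | c%:E < lr_stat Theta0 Theta1 w]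
        <= (alpha + e)%:E)%E]).
      by split; [exact: nbhs_enorm|exact: H].
    by move=> [x n] /= [xh Hn] i ix; apply: Hn; rewrite ix.
  have [e' e'0 He'] : exists2 e' : R, 0 < e' & forall h', cone0 m U h' -> e' <= enorm (h - h').
    apply: contrapT => H; apply: nch; apply: cone0_closed => e' e'0.
    apply: contrapT => H'; apply: H; exists e' => // h' ch'.
    by rewrite leNgt; apply/negP => hh'; apply: H'; exists h'.
  exists ([set x | enorm (x - h) < e'], setT).
    by split; [exact: nbhs_enorm|exact: filterT].
  move=> [x n] /= [xh _] i ix; have := He' _ (cdrift i).
  by rewrite ix enorm_distC leNgt xh.
by apply: filterS => n CQ i; apply: (CQ (drift i)).
Qed.

End Local_size.

Section Fixed_path.
Context {R : realType} {d q : nat} {X : experiment R d q}.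
Local Notation E := (param R d q).
Variables (theta0 : E) (I : 'End(E)) (Z : forall n, obs X n -> E).
Arguments Z : clear implicits.
Hypotheses (saI : self_adjoint I) (pdI : positive_definite I).
Hypothesis rZ : forall n, random_element (Z n).
Hypothesis ext0 : ext X theta0.
Hypothesis lanC : forall (C : set E) (eps : R), compact C -> 0 < eps ->
  (outer_pr theta0 [set w : obs X n | (eps%:E <
    ereal_sup [set lan_error theta0 I Z (local_point theta0 n h) h w | h in C])%E])
  @[n --> \oo] --> 0%E.
Context {dT : measure_display} {T : measurableType dT}.
Variables (P : probability T R) (Zlim : T -> E).
Hypothesis gZ : centred_gaussian P I Zlim.
Hypothesis cvZ : converges_in_law theta0 Z P Zlim.
Variables (Theta0 : set E) (h : E) (path : R -> E).
Hypothesis ext_null : Theta0 `<=` ext X.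
Hypothesis np : null_path Theta0 theta0 h path.

Local Notation theta := (fun (_ : unit) n => path (rate R n)).

Lemma null_path_ext : \forall n \near \oo, forall k, ext X (theta k n).
Proof.
near=> n; move=> _; apply: ext_null; apply: np.1; apply: rate_gt0.
by near: n; exact: nbhs_infty_gt.
Unshelve. all: by end_near. Qed.

(** Along a single path the expansion follows from the one that is uniform on
    compact sets, because the rescaled path stays in a ball. *)
Lemma null_path_weak_lan : lan_bounded theta0 I Z theta (fun=> h).
Proof.
move=> r eps del eps0 del0.
have [M M0 IM] := operator_bound I.
have [C cC CB] := @compact_covering_ball R d q (enorm h + 1).
(* [b] bounds the Lipschitz constant of [lan_form] on the unit ball around [h]
   at scores of norm at most [r]. *)
pose b := `|r| + M * (2 * enorm h + 1) + 1.
have b0 : 0 < b by rewrite ltr_wpDl// addr_ge0// mulr_ge0// addr_ge0 ?mulr_ge0 ?enorm_ge0.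
have eps2 : 0 < eps / 2 by rewrite divr_gt0.
pose eta := Num.min 1 (eps / 2 / b).
have eta0 : 0 < eta by rewrite lt_min ltr01 divr_gt0.
apply: filterS3 (nbhs_infty_gt 0) (null_path_rescaled np eta0)
  (outer_pr_near0 (lanC cC eps2) del0) => n n0 [_ hn] Dn _.
apply: le_trans Dn; apply: outer_pr_le => w /= [we wr].
rewrite ltNge; apply/negP => sup_le; move: we; apply/negP; rewrite -leNgt.
set hn' := _ *: _ in hn.
have h1 : enorm (hn' - h) < 1 by rewrite (lt_le_trans hn)// ge_min lexx.
have hn1 : enorm hn' <= enorm h + 1.
  by rewrite -[hn'](subrK h) (le_trans (enormD _ _))// addrC lerD2l ltW.
have le1 : (lan_error theta0 I Z (path (rate R n)) hn' w <= (eps / 2)%:E)%E.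
  apply: le_trans sup_le; apply: ereal_sup_ubound; exists hn'; first exact: CB.
  by rewrite local_pointK.
rewrite [eps]splitr; apply: lan_error_shift le1 _.
apply: le_trans (lan_form_lipschitz saI hn' h (Z n w) IM) _.
have hb : enorm (hn' - h) * b <= eps / 2.
  by rewrite -ler_pdivlMr// ltW// (lt_le_trans hn)// ge_min lexx orbT.
apply: le_trans hb; apply: ler_wpM2l; first exact: enorm_ge0.
have := ler_wpM2l M0 hn1; have := ler_norm r; rewrite /b; lra.
Qed.

(** Stochastic boundedness under [theta0] is inherited under the drifting laws,
    by contiguity. *)
Lemma null_path_localised (Theta : set E) :
  localised X Theta theta0 -> localised_along X Theta theta0 theta.
Proof.
move=> [hhat loc]; exists hhat => e e0.
have rZl : random_element Zlim by case: gZ.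
have cexp : continuous (fun z => expR (lan_form I h z)).
  move=> z; apply: (@continuous_comp _ _ _ (lan_form I h) expR); last exact: continuous_expR.
  exact: lan_form_continuous.
have [N massN] : exists N, ((1 - e)%:E <
    \int[P]_w (ball_bump N (Zlim w) * expR (lan_form I h (Zlim w)))%:E)%E.
  apply: integral_ball_bump => //.
    exact: measurable_continuous_random rZl cexp.
  have -> : (\int[P]_w (expR (lan_form I h (Zlim w)))%:E = 1)%E.
    exact: tilted_total.
  by rewrite lte_fin; lra.
have [eta [del [eta0 del0 transfer]]] := @lan_transfer R d q X theta0 I Z saI pdI rZ ext0
  dT T P Zlim cvZ unit theta (fun=> h) null_path_ext null_path_weak_lan
  _ _ _ _ (@ball_bump_continuous R d q N) (fun z => clamp01 _)
  (@ball_bump_support R d q N) massN.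
have [M locM] := loc _ del0.
exists M; apply: filterS2 (locM : \forall n \near \oo, _) transfer => n Dn tr k.
rewrite subrr enorm0 in tr.
have := tr k eta0 _ (Dn k); rewrite subKr; apply: le_trans.
by apply: outer_pr_le => w; left.
Qed.

End Fixed_path.

(** * Asymptotic size of the critical value *)

Theorem corollary3p11 (R : realType) (d q r : nat) (r_lt_q : (r < q)%N)
    (X : experiment R d q) (Theta0 Theta1 : set (param R d q))
    (sub01 : Theta0 `<=` Theta1) (sub1 : Theta1 `<=` ext X)
    (null_set : Theta0 `<=` [set theta | psd_rank_le r theta.2])
    (alternative_set : Theta1 `<=` [set theta | psd theta.2])
    (isotropic : isotropic_experiment X Theta0 r)
    (dG : measure_display) (TG : measurableType dG) (PG : probability TG R)
    (G : TG -> sym R (q - r)) (gaussianG : standard_gaussian PG G)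
    (alpha : R) (alpha_gt0 : 0 < alpha) (alpha_lt1 : alpha < 1)
    (c : R) (critical : c = upper_critical (top_stratum_cdf PG G) alpha)
    (c_gt0 : 0 < c)
    (theta0 : param R d q) (theta0_null : Theta0 theta0)
    (s : nat) (s_le_r : (s <= r)%N) (rank_s : \rank (vsval theta0.2) = s)
    (U : 'M[R]_(q, q - s)) (frame : kernel_frame theta0.2 U)
    (local_extension : nbhs theta0 (ext X))
    (I : 'End(param R d q)) (Z : forall n, obs X n -> param R d q)
    (LAN : lan theta0 I Z)
    (set_convergence : local_set_convergence r Theta0 Theta1 theta0 U) :
  (localised X Theta0 theta0 -> localised X Theta1 theta0 ->
   forall (drift : param R d q) (theta : R -> param R d q),
     null_path Theta0 theta0 drift theta ->
     (limn_esup (fun n : nat => outer_pr (theta (rate R n))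
        [set w : obs X n | c%:E < lr_stat Theta0 Theta1 w]) <= alpha%:E)%E)
  /\
  (forall (K : Type) (drift : K -> param R d q)
      (theta : K -> R -> param R d q) (C : set (param R d q)),
     compact C -> (forall k, C (drift k)) ->
     (forall k, null_path Theta0 theta0 (drift k) (theta k)) ->
     lan_along theta0 I Z (fun k n => theta k (rate R n)) drift ->
     localised_along X Theta0 theta0 (fun k n => theta k (rate R n)) ->
     localised_along X Theta1 theta0 (fun k n => theta k (rate R n)) ->
     (limn_esup (fun n : nat => ereal_sup
        [set outer_pr (theta k (rate R n))
           [set w : obs X n | c%:E < lr_stat Theta0 Theta1 w] | k in setT])
      <= alpha%:E)%E).
Proof.
have [[saI pdI] rZ lanC [dT [T [P [Zlim [gZ cvZ]]]]]] := LAN.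
have [cT0 cT1] := set_convergence.
have ext0 : ext X theta0 by apply: sub1; exact: sub01.
have ext_null : Theta0 `<=` ext X by move=> x /sub01 /sub1.
have k0 : (0 < q - s)%N by rewrite subn_gt0 (leq_ltn_trans s_le_r).
have p0 : (0 < q - r)%N by rewrite subn_gt0.
have kmp : (q - s = (r - s) + (q - r))%N by lia.
have [c0 iso] := isotropic s theta0 U I Z s_le_r theta0_null rank_s local_extension frame LAN.
have {}iso B : reduced_covariance I U B = c0 *: B.
  by rewrite iso scale_lfunE id_lfunE.
have c00 := isotropic_scale_gt0 pdI frame.1 k0 iso.
have level := critical_value_left p0 gaussianG critical c_gt0.
have sG := standard_sym_gaussian gaussianG.
have uniform K := @uniform_size R d q X theta0 I Z saI pdI rZ ext0 lanC dT T P Zlim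
  gZ cvZ _ _ _ U c0 kmp c00 iso Theta0 Theta1 cT0 cT1 dG TG PG G alpha c sG level K.
split.
- move=> _ loc1 drift path np.
  have size e := uniform unit (fun _ n => path (rate R n)) (fun=> drift)
    (null_path_ext ext_null np)
    (null_path_weak_lan saI lanC np)
    (null_path_localised saI pdI rZ ext0 lanC gZ cvZ ext_null np loc1)
    [set drift] e (@compact_set1 _ drift) (fun=> erefl)
    (fun=> null_path_drift cT0 np).
  apply: limn_esup_le => e e0.
  by apply: filterS (size e e0) => n; apply; exact: tt.
move=> K drift path C cC Cdrift np lanK _ loc1.
have ext_path : \forall n \near \oo, forall k, ext X (path k (rate R n)).
  near=> n; move=> k; apply: ext_null; apply: (np k).1; apply: rate_gt0.
  by near: n; exact: nbhs_infty_gt.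
have weak : lan_bounded theta0 I Z (fun k n => path k (rate R n)) drift.
  move=> a eps del eps0 del0; have d0 : (0 < del%:E)%E by rewrite lte_fin.
  have : \forall n \near \oo, (ereal_sup [set outer_pr theta0 [set w : obs X n |
        (eps%:E < lan_error theta0 I Z (path k (rate R n)) (drift k) w)%E] | k in setT]
        < del%:E)%E.
    exact: (lanK _ eps0 _ (open_nbhs_nbhs (conj (@open_ereal_lt_ereal R del%:E) d0))).
  apply: filterS => n /ltW supn k; apply: le_trans supn.
  apply: le_trans (ereal_sup_ubound _); last by exists k.
  by apply: outer_pr_le => w [].
have size e := uniform K (fun k n => path k (rate R n)) drift
    ext_path weak loc1 C e cC Cdrift
    (fun k => null_path_drift cT0 (np k)).
apply: limn_esup_le => e e0; apply: filterS (size e e0) => n sizen.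
by apply: ge_ereal_sup => _ [k _ <-]; exact: sizen.
Unshelve. all: by end_near. Qed.
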